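(* Let $X:M^n\looparrowright\mathbb{R}^{n+p}_p$ be a complete noncompact spacelike self-shrinker. If the second fundamental form $A$ of $M^n$ is such that $|A|$ converges to zero at infinity, then $M^n$ is an $n$-dimensional spacelike hyperplane of $\mathbb{R}^{n+p}_p$.
   Context: $\mathbb{R}^{n+p}_{p}$ is the linear space $\mathbb{R}^{n+p}$ endowed with the indefinite flat metric $\langle\,,\rangle=\sum_{i=1}^{n}(dx_i)^2-\sum_{\alpha=n+1}^{n+p}(dx_\alpha)^2$. A spacelike submanifold $X:M^n\looparrowright\mathbb{R}^{n+p}_p$ is a smooth immersion of a connected $n$-dimensional manifold whose induced metric is Riemannian (positive definite); its normal bundle is then negative definite. It is complete if the induced Riemannian metric is complete. Choose local orthonormal frames $\{e_i\}_{1\le i\le n}$ of $TM$ (spacelike) and $\{e_\alpha\}_{n+1\le\alpha\le n+p}$ of $TM^\perp$ (timelike, $\langle e_\alpha,e_\beta\rangle=-\delta_{\alpha\beta}$). The second fundamental form $A$ has values $A_{ij}=(\overline{\nabla}_{e_i}e_j)^\perp=\sum_\alpha h^\alpha_{ij}e_\alpha$, where $\overline{\nabla}$ is the flat connection of $\mathbb{R}^{n+p}_p$; its norm is the nonnegative quantity given by $|A|^2=\sum_{i,j,\alpha}(h^\alpha_{ij})^2$. The (non-normalized) mean curvature vector is $\vec{H}=\sum_\alpha\left(\sum_k h^\alpha_{kk}\right)e_\alpha$. $M^n$ is a spacelike self-shrinker if $\vec{H}=-\frac12X^\perp$, where $X^\perp$ is the normal part of the position vector $X$. On a complete noncompact Riemannian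 manifold $M^n$ with Riemannian distance $d(\cdot,o)$ from a fixed point $o\in M^n$, a function $u$ converges to zero at infinity if $\lim_{d(x,o)\to+\infty}u(x)=0$. ''$M^n$ is an $n$-dimensional spacelike hyperplane of $\mathbb{R}^{n+p}_p$'' means that $X(M)$ is an $n$-dimensional affine plane of $\mathbb{R}^{n+p}_p$ on which the metric is positive definite. *)

(* Defs.v *)
From HB Require Import structures.
From mathcomp Require Import all_boot all_order all_algebra.
From mathcomp Require Import all_classical all_reals all_analysis.

Set Implicit Arguments.
Unset Strict Implicit.
Unset Printing Implicit Defensive.

Import Order.TTheory GRing.Theory Num.Theory.
Import numFieldNormedType.Exports.

Local Open Scope classical_set_scope.
Local Open Scope ring_scope.

Section Smooth.
Context {R : realType} {V W : normedModType R}.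

Definition iter_derive (vs : seq V) (f : V -> W) : V -> W :=
  foldr (fun v g => 'D_v g) f vs.

(* C^oo on U, meant for open U.  When V is finite-dimensional, f is infinitely
   differentiable on U iff all its iterated directional derivatives are
   (Frechet) differentiable there. *)
Definition smooth_on (U : set V) (f : V -> W) : Prop :=
  forall (vs : seq V) x, U x -> differentiable (iter_derive vs f) x.
End Smooth.

(* chart_inv is only meaningful on chart_fun @` chart_dom. *)
Record chart (R : realType) (n : nat) (M : topologicalType) := Chart {
  chart_dom : set M;
  chart_fun : M -> 'rV[R]_n;
  chart_inv : 'rV[R]_n -> M;
  open_chart_dom : open chart_dom;
  open_chart_cod : open (chart_fun @` chart_dom);
  chart_funK : forall x, chart_dom x -> chart_inv (chart_fun x) = x;
  continuous_chart_fun :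
    forall x, chart_dom x -> {for x, continuous chart_fun};
  continuous_chart_inv :
    forall u, (chart_fun @` chart_dom) u -> {for u, continuous chart_inv}
}.

Definition chart_cod {R : realType} {n : nat} {M : topologicalType}
  (c : chart R n M) : set 'rV[R]_n := chart_fun c @` chart_dom c.

(* The preferred charts chart_at only serve to write pointwise objects in
   coordinates: immersions, normal parts, mean curvature, |A|, smooth curves
   and distances do not depend on them. *)
Record smooth_manifold (R : realType) (n : nat) := SmoothManifold {
  carrier :> topologicalType;
  manifold_hausdorff : hausdorff_space carrier;
  manifold_second_countable : @second_countable carrier;
  atlas : set (chart R n carrier);
  transition_smooth : forall c d, atlas c -> atlas d ->
    smooth_on (chart_fun c @` (chart_dom c `&` chart_dom d))
              (chart_fun d \o chart_inv c);
  chart_at : carrier -> chart R n carrier;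
  chart_at_atlas : forall x, atlas (chart_at x);
  chart_at_dom : forall x, chart_dom (chart_at x) x
}.

Section PseudoEuclidean.
Context {R : realType} {n p : nat}.

Definition ip (x y : 'rV[R]_(n + p)) : R :=
  \sum_(i < n) x 0 (lshift p i) * y 0 (lshift p i)
  - \sum_(a < p) x 0 (rshift n a) * y 0 (rshift n a).

Definition is_spacelike_plane (S : set 'rV[R]_(n + p)) : Prop :=
  exists (a : 'rV[R]_(n + p)) (P : 'M[R]_(n, n + p)),
    [/\ row_free P,
        forall v : 'rV[R]_n, v != 0 -> 0 < ip (v *m P) (v *m P)
      & S = [set a + v *m P | v in [set: 'rV[R]_n]]].
End PseudoEuclidean.

Section Submanifold.
Context {R : realType} {n p : nat} (M : smooth_manifold R n).
Variable X : M -> 'rV[R]_(n + p).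

Definition smooth_map : Prop :=
  forall c, atlas (s := M) c -> smooth_on (chart_cod c) (X \o chart_inv c).

Definition local_expr (x : M) : 'rV[R]_n -> 'rV[R]_(n + p) :=
  X \o chart_inv (chart_at x).

Definition coord (x : M) : 'rV[R]_n := chart_fun (chart_at x) x.

(* Tangent vectors at x are represented by their coordinates in chart_at x. *)
Definition dX (x : M) (v : 'rV[R]_n) : 'rV[R]_(n + p) :=
  'D_v (local_expr x) (coord x).

Definition induced_metric (x : M) (v w : 'rV[R]_n) : R := ip (dX x v) (dX x w).

Definition spacelike_immersion : Prop :=
  [/\ smooth_map,
      forall x, injective (dX x)
    & forall x v, v != 0 -> 0 < induced_metric x v v].

Definition normal (x : M) (z : 'rV[R]_(n + p)) : Prop :=
  forall v, ip (dX x v) z = 0.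

(* For a spacelike immersion, w splits uniquely as tangent plus normal. *)
Definition normal_part (x : M) (w : 'rV[R]_(n + p)) : 'rV[R]_(n + p) :=
  get [set z | normal x z /\ exists v, w = dX x v + z].

(* (nabla_v W)^perp for the vector field W extending w with constant
   coordinates in chart_at x; any other extension has the same normal part. *)
Definition second_fundamental_form (x : M) (v w : 'rV[R]_n) :
    'rV[R]_(n + p) :=
  normal_part x ('D_v ('D_w (local_expr x)) (coord x)).

(* Row i of E is the coordinate vector of e_i. *)
Definition is_tangent_frame (x : M) (E : 'M[R]_n) : Prop :=
  forall i j, induced_metric x (row i E) (row j E) = (i == j)%:R.

Definition is_normal_frame (x : M) (N : 'M[R]_(p, n + p)) : Prop :=
  (forall a, normal x (row a N)) /\
  (forall a b, ip (row a N) (row b N) = - (a == b)%:R).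

(* Frames are chosen point by point; the mean curvature vector and |A| do not
   depend on the choice. *)
Definition tangent_frame (x : M) : 'M[R]_n := get (is_tangent_frame x).

Definition normal_frame (x : M) : 'M[R]_(p, n + p) := get (is_normal_frame x).

(* The sign comes from <e_a, e_b> = - delta_ab: this is the coefficient in
   A_ij = \sum_a h^a_ij e_a. *)
Definition h_coef (x : M) (a : 'I_p) (i j : 'I_n) : R :=
  - ip (second_fundamental_form x (row i (tangent_frame x))
                                  (row j (tangent_frame x)))
       (row a (normal_frame x)).

Definition norm_A (x : M) : R :=
  Num.sqrt (\sum_(i < n) \sum_(j < n)
    \sum_(a < p) h_coef x a i j ^+ 2).

Definition mean_curvature (x : M) : 'rV[R]_(n + p) :=
  \sum_(a < p) (\sum_(k < n) h_coef x a k k) *: row a (normal_frame x).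

Definition self_shrinker : Prop :=
  forall x, mean_curvature x = - 2^-1 *: normal_part x (X x).

(* Smooth on a neighbourhood of each point of [0, 1]. *)
Definition smooth_curve (g : R -> M) : Prop :=
  forall t, `[0, 1]%classic t -> {for t, continuous g} /\
    exists2 U : set R, open_nbhs t U &
      smooth_on U (chart_fun (chart_at (g t)) \o g).

(* The speed of g for the induced metric is sqrt <(X o g)', (X o g)'>. *)
Definition arc_length (g : R -> M) : R :=
  \int[lebesgue_measure]_(t in `[0%R, 1%R])
     Num.sqrt (ip ('D_1 (X \o g) t) ('D_1 (X \o g) t)).

(* Lengths of the piecewise smooth curves from x to y, each smooth piece being
   parametrized by [0, 1]. *)
Inductive path_length (x : M) : M -> R -> Prop :=
| path_length_nil : path_length x x 0
| path_length_cons l g : path_length x (g 0) l -> smooth_curve g ->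
    path_length x (g 1) (l + arc_length g).

Definition riemannian_dist (x y : M) : R := inf [set l | path_length x y l].

Definition complete_metric : Prop :=
  forall s : nat -> M,
    (forall e, 0 < e -> exists N : nat, forall j k : nat,
       (N <= j)%N -> (N <= k)%N -> riemannian_dist (s j) (s k) < e) ->
    exists x, riemannian_dist (s k) x @[k --> \oo] --> 0.

Definition converges_to_zero_at_infinity (o : M) (u : M -> R) : Prop :=
  forall e, 0 < e -> exists r : R,
    forall x, r < riemannian_dist x o -> `|u x| < e.
End Submanifold.

(* Main.v *)
(** For a spacelike tangent space T and any w, the number |w^perp|^2 is the
    maximum of - <w - V, w - V> over V in T, because the normal space is negative
    definite.  Hence suprema of |X^perp|^2 and of the second fundamental form can
    be tested with smooth fields X - V and D_v D_v X - V, V tangent, and no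
    projection has to be differentiated.

    A Hopf-Rinow argument shows that closed balls are compact, so, as |A| tends
    to zero and |X^perp|^2 <= C |A|^2, both suprema are attained if positive.
    Step 1: at a positive maximum of |X^perp|^2 the first and second variations,
    combined with the derivative of the self-shrinker equation, are
    contradictory; so X is tangent to M everywhere.
    Step 2: X is then a tangent field under whose flow |A(v, v)|, for unit v,
    scales by a negative power, so it has no positive maximum and A = 0.
    Step 3: the tangent spaces are locally constant by Gronwall's inequality, so
    X(M) lies in the linear spacelike space T_o; Ekeland's principle applied to
    the distance of X to a point of T_o shows that X(M) = T_o. *)

(* The preferred charts and frames are chosen point by point with no continuity, so nothing built
   from [chart_at], [tangent_frame] or [normal_frame] can be differentiated. The self-shrinker
   equation is therefore read as a tangency: the trace of the second derivative plus half of the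
   position is a tangent vector. It is differentiated by dividing a family of tangent vectors by the
   parameter of a line; local coercivity of the metric bounds their coefficients, so tangency
   survives in the limit.

   Step 2 has a simple picture: when [X] is tangent, its flow acts on the image by dilations, so the
   image is locally a cone, and the second fundamental form of a cone has degree -1.

   No geodesic is constructed. In the Hopf-Rinow part too, completeness enters through Ekeland's
   principle, applied there to the largest radius of compact balls. Ekeland's principle needs
   convergence for the distance to imply convergence in [M]; this comparison of topologies is the
   purpose of the bump functions. *)
Require Import Defs.
From HB Require Import structures.
From mathcomp Require Import all_boot all_order all_algebra.
From mathcomp Require Import all_classical all_reals all_analysis.
From mathcomp Require Import ring lra.

Set Implicit Arguments.
Unset Strict Implicit.
Unset Printing Implicit Defensive.

Import Order.TTheory GRing.Theory Num.Theory.
Import numFieldNormedType.Exports.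

Local Open Scope classical_set_scope.
Local Open Scope ring_scope.

(** * Linear algebra of spacelike subspaces *)

Section LinearAlgebra.
Context {R : realType}.

(** Gram-Schmidt by induction on the dimension. The rows [row_mx (v *m k) v] are orthogonal to the
    first basis vector, and on them the form is the Schur complement [S], which inherits
    positivity. *)
Lemma symmetric_posdef_orthonormal (n : nat) (G : 'M[R]_n) : G^T = G ->
  (forall v : 'rV_n, v != 0 -> 0 < (v *m G *m v^T) 0 0) ->
  exists E : 'M[R]_n, E *m G *m E^T = 1%:M.
Proof.
elim: n G => [|n IH] G symG posG.
  by exists 0; apply/matrixP => -[].
rewrite -[n.+1]/(1 + n)%N in G symG posG *.
pose a := G 0 0; pose b := ursubmx G; pose D := drsubmx G.
have aE : ulsubmx G = a%:M.
  rewrite [LHS]mx11_scalar; congr (_%:M); rewrite !mxE /a.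
  by congr (G _ _); apply: val_inj.
have GE : G = block_mx a%:M b b^T D.
  by rewrite -[LHS]submxK aE; congr block_mx; rewrite /b trmx_ursub symG.
have symD : D^T = D by rewrite /D trmx_drsub symG.
have a_gt0 : 0 < a.
  have := posG (row_mx 1%:M 0).
  rewrite GE mul_row_block !(mul1mx, mul0mx, addr0).
  rewrite tr_row_mx mul_row_col trmx1 trmx0 mulmx1 mulmx0 addr0 mxE eqxx.
  apply; apply/eqP => /(congr1 lsubmx); rewrite row_mxKl => /matrixP/(_ 0 0).
  by rewrite !mxE => /eqP; rewrite oner_eq0.
have a0 : a != 0 by rewrite gt_eqF.
pose k := - (a^-1 *: b^T).
have kb : a *: k + b^T = 0.
  by rewrite /k scalerN scalerA divff// scale1r addNr.
pose S := k *m b + D.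
have symS : S^T = S.
  rewrite /S linearD/= trmx_mul symD; congr (_ + _).
  by rewrite /k linearN/= linearZ/= trmxK mulmxN mulNmx -scalemxAr -scalemxAl.
have LG (v : 'rV_n) : row_mx (v *m k) v *m G *m (row_mx (v *m k) v)^T
    = v *m S *m v^T.
  rewrite GE mul_row_block tr_row_mx mul_row_col.
  rewrite mul_mx_scalar [a *: _]scalemxAr -mulmxDr kb mulmx0 mul0mx add0r.
  by rewrite -(mulmxA v k) -mulmxDr.
have posS (v : 'rV_n) : v != 0 -> 0 < (v *m S *m v^T) 0 0.
  move=> v0; rewrite -LG; apply: posG; apply: contra v0 => /eqP.
  by move=> /(congr1 rsubmx); rewrite row_mxKr => ->; rewrite linear0.
have [E EE] := IH _ symS posS.
exists (block_mx (Num.sqrt a^-1)%:M 0 (E *m k) E).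
have sq : (Num.sqrt a^-1) ^+ 2 = a^-1 by rewrite sqr_sqrtr// invr_ge0 ltW.
rewrite GE tr_block_mx !mulmx_block tr_scalar_mx trmx0.
rewrite !(mul0mx, mulmx0, addr0, add0r, mul_mx_scalar, mul_scalar_mx).
have -> : a *: (E *m k) + E *m b^T = 0.
  by rewrite scalemxAr -mulmxDr kb mulmx0.
rewrite !scaler0 mul0mx add0r trmx_mul.
have -> : E *m k *m b + E *m D = E *m S by rewrite /S mulmxDr mulmxA.
rewrite EE; have -> : a *: (Num.sqrt a^-1)%:M *m (k^T *m E^T) + Num.sqrt a^-1 *: b *m E^T = 0.
  rewrite -!scalemxAl mul_scalar_mx scalerA mulrC -scalerA -scalerDr scalemxAl -mulmxDl.
  have -> : a *: k^T + b = 0.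
    by rewrite -[RHS]trmx0 -kb; apply/matrixP => i j; rewrite !mxE.
  by rewrite mul0mx scaler0.
rewrite [in RHS]scalar_mx_block; congr block_mx.
by rewrite !scale_scalar_mx mulrCA -expr2 sq mulfV.
Qed.

Section Ip.
Context {n p : nat}.
Implicit Types x y z : 'rV[R]_(n + p).

Definition ip_sign : 'rV[R]_(n + p) := row_mx (const_mx 1) (const_mx (- 1)).

Lemma ipE x y : ip x y = \sum_k ip_sign 0 k * (x 0 k * y 0 k).
Proof.
rewrite /ip big_split_ord/= -sumrN; congr (_ + _); apply: eq_bigr => i _.
  by rewrite /ip_sign row_mxEl mxE mul1r.
by rewrite /ip_sign row_mxEr mxE mulN1r.
Qed.

Lemma ip_mx x y : ip x y = (x *m diag_mx ip_sign *m y^T) 0 0.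
Proof.
rewrite ipE mxE; apply: eq_bigr => k _.
by rewrite mul_mx_diag !mxE; ring.
Qed.

Lemma ip_sqr1 k : ip_sign 0 k * ip_sign 0 k = 1.
Proof.
by case: (split_ordP k) => i ->;
  rewrite /ip_sign ?row_mxEl ?row_mxEr mxE ?mulr1// mulrNN mulr1.
Qed.

Lemma ipC x y : ip x y = ip y x.
Proof. by rewrite !ipE; apply: eq_bigr => k _; rewrite [x _ _ * _]mulrC. Qed.

Lemma ipDl x y z : ip (x + y) z = ip x z + ip y z.
Proof. by rewrite !ip_mx !mulmxDl mxE. Qed.

Lemma ipZl a x y : ip (a *: x) y = a * ip x y.
Proof. by rewrite !ip_mx -!scalemxAl mxE. Qed.

Lemma ipDr x y z : ip x (y + z) = ip x y + ip x z.
Proof. by rewrite ipC ipDl !(ipC x). Qed.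

Lemma ipZr a x y : ip x (a *: y) = a * ip x y.
Proof. by rewrite ipC ipZl ipC. Qed.

Lemma ip0l x : ip 0 x = 0.
Proof. by rewrite -(scale0r x) ipZl mul0r. Qed.

Lemma ip0r x : ip x 0 = 0. Proof. by rewrite ipC ip0l. Qed.

Lemma ipNl x y : ip (- x) y = - ip x y.
Proof. by rewrite -scaleN1r ipZl mulN1r. Qed.

Lemma ipNr x y : ip x (- y) = - ip x y.
Proof. by rewrite ipC ipNl ipC. Qed.

Lemma ipBl x y z : ip (x - y) z = ip x z - ip y z.
Proof. by rewrite ipDl ipNl. Qed.

Lemma ipBr x y z : ip x (y - z) = ip x y - ip x z.
Proof. by rewrite ipDr ipNr. Qed.

Lemma ip_suml (I : Type) (r : seq I) (P : pred I) (F : I -> 'rV[R]_(n + p)) y :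
  ip (\sum_(i <- r | P i) F i) y = \sum_(i <- r | P i) ip (F i) y.
Proof.
by apply: (big_morph (fun x => ip x y)); [move=> a b; exact: ipDl|exact: ip0l].
Qed.

Lemma ip_sumr (I : Type) (r : seq I) (P : pred I) (F : I -> 'rV[R]_(n + p)) y :
  ip y (\sum_(i <- r | P i) F i) = \sum_(i <- r | P i) ip y (F i).
Proof. by rewrite ipC ip_suml; apply: eq_bigr => i _; rewrite ipC. Qed.

(** * Frames and orthogonal splitting for the spacelike row space of [J] *)

Section SpacelikeSubspace.
Variable J : 'M[R]_(n, n + p).
Hypothesis posJ : forall v : 'rV_n, v != 0 -> 0 < ip (v *m J) (v *m J).

Definition nor z := forall v : 'rV_n, ip (v *m J) z = 0.

Definition tframe (E : 'M[R]_n) :=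
  forall i j, ip (row i E *m J) (row j E *m J) = (i == j)%:R.

Definition nframe (N : 'M[R]_(p, n + p)) :=
  (forall a, nor (row a N)) /\
  (forall a b, ip (row a N) (row b N) = - (a == b)%:R).

Lemma ip_row m q (A : 'M[R]_(m, n + p)) (B : 'M[R]_(q, n + p)) i j :
  ip (row i A) (row j B) = (A *m diag_mx ip_sign *m B^T) i j.
Proof.
rewrite ip_mx -!row_mul tr_row; rewrite !mxE; apply: eq_bigr => k _.
by rewrite !mxE.
Qed.

Lemma tframe_exists : exists E, tframe E.
Proof.
have [||E EE] := @symmetric_posdef_orthonormal n (J *m diag_mx ip_sign *m J^T).
- by rewrite !trmx_mul trmxK tr_diag_mx mulmxA.
- by move=> v /posJ; rewrite ip_mx trmx_mul !mulmxA.
exists E => i j; rewrite -!row_mul ip_row trmx_mul.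
by have /matrixP/(_ i j) := EE; rewrite !mulmxA [in RHS]mxE.
Qed.

Lemma nframe_exists : exists N, nframe N.
Proof.
pose J1 := lsubmx J; pose J2 := rsubmx J.
have ipJ (v w : 'rV_n) : ip (v *m J) (w *m J) = (v *m J1 *m (w *m J1)^T) 0 0
    - (v *m J2 *m (w *m J2)^T) 0 0.
  rewrite /ip; congr (_ - _); rewrite [in RHS]mxE; apply: eq_bigr => i _;
  by rewrite !mxE; congr (_ * _); apply: eq_bigr => k _; rewrite !mxE.
have sq_ge0 q (v : 'rV[R]_q) : 0 <= (v *m v^T) 0 0.
  by rewrite mxE sumr_ge0// => i _; rewrite mxE -expr2 sqr_ge0.
have sq_gt0 q (v : 'rV[R]_q) : v != 0 -> 0 < (v *m v^T) 0 0.
  move=> v0; rewrite lt_def sq_ge0 andbT; apply: contra v0; rewrite mxE => /eqP.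
  under eq_bigr do rewrite mxE -expr2.
  move=> /psumr_eq0P h; apply/eqP/rowP => i; rewrite mxE; apply/eqP.
  by rewrite -sqrf_eq0 h// => j _; exact: sqr_ge0.
(* A kernel vector of [J1] would have a purely timelike image under [J]. *)
have J1u : J1 \in unitmx.
  rewrite -row_free_unit -kermx_eq0; apply/negP => /negP.
  case/rowV0Pn => v /sub_kermxP vJ1 v0; have := posJ v0.
  rewrite ipJ vJ1 mul0mx [X in X - _]mxE sub0r oppr_gt0.
  by rewrite ltNge sq_ge0.
(* The subspace is the graph of [K] over the spacelike coordinates, and its normal space is the
   graph of [K^T] over the timelike ones. *)
pose K := invmx J1 *m J2.
(* By [posJ], [K] strictly shrinks Euclidean lengths. So does its transpose: for [c = b K^T] and
   [d = c K], [|c|^2 = <b, d> <= |b| |d| < |b| |c|]. *)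
have posK (b : 'rV_p) : b != 0 -> 0 < (b *m (1%:M - K^T *m K) *m b^T) 0 0.
  move=> b0; rewrite mulmxBr mulmxBl mulmx1 mxE [X in _ + X]mxE subr_gt0.
  pose c : 'rV_n := b *m K^T.
  have -> : b *m (K^T *m K) *m b^T = c *m c^T by rewrite /c (trmx_mul b) trmxK -!mulmxA.
  have [->|c0] := eqVneq c 0; first by rewrite mul0mx [X in X < _]mxE sq_gt0.
  pose d := c *m K.
  have cd : (d *m d^T) 0 0 < (c *m c^T) 0 0.
    rewrite -subr_gt0; have := @posJ (c *m invmx J1).
    rewrite ipJ (mulmxKV J1u) -(mulmxA c _ J2).
    apply; apply: contra c0 => /eqP h.
    by rewrite -(mulmxKV J1u c) h mul0mx.
  have cE : (b *m d^T) 0 0 = (c *m c^T) 0 0.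
    by rewrite /d (trmx_mul c) /c -!mulmxA.
  (* Expanding this square gives the Cauchy-Schwarz inequality for [b] and [d]. *)
  have := sq_ge0 _ ((b *m b^T) 0 0 *: d - (b *m d^T) 0 0 *: b).
  have dbE : (d *m b^T) 0 0 = (b *m d^T) 0 0.
    by rewrite !mxE; apply: eq_bigr => i _; rewrite !mxE mulrC.
  have trB (x y : R) : (x *: d - y *: b)^T = x *: d^T - y *: b^T.
    by apply/matrixP => i j; rewrite !mxE.
  rewrite trB mulmxBl !mulmxBr -!scalemxAl -!scalemxAr.
  have coord00 (A A' B B' : 'M[R]_1) (x y z w : R) :
    (x *: (x *: A) - y *: (z *: A') - (z *: (y *: B) - w *: (w *: B'))) 0 0 =
    x ^+ 2 * A 0 0 - y * z * A' 0 0 - z * y * B 0 0 + w ^+ 2 * B' 0 0.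
    by rewrite !mxE; ring.
  have bb := sq_gt0 _ _ b0; have cc := sq_gt0 _ _ c0.
  rewrite coord00 dbE cE => h.
  have {}h : (b *m b^T) 0 0 * ((b *m b^T) 0 0 * (d *m d^T) 0 0 - (c *m c^T) 0 0 ^+ 2) >= 0.
    by apply: le_trans h _; rewrite le_eqVlt; apply/orP; left; apply/eqP; ring.
  rewrite pmulr_rge0// in h.
  rewrite -subr_gt0 -(pmulr_rgt0 _ cc).
  have : (b *m b^T) 0 0 * ((c *m c^T) 0 0 - (d *m d^T) 0 0) > 0.
    by rewrite pmulr_rgt0// subr_gt0.
  by nra.
have [||C CC] := @symmetric_posdef_orthonormal p (1%:M - K^T *m K).
- by rewrite linearB/= trmx1 trmx_mul trmxK.
- exact: posK.
pose N0 := row_mx K^T (1%:M : 'M[R]_p).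
have eta_mul q (A : 'M[R]_(q, n)) (B : 'M[R]_(q, p)) :
    row_mx A B *m diag_mx ip_sign = row_mx A (- B).
  apply/matrixP => i j; rewrite mul_mx_diag mxE.
  by case: (split_ordP j) => k ->; rewrite /ip_sign ?row_mxEl ?row_mxEr mxE
    ?mulr1// [RHS]mxE mulrN1.
exists (C *m N0); split => [a v|a b].
  rewrite -{1}[v *m J](row_id 0) ip_row -(hsubmxK J) mul_mx_row eta_mul.
  rewrite trmx_mul tr_row_mx trmx1 trmxK mulmxA mul_row_col.
  rewrite mulmx1 -(mulmxA v (lsubmx J)) /K -/J1 mulKVmx// subrr.
  by rewrite mul0mx mxE.
rewrite ip_row trmx_mul !mulmxA -(mulmxA C) eta_mul tr_row_mx -!mulmxA.
rewrite (mulmxA (row_mx _ _)) mul_row_col trmx1 mulmx1 trmxK !mulmxA.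
rewrite -(mulmxA K^T) -/K; have -> : C *m (K^T *m K - 1%:M) *m C^T = - 1%:M.
  by rewrite -[in RHS]CC -mulNmx -mulmxN opprB.
by rewrite !mxE.
Qed.

(** The stacked frame [F] satisfies [F eta F^T = eta]. Since [eta] is an involution, this turns into
    [F^T eta F = eta], which is the expansion in the frame. *)
Lemma ip_frame_sum E N z w : tframe E -> nframe N ->
  ip z w = \sum_i ip z (row i E *m J) * ip w (row i E *m J)
           - \sum_a ip z (row a N) * ip w (row a N).
Proof.
move=> tE [norN oN].
pose F : 'M[R]_(n + p) := col_mx (E *m J) N.
pose eta := diag_mx ip_sign.
have FF : F *m eta *m F^T = eta.
  apply/matrixP => i j; rewrite -ip_row mxE.
  case: (split_ordP i) => i' ->; case: (split_ordP j) => j' ->;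
    rewrite ?(rowKu, rowKd) ?row_mul /ip_sign ?row_mxEl ?row_mxEr.
  - by rewrite tE mxE eq_lshift.
  - by rewrite norN eq_lrshift.
  - by rewrite ipC norN eq_rlshift.
  - by rewrite oN eq_rshift mxE mulNrn.
have eta2 : eta *m eta = 1%:M.
  by apply/matrixP => i j; rewrite /eta mul_mx_diag [LHS]mxE [diag_mx _ _ _]mxE [RHS]mxE mulrnAl; case: eqP => [->|//]; rewrite ip_sqr1.
have FF' : F^T *m eta *m F = eta.
  have : (eta *m F) *m (eta *m F^T) = 1%:M by rewrite !mulmxA -(mulmxA eta) -(mulmxA eta) FF.
  move=> /mulmx1C h.
  have <- : eta *m (eta *m F^T *m (eta *m F)) = F^T *m eta *m F.
    by rewrite !mulmxA eta2 mul1mx.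
  by rewrite h mulmx1.
have -> : ip z w = (z *m eta *m F^T *m eta *m F *m eta *m w^T) 0 0.
  rewrite ip_mx -/eta; congr ((_ *m _) 0 0).
  by rewrite -!mulmxA (mulmxA F^T) (mulmxA _ F) FF' eta2 mulmx1.
have -> : z *m eta *m F^T *m eta *m F *m eta *m w^T =
    (z *m eta *m F^T) *m eta *m (w *m eta *m F^T)^T.
  by rewrite !trmx_mul trmxK tr_diag_mx !mulmxA.
have coordF x k : (x *m eta *m F^T) 0 k = ip x (row k F).
  by rewrite -{2}[x](row_id 0) ip_row.
by rewrite -ip_mx /ip; congr (_ - _); apply: eq_bigr => i _;
  rewrite !coordF ?rowKu ?rowKd ?row_mul.
Qed.

Lemma nor_ip_le0 z : nor z -> ip z z <= 0.
Proof.
move=> nz; have [E tE] := tframe_exists; have [N nN] := nframe_exists.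
rewrite (ip_frame_sum _ _ tE nN) big1 => [|i _]; last by rewrite ipC nz mul0r.
by rewrite sub0r oppr_le0 sumr_ge0// => a _; rewrite -expr2 sqr_ge0.
Qed.

Lemma nor_ip_eq0 z : nor z -> 0 <= ip z z -> z = 0.
Proof.
move=> nz z0; have [E tE] := tframe_exists; have [N nN] := nframe_exists.
have w0 i : ip z (row i E *m J) = 0 by rewrite ipC nz.
have a0 a : ip z (row a N) = 0.
  move: z0; rewrite (ip_frame_sum _ _ tE nN) big1 => [|i _]; last by rewrite w0 mul0r.
  rewrite sub0r oppr_ge0 => h; apply/eqP; rewrite -sqrf_eq0 expr2.
  have /psumr_eq0P -> // : \sum_a ip z (row a N) * ip z (row a N) = 0.
    by apply/eqP; rewrite eq_le h sumr_ge0// => b _; rewrite -expr2 sqr_ge0.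
  by move=> b _; rewrite -expr2 sqr_ge0.
have ipz x : ip x z = 0.
  rewrite (ip_frame_sum _ _ tE nN) !big1 ?subr0// => i _; first by rewrite a0 mulr0.
  by rewrite w0 mulr0.
apply/rowP => k; have := ipz (delta_mx 0 k).
have z00 : (0 : 'rV[R]_(n + p)) 0 k = 0 by rewrite mxE.
rewrite ipE (bigD1 k)//= big1 => [|j jk]; last first.
  by rewrite [delta_mx _ _ _ _]mxE (negbTE jk) andbF mul0r mulr0.
rewrite addr0 [delta_mx _ _ _ _]mxE !eqxx mul1r z00 => /eqP.
rewrite mulf_eq0 => /orP[/eqP s0|/eqP //].
by have /eqP := ip_sqr1 k; rewrite s0 mul0r eq_sym oner_eq0.
Qed.

Lemma ortho_decomposition w : exists v : 'rV_n, nor (w - v *m J).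
Proof.
have [E tE] := tframe_exists.
pose c : 'rV_n := \row_i ip w (row i E *m J).
exists (c *m E) => u.
have Eu : E \in unitmx.
  have [|h _] := @mulmx1_unit _ n E (J *m diag_mx ip_sign *m J^T *m E^T); last by [].
  apply/matrixP => i j; rewrite !mulmxA.
  by rewrite [RHS]mxE -tE -!row_mul ip_row trmx_mul !mulmxA.
suff ort i : ip (row i E *m J) (w - c *m E *m J) = 0.
  rewrite -(mulmxKV Eu u) (mulmx_sum_row (u *m invmx E)) mulmx_suml ip_suml big1// => i _.
  by rewrite -scalemxAl ipZl ort mulr0.
rewrite ipBr (mulmx_sum_row c) mulmx_suml ip_sumr (bigD1 i)//= big1 => [|j ji].
  by rewrite -scalemxAl ipZr tE eqxx mulr1 addr0 mxE ipC subrr.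
by rewrite -scalemxAl ipZr tE eq_sym (negbTE ji) mulr0.
Qed.
End SpacelikeSubspace.
End Ip.
End LinearAlgebra.

(** * Directional derivatives *)

Section Calculus.
Context {R : realType}.

Section General.
Context {V V' W : normedModType R}.
Implicit Types (f : V -> W) (U : set V).

Lemma deriveDl f u v w : differentiable f u ->
  'D_(v + w) f u = 'D_v f u + 'D_w f u.
Proof. by move=> df; rewrite !deriveE// linearD. Qed.

Lemma deriveZl f u a v : differentiable f u -> 'D_(a *: v) f u = a *: 'D_v f u.
Proof. by move=> df; rewrite !deriveE// linearZ. Qed.

Lemma derive_suml f u (I : Type) (r : seq I) (F : I -> V) : differentiable f u ->
  'D_(\sum_(i <- r) F i) f u = \sum_(i <- r) 'D_(F i) f u.
Proof.
by move=> df; rewrite deriveE// linear_sum; apply: eq_bigr => i _; rewrite deriveE.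
Qed.

Lemma is_derive_chain (g : V' -> V) f (x v : V') :
  differentiable g x -> differentiable f (g x) ->
  is_derive x v (f \o g) ('D_('D_v g x) f (g x)).
Proof.
move=> dg df; have dfg := differentiable_comp dg df.
apply: DeriveDef; first exact: diff_derivable.
by rewrite deriveE// diff_comp//= !deriveE.
Qed.

Lemma smooth_on_derive U f v : smooth_on U f -> smooth_on U ('D_v f).
Proof.
move=> sf vs x Ux; have := sf (rcons vs v) x Ux.
by rewrite /iter_derive -cats1 foldr_cat.
Qed.

Lemma smooth_on_differentiable U f u : smooth_on U f -> U u -> differentiable f u.
Proof. by move=> sf; exact: (sf [::]). Qed.

Lemma smooth_on_continuous U f u : smooth_on U f -> U u -> {for u, continuous f}.
Proof. by move=> sf Uu; apply: differentiable_continuous; exact: smooth_on_differentiable sf Uu. Qed.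

End General.

Lemma is_derive_line {V W : normedModType R} (f : V -> W) (u v : V) (t : R) :
  differentiable f (u + t *: v) ->
  is_derive t 1 (fun s : R => f (u + s *: v)) ('D_v f (u + t *: v)).
Proof.
move=> df.
have [dg dE] : is_diff t (cst u + *:%R^~ v) (0 + *:%R^~ v) by exact: is_diffD.
have := is_derive_chain (1 : R) dg df.
have -> : 'D_1 (cst u + *:%R^~ v) t = v; last by [].
by rewrite deriveE// dE !fctE add0r scale1r.
Qed.

Lemma is_derive_sumf {V W : normedModType R} m (F : 'I_m -> V -> W) dF t v :
  (forall i, is_derive t v (F i) (dF i)) ->
  is_derive t v (fun x => \sum_i F i x) (\sum_i dF i).
Proof.
move=> h; rewrite (_ : (fun x => _) = \sum_i F i); first exact: is_derive_sum.
by apply/funext => x; rewrite fct_sumE.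
Qed.

Lemma differentiable_eps {V W : normedModType R} (f : V -> W) u :
  differentiable f u -> forall e, 0 < e ->
  \forall k \near 0, `|f (k + u) - f u - 'D_k f u| <= e * `|k|.
Proof.
move=> df e e0; have /eqaddoP/(_ _ e0) := diff_locally df.
by apply: filterS => k /=; rewrite deriveE// !fctE /= opprD addrA.
Qed.

Lemma near_eq_differentiable {V W : normedModType R} (f g : V -> W) u :
  {near u, f =1 g} -> differentiable f u -> differentiable g u.
Proof.
move=> fg df; have fgu := nbhs_singleton fg.
apply/diff_locallyP.
have gE : g \o shift u = cst (g u) + 'd f u +o_ 0 id.
  apply/eqaddoP => e e0; have /eqaddoP/(_ _ e0) := diff_locally df.
  apply: filter_app; have := fg; rewrite -[{near u, _}]/(\forall x \near u, f x = g x).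
  rewrite (near_shift 0)/= subr0; apply: filterS => k /= h.
  by rewrite !fctE /= h fgu.
have dgE := diff_unique (diff_continuous df) gE.
by rewrite dgE; split => //; exact: diff_continuous.
Qed.

(** * Symmetry of second derivatives *)

Section Schwarz.
Context {V : normedModType R}.
Implicit Types f : V -> R.

Lemma derivable_right_interval (P : R -> Prop) : (\forall t \near (0:R), P t) ->
  exists2 d : R, 0 < d & forall t, `|t| < d -> P t.
Proof.
move=> /nbhs_ballP[d /= d0 h]; exists d => // t td; apply: h.
by rewrite /ball/= sub0r normrN.
Qed.

(** The mean value theorem for [s |-> f (u + t w + s v) - f (u + s v)] on [[0, t]] leaves a
    difference of two values of ['D_v f]; both are expanded to first order at [u]. *)
Lemma second_difference f (U : set V) (u v w : V) : open U -> U u ->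
  (forall x, U x -> differentiable f x) -> differentiable ('D_v f) u ->
  forall e, 0 < e -> \forall t \near (0 : R)^'+,
   `|f (u + t *: w + t *: v) - f (u + t *: w) - f (u + t *: v) + f u
     - t ^+ 2 * 'D_w ('D_v f) u| <= t ^+ 2 * (e * (2 * `|v| + `|w|)).
Proof.
move=> oU Uu df dvf e e0.
have [d /= d0 hd] : exists2 d : R, 0 < d & forall k, `|k| < d -> U (k + u) /\
    `|'D_v f (k + u) - 'D_v f u - 'D_k ('D_v f) u| <= e * `|k|.
  have /nbhs_ballP[d d0 h] : \forall k \near (0 : V), U (k + u) /\
    `|'D_v f (k + u) - 'D_v f u - 'D_k ('D_v f) u| <= e * `|k|.
    apply: filterI; last exact: differentiable_eps.
    have : \forall k \near u, U k by exact: open_nbhs_nbhs.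
    by rewrite (near_shift 0)/= subr0.
  by exists d => // k kd; apply: h; rewrite -ball_normE /ball_/= sub0r normrN.
have nvw : 0 < `|v| + `|w| + 1 by rewrite ltr_wpDl// addr_ge0.
near=> t.
have t0 : 0 < t by [].
have td : t * (`|v| + `|w| + 1) < d.
  rewrite -ltr_pdivlMr//; near: t; apply: nbhs_right_lt; exact: divr_gt0.
have small (a b : R) : 0 <= a <= 1 -> 0 <= b <= t -> `|(a * t) *: w + b *: v| < d.
  move=> /andP[a0 a1] /andP[b0 bt]; apply: le_lt_trans td.
  rewrite (le_trans (ler_normD _ _))// !normrZ !ger0_norm// ?mulr_ge0 ?(ltW t0)//.
  rewrite !mulrDr mulr1.
  have : a * t * `|w| <= t * `|w| by rewrite ler_wpM2r// ler_piMl// ltW.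
  have : b * `|v| <= t * `|v| by rewrite ler_wpM2r.
  by have := ltW t0; lra.
pose phi s := f (u + t *: w + s *: v) - f (u + s *: v).
have dphi s : 0 <= s <= t -> is_derive s 1 phi
    ('D_v f (u + t *: w + s *: v) - 'D_v f (u + s *: v)).
  move=> st; apply: is_deriveB; apply: is_derive_line; apply: df.
    have := small 1 s; rewrite mul1r => /(_ _ st) h.
    by have [] := hd _ (h _); rewrite ?ler01 ?lexx// addrC addrA.
  have := small 0 s; rewrite mul0r scale0r add0r => /(_ _ st) h.
  by have [] := hd _ (h _); rewrite ?ler01 ?lexx// addrC.
have [c /andP[/= c0 ct]] : exists2 c, c \in `]0, t[%R &
    phi t - phi 0 = ('D_v f (u + t *: w + c *: v) - 'D_v f (u + c *: v)) * (t - 0).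
  apply: (@MVT _ _ (fun s => 'D_v f (u + t *: w + s *: v) - 'D_v f (u + s *: v))) => //.
    by move=> x /[!in_itv]/= /andP[x0 xt]; apply: dphi; rewrite !ltW.
  apply: derivable_within_continuous => x /[!in_itv]/= xt.
  by apply: (@ex_derive _ _ _ _ _ _ _ (dphi x _)).
rewrite !bnd_simp in c0 ct.
rewrite /phi scale0r !addr0 subr0 => E.
have -> : f (u + t *: w + t *: v) - f (u + t *: w) - f (u + t *: v) + f u =
  f (u + t *: w + t *: v) - f (u + t *: v) - (f (u + t *: w) - f u) by ring.
have ct' : 0 <= c <= t by rewrite !ltW.
rewrite E.
have := small 1 c; rewrite mul1r => /(_ _ ct').
rewrite ler01 lexx => /(_ isT) /hd [_].
have := small 0 c; rewrite mul0r scale0r add0r => /(_ _ ct').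
rewrite ler01 lexx => /(_ isT) /hd [_].
rewrite (addrC _ u) (addrC _ u) addrA.
rewrite deriveDl// !deriveZl//.
set A := 'D_v f (_ + _); set B := 'D_v f (_ + _); set C := 'D_v f u.
set D := c *: _; set E1 := 'D_w _ _ => h1 h2.
have -> : (B - A) * t - t ^+ 2 * E1 = t * ((B - C - (t *: E1 + D)) - (A - C - D)).
  by rewrite /GRing.scale/=; ring.
rewrite normrM (ger0_norm (ltW t0)) expr2 -mulrA ler_pM2l//.
apply: le_trans (ler_normB _ _) _; apply: le_trans (lerD h2 h1) _.
rewrite -mulrDr mulrCA ler_pM2l//.
have nc : `|c *: v| <= t * `|v|.
  by rewrite normrZ ger0_norm ?(ltW c0)// ler_wpM2r// ltW.
have : `|t *: w + c *: v| <= t * `|w| + t * `|v|.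
  by rewrite (le_trans (ler_normD _ _))// lerD// normrZ ger0_norm// ltW.
by move=> h; apply: le_trans (lerD h nc) _; lra.
Unshelve. all: by end_near. Qed.

Lemma derive_comm f (U : set V) (u v w : V) : open U -> U u ->
  (forall x, U x -> differentiable f x) ->
  differentiable ('D_v f) u -> differentiable ('D_w f) u ->
  'D_v ('D_w f) u = 'D_w ('D_v f) u.
Proof.
move=> oU Uu df dv dw; apply/eqP; rewrite -subr_eq0 -normr_eq0.
rewrite eq_le normr_ge0 andbT; apply/ler_addgt0Pl => e e0; rewrite addr0.
(* The two error bounds [2 |v| + |w|] and [2 |w| + |v|] add up to [3 (|v| + |w|)]; the [+ 1] allows
   the division when both vectors vanish. *)
set K := 3 * (`|v| + `|w|) + 1.
have K0 : 0 < K by rewrite ltr_wpDl// mulr_ge0// addr_ge0.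
have eK : 0 < e / K by exact: divr_gt0.
near (0 : R)^'+ => t.
have t0 : 0 < t by [].
have h1 : `|f (u + t *: w + t *: v) - f (u + t *: w) - f (u + t *: v) + f u
     - t ^+ 2 * 'D_w ('D_v f) u| <= t ^+ 2 * (e / K * (2 * `|v| + `|w|)).
  by near: t; exact: second_difference oU Uu df dv _ eK.
have h2 : `|f (u + t *: v + t *: w) - f (u + t *: v) - f (u + t *: w) + f u
     - t ^+ 2 * 'D_v ('D_w f) u| <= t ^+ 2 * (e / K * (2 * `|w| + `|v|)).
  by near: t; exact: second_difference oU Uu df dw _ eK.
rewrite -(ler_pM2l (exprn_gt0 2 t0)).
rewrite -{1}(ger0_norm (ltW (exprn_gt0 2 t0))) -normrM.
rewrite (addrAC u) in h2.
set A := f (u + t *: w + t *: v) in h1 h2.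
have E (a b c d x y q : R) : q * (y - x) =
  (a - b - c + d - q * x) - (a - c - b + d - q * y) by ring.
rewrite (E A (f (u + t *: w)) (f (u + t *: v)) (f u)).
apply: le_trans (ler_normB _ _) _; apply: le_trans (lerD h1 h2) _.
rewrite -mulrDr ler_pM2l ?exprn_gt0// -mulrDr.
rewrite mulrAC ler_pdivrMr// ler_pM2l// /K.
by clear; have := normr_ge0 v; have := normr_ge0 w; lra.
Unshelve. all: by end_near. Qed.

End Schwarz.

Section Mx.
Context {V : normedModType R} {m q : nat}.

Lemma is_derive_mx (M : V -> 'M[R]_(m, q)) (D : 'M[R]_(m, q)) t v :
  (forall i j, is_derive t v (fun x => M x i j) (D i j)) -> is_derive t v M D.
Proof.
move=> h; have dM : derivable M t v.
  by apply/derivable_mxP => i j; exact: (@ex_derive _ _ _ _ _ _ _ (h i j)).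
apply: DeriveDef => //; rewrite derive_mx//; apply/matrixP => i j; rewrite mxE.
exact: (@derive_val _ _ _ _ _ _ _ (h i j)).
Qed.

Lemma is_derive_coord (M : V -> 'M[R]_(m, q)) D t v i j :
  is_derive t v M D -> is_derive t v (fun x => M x i j) (D i j).
Proof.
move=> [dM <-]; apply: DeriveDef; first by move/derivable_mxP : dM; exact.
by rewrite derive_mx// mxE.
Qed.

Lemma is_derive_scale (k : V -> R) (M : V -> 'M[R]_(m, q)) dk D t v :
  is_derive t v k dk -> is_derive t v M D ->
  is_derive t v (fun x => k x *: M x) (dk *: M t + k t *: D).
Proof.
move=> hk hM; apply: is_derive_mx => i j.
have := is_deriveM hk (is_derive_coord i j hM).
move=> /is_derive_eq h; under eq_fun do rewrite mxE; apply: h.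
by rewrite !mxE /= addrC; congr (_ + _); rewrite mulrC.
Qed.

End Mx.

Lemma is_derive_ip {V : normedModType R} {n p : nat} (f g : V -> 'rV[R]_(n + p))
    df dg t v : is_derive t v f df -> is_derive t v g dg ->
  is_derive t v (fun x => ip (f x) (g x)) (ip df (g t) + ip (f t) dg).
Proof.
move=> hf hg.
have key k : is_derive t v (fun x => ip_sign 0 k * (f x 0 k * g x 0 k) : R)
    (ip_sign 0 k * (df 0 k * g t 0 k) + ip_sign 0 k * (f t 0 k * dg 0 k)).
  have := is_deriveM (is_derive_coord 0 k hf) (is_derive_coord 0 k hg).
  move=> /(is_deriveZ (ip_sign 0 k)) /is_derive_eq; apply.
  by rewrite /GRing.scale/=; ring.
rewrite (_ : (fun x => ip (f x) (g x)) =
    fun x => \sum_k ip_sign 0 k * (f x 0 k * g x 0 k)); last first.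
  by apply/funext => x; rewrite ipE.
apply: is_derive_eq; first exact: (is_derive_sumf key).
by rewrite big_split/= -!ipE.
Qed.

Section MxSmooth.
Context {V : normedModType R} {m : nat}.
Implicit Types f : V -> 'rV[R]_m.

Lemma derive_coord f u v j : differentiable f u ->
  'D_v f u 0 j = 'D_v (fun x => f x 0 j) u.
Proof. by move=> df; rewrite derive_mx ?mxE//; exact: diff_derivable. Qed.

Lemma differentiable_row_coord f u j : differentiable f u ->
  differentiable (fun x => f x 0 j) u.
Proof.
move=> df; apply: (@differentiable_comp _ _ _ _ f (fun M : 'rV[R]_m => M 0 j)) => //.
exact: differentiable_coord.
Qed.

Lemma smooth_on_derive_comm (U : set V) f u v w : open U -> smooth_on U f -> U u ->
  'D_v ('D_w f) u = 'D_w ('D_v f) u.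
Proof.
move=> oU sf Uu; apply/rowP => j.
have dD x : U x -> forall y, differentiable ('D_y f) x.
  by move=> Ux y; exact: smooth_on_differentiable (smooth_on_derive y sf) Ux.
have df x : U x -> differentiable f x by move=> Ux; exact: smooth_on_differentiable sf Ux.
apply: etrans (derive_coord v j (dD _ Uu w)) _; apply/esym.
apply: etrans (derive_coord w j (dD _ Uu v)) _; apply/esym.
have nE y : {near u, (fun x => 'D_y f x 0 j) =1 'D_y (fun x => f x 0 j)}.
  have : nbhs u U by exact: open_nbhs_nbhs.
  by apply: filterS => x Ux; rewrite derive_coord//; exact: df.
rewrite (near_eq_derive _ (nE w)) (near_eq_derive _ (nE v)).
have dDy y : differentiable ('D_y (fun x => f x 0 j)) u.
  have : differentiable (fun x => 'D_y f x 0 j) u.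
    by apply: differentiable_row_coord; exact: dD.
  exact: near_eq_differentiable.
apply: (derive_comm oU Uu).
- by move=> x Ux; apply: differentiable_row_coord; exact: df.
- exact: dDy.
exact: dDy.
Qed.

End MxSmooth.

(** * First and second order expansions on the line *)

Lemma is_derive_eps {W : normedModType R} (g : R -> W) c :
  is_derive (0 : R) (1 : R) g c ->
  forall e, 0 < e -> \forall t \near (0 : R), `|g t - g 0 - t *: c| <= e * `|t|.
Proof.
move=> [dg <-] e e0; have dg' : differentiable g 0 by exact/derivable1_diffP.
apply: filterS (differentiable_eps dg' e0) => t; rewrite addr0.
have -> : 'D_t g 0 = t *: 'D_1 g 0; last by [].
by rewrite -deriveZl// /GRing.scale/= mulr1.
Qed.

Lemma second_derivative_max (phi psi : R -> R) c :
  (\forall t \near (0 : R), is_derive t (1 : R) phi (psi t)) ->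
  is_derive (0 : R) (1 : R) psi c ->
  (\forall t \near (0 : R), phi t <= phi 0) -> psi 0 = 0 /\ c <= 0.
Proof.
move=> /derivable_right_interval[d d0 hd] dpsi /derivable_right_interval[d' d'0 hd'].
have psi0 : psi 0 = 0.
  pose r := Num.min d d'; have r0 : 0 < r by rewrite lt_min d0.
  have rd t : t \in `]- r, r[%R -> `|t| < r.
    by rewrite in_itv/= ltr_norml.
  have [_ <-] : is_derive (0 : R) (1 : R) phi (psi 0) by apply: hd; rewrite normr0.
  suff [_ ->] : is_derive (0 : R) (1 : R) phi 0 by [].
  apply: (@derive1_at_max _ phi (- r) r).
  - by rewrite ge0_cp// ltW.
  - by move=> t /rd; rewrite lt_min => /andP[/hd].
  - by rewrite in_itv/= oppr_lt0 r0.
  - by move=> t /rd; rewrite lt_min => /andP[_ /hd'].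
split => //; rewrite leNgt; apply/negP => c0.
have c20 : 0 < c / 2 by rewrite divr_gt0.
(* With the error [c / 2], the expansion makes [psi] positive just to the right of 0, so [phi] would
   increase there. *)
have /derivable_right_interval[r r0 hr] := is_derive_eps dpsi c20.
pose t := Num.min (Num.min d d') r / 2.
have m0 : 0 < Num.min (Num.min d d') r by rewrite !lt_min d0 d'0.
have t0 : 0 < t by rewrite divr_gt0.
have : t < Num.min (Num.min d d') r by rewrite ltr_pdivrMr// ltr_pMr// ltr1n.
rewrite !lt_min => /andP[/andP[td td'] tr].
have sml x : 0 <= x <= t -> `|x| < d by move=> /andP[x0 xt]; rewrite ger0_norm// (le_lt_trans xt).
have [x /[!in_itv]/= /andP[x0 xt]] : exists2 x, x \in `]0, t[%R & phi t - phi 0 = psi x * (t - 0).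
  apply: (@MVT _ _ psi) => //.
    by move=> x /[!in_itv]/= /andP[x0 xt]; apply/hd/sml; rewrite !ltW.
  apply: derivable_within_continuous => x /[!in_itv]/= xt.
  by have [] := hd _ (sml _ xt).
rewrite subr0 => E.
have : phi t <= phi 0 by apply: hd'; rewrite ger0_norm// ltW.
rewrite -subr_le0 E leNgt => /negP; apply; rewrite pmulr_lgt0//.
have := hr x; rewrite ger0_norm ?(ltW x0)// (lt_trans xt tr) => /(_ isT).
rewrite psi0 subr0 ler_norml => /andP[+ _].
by rewrite /GRing.scale/=; clear -x0 c0; nra.
Qed.

(** The mean value theorem is applied to [f s - c / 2 * s ^+ 2], whose derivative [g s - c * s] is
    [o(s)]. *)
Lemma second_order_limit (f g : R -> R) c : f 0 = 0 -> g 0 = 0 ->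
  (\forall t \near (0 : R), is_derive t (1 : R) f (g t)) ->
  is_derive (0 : R) (1 : R) g c ->
  (t ^- 2) * f t @[t --> 0^'+] --> c / 2.
Proof.
move=> f0 g0 /derivable_right_interval[d d0 hd] dg.
apply/cvgrPdist_le => e e0.
have /derivable_right_interval[r r0 hr] := is_derive_eps dg e0.
near=> t.
have t0 : 0 < t by [].
have td : t < d by near: t; exact: nbhs_right_lt.
have tr : t < r by near: t; exact: nbhs_right_lt.
have sml x : 0 <= x <= t -> `|x| < d by move=> /andP[x0 xt]; rewrite ger0_norm// (le_lt_trans xt).
pose h s := f s - c / 2 * s ^+ 2.
have dh s : 0 <= s <= t -> is_derive s 1 h (g s - c * s).
  move=> /sml /hd hs; apply: is_deriveB => //.
  have := is_deriveZ (c / 2) (is_deriveX 2 (is_derive_id s (1 : R))).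
  move=> /is_derive_eq; apply; rewrite /GRing.scale/= expr1.
  by field.
have [x /[!in_itv]/= /andP[x0 xt]] : exists2 x, x \in `]0, t[%R & h t - h 0 = (g x - c * x) * (t - 0).
  apply: (@MVT _ _ (fun s => g s - c * s)) => //.
    by move=> x /[!in_itv]/= /andP[x0 xt]; apply/dh; rewrite !ltW.
  apply: derivable_within_continuous => x /[!in_itv]/= xt.
  by have [] := dh _ xt.
rewrite /h f0 expr0n/= mulr0 !subr0 => E.
have -> : c / 2 - t ^- 2 * f t = - (t ^- 2 * (f t - c / 2 * t ^+ 2)).
  by field; rewrite gt_eqF.
rewrite E normrN !normrM normfV normrX (ger0_norm (ltW t0)).
have := hr x; rewrite (ger0_norm (ltW x0)) (lt_trans xt tr) => /(_ isT).
rewrite g0 subr0 /GRing.scale/= [x * c]mulrC => hx.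
rewrite ler_pdivrMl ?exprn_gt0// expr2 -mulrA mulrC ler_pM2l//.
by apply: le_trans hx _; rewrite mulrC ler_pM2r// ltW.
Unshelve. all: by end_near. Qed.

Section Local.
Context {n : nat}.

Lemma derive_basis {W : normedModType R} (f : 'rV[R]_n -> W) u v :
  differentiable f u -> 'D_v f u = \sum_i v 0 i *: 'D_(delta_mx 0 i) f u.
Proof.
move=> df; rewrite {1}(row_sum_delta v) derive_suml//.
by apply: eq_bigr => i _; rewrite deriveZl.
Qed.

(** Joint continuity in the direction and the point: by linearity in the direction only finitely
    many directional derivatives are involved. *)
Lemma cvg_derive_pair {W : normedModType R} (U : set 'rV[R]_n)
    (f : 'rV[R]_n -> W) (v u : 'rV[R]_n) :
  open U -> smooth_on U f -> U u ->
  'D_(z.1) f z.2 @[z --> (v, u)] --> 'D_v f u.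
Proof.
move=> oU sf Uu; rewrite (derive_basis _ (smooth_on_differentiable sf Uu)).
have : \sum_i (z.1 : 'rV[R]_n) 0 i *: 'D_(delta_mx 0 i) f z.2 @[z --> (v, u)] -->
    \sum_i v 0 i *: 'D_(delta_mx 0 i) f u.
  apply: cvg_big => [|i _]; first exact: add_continuous.
  apply: cvgZ.
    apply: (cvg_comp fst (fun M : 'rV[R]_n => M 0 i)); first exact: cvg_fst.
    exact: coord_continuous.
  apply: (cvg_comp snd ('D_(delta_mx 0 i) f)); first exact: cvg_snd.
  exact: smooth_on_continuous (smooth_on_derive _ sf) Uu.
apply: cvg_trans; apply: near_eq_cvg.
have : \forall z \near ((v, u) : 'rV[R]_n * 'rV[R]_n), U z.2.
  have nU : nbhs u U by exact: open_nbhs_nbhs.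
  exact: (cvg_snd nU).
by apply: filterS => z Uz; rewrite -derive_basis//; exact: smooth_on_differentiable sf Uz.
Qed.

End Local.
End Calculus.

(* 'D_ is transparent and unification keeps unfolding it, hence the lock. *)
HB.lock Definition dd {R : realType} {V W : normedModType R} (v : V) (f : V -> W)
  (u : V) : W := 'D_v f u.

Section LockedDerivative.
Context {R : realType}.

Lemma ddE {V W : normedModType R} (v : V) (f : V -> W) : dd v f = 'D_v f.
Proof. by rewrite unlock. Qed.

Section General.
Context {V W : normedModType R}.
Implicit Types (f : V -> W) (U : set V).

Lemma ddDl f u v w : differentiable f u -> dd (v + w) f u = dd v f u + dd w f u.
Proof. by rewrite !ddE; exact: deriveDl. Qed.

Lemma ddZl f u a v : differentiable f u -> dd (a *: v) f u = a *: dd v f u.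
Proof. by rewrite !ddE; exact: deriveZl. Qed.

Lemma ddNl f u v : differentiable f u -> dd (- v) f u = - dd v f u.
Proof. by move=> df; rewrite -scaleN1r ddZl// scaleN1r. Qed.

Lemma dd0l f u : dd 0 f u = 0.
Proof. by rewrite ddE derive0. Qed.

Lemma dd_suml f u (I : Type) (r : seq I) (F : I -> V) : differentiable f u ->
  dd (\sum_(i <- r) F i) f u = \sum_(i <- r) dd (F i) f u.
Proof.
by move=> df; rewrite ddE derive_suml//; apply: eq_bigr => i _; rewrite ddE.
Qed.

Lemma smooth_on_dd U f v : smooth_on U f -> smooth_on U (dd v f).
Proof. by rewrite ddE; exact: smooth_on_derive. Qed.

Lemma is_derive_dd f (u v : V) (t : R) : differentiable f (u + t *: v) ->
  is_derive t 1 (fun s : R => f (u + s *: v)) (dd v f (u + t *: v)).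
Proof. by rewrite ddE; exact: is_derive_line. Qed.

End General.

Lemma dd_comm {V : normedModType R} {m : nat} (U : set V) (f : V -> 'rV[R]_m) u v w :
  open U -> smooth_on U f -> U u -> dd v (dd w f) u = dd w (dd v f) u.
Proof. by rewrite !ddE; exact: smooth_on_derive_comm. Qed.

Lemma dd_basis {n : nat} {W : normedModType R} (f : 'rV[R]_n -> W) u v :
  differentiable f u -> dd v f u = \sum_i v 0 i *: dd (delta_mx 0 i) f u.
Proof.
by move=> df; rewrite ddE derive_basis//; apply: eq_bigr => i _; rewrite ddE.
Qed.

Lemma cvg_dd_pair {n : nat} {W : normedModType R} (U : set 'rV[R]_n)
    (f : 'rV[R]_n -> W) (v u : 'rV[R]_n) :
  open U -> smooth_on U f -> U u -> dd z.1 f z.2 @[z --> (v, u)] --> dd v f u.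
Proof.
move=> oU sf Uu; rewrite ddE; under eq_cvg do rewrite ddE.
exact: cvg_derive_pair oU sf Uu.
Qed.

End LockedDerivative.

(** * Immersions of open subsets of a vector space *)

Section LocalGeometry.
Context {R : realType} {n p : nat}.

Lemma cvg_coord {T : Type} {F : set_system T} {FF : Filter F} m q
    (f : T -> 'M[R]_(m, q)) (a : 'M[R]_(m, q)) i j : f @ F --> a -> f x i j @[x --> F] --> a i j.
Proof.
by move=> fa; apply: (cvg_comp f (fun M : 'M[R]_(m, q) => M i j) fa); exact: coord_continuous.
Qed.

Lemma cvg_ip {T : Type} {F : set_system T} {FF : Filter F}
    (f g : T -> 'rV[R]_(n + p)) a b :
  f @ F --> a -> g @ F --> b -> ip (f x) (g x) @[x --> F] --> ip a b.
Proof.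
by move=> fa gb; apply: cvgB; (apply: cvg_big => [|i _]; first exact: add_continuous);
  apply: cvgM; exact: cvg_coord.
Qed.

Lemma cvg_point_line (V : normedModType R) (u v : V) :
  u + t *: v @[t --> (0 : R)^'+] --> u.
Proof.
have : u + t *: v @[t --> (0 : R)^'+] --> u + (0 : R) *: v.
  apply: cvg_at_right_filter; apply: cvgD; first exact: cvg_cst.
  by apply: cvgZr_tmp; exact: cvg_id.
by rewrite scale0r addr0.
Qed.

Lemma cvg_near_eq_to {T : Type} {F : set_system T} {FF : Filter F} (V : topologicalType)
    (f g : T -> V) (l : V) : (\forall t \near F, f t = g t) -> f @ F --> l -> g @ F --> l.
Proof. by move=> fg fl; exact: (cvg_trans (near_eq_cvg fg) fl). Qed.

Lemma near_line (V : normedModType R) (u v : V) (P : V -> Prop) :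
  (\forall w \near u, P w) -> \forall t \near (0 : R)^'+, P (u + t *: v).
Proof. by move=> Pu; exact: (@cvg_point_line _ u v _ Pu). Qed.

Lemma coord_le_norm m q (A : 'M[R]_(m, q)) i j : `|A i j| <= `|A|.
Proof. by rewrite [leRHS]/Num.Def.normr/= mx_normrE; exact: (le_bigmax _ _ (i, j)). Qed.

Lemma norm_le_coord m q (A : 'M[R]_(m, q)) c : 0 <= c ->
  (forall i j, `|A i j| <= c) -> `|A| <= c.
Proof.
by move=> c0 h; rewrite [leLHS]/Num.Def.normr/= mx_normrE bigmax_le.
Qed.

Lemma norm_mulmx m q r (A : 'M[R]_(m, q)) (B : 'M[R]_(q, r)) :
  `|A *m B| <= q%:R * `|A| * `|B|.
Proof.
apply: norm_le_coord => [|i j]; first by rewrite !mulr_ge0.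
rewrite mxE (le_trans (ler_norm_sum _ _ _))//.
rewrite -mulrA -[q in q%:R]card_ord -sumr_const mulr_suml ler_sum// => k _.
by rewrite mul1r normrM ler_pM// coord_le_norm.
Qed.

Lemma norm_trmx_le m q (A : 'M[R]_(m, q)) : `|A^T| <= `|A|.
Proof. by apply: norm_le_coord => // i j; rewrite mxE coord_le_norm. Qed.

Lemma cvg_mulmx_bounded {T : Type} {F : set_system T} {FF : Filter F} m q r
    (A : T -> 'M[R]_(m, q)) (X : T -> 'M[R]_(q, r)) B :
  (\forall t \near F, `|A t| <= B) -> X t @[t --> F] --> (0 : 'M[R]_(q, r)) ->
  A t *m X t @[t --> F] --> (0 : 'M[R]_(m, r)).
Proof.
move=> AB X0; apply/cvgr0Pnorm_le => e e0.
have K0 : 0 < q%:R * `|B| + 1 by rewrite ltr_wpDl// mulr_ge0.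
have eK : 0 < e / (q%:R * `|B| + 1) by rewrite divr_gt0.
have : \forall t \near F, `|X t| <= e / (q%:R * `|B| + 1).
  by move/cvgr0Pnorm_le : X0; apply.
apply: filterS2 AB => t At Xt; rewrite (le_trans (norm_mulmx _ _))//.
have : q%:R * `|A t| * `|X t| <= (q%:R * `|B| + 1) * (e / (q%:R * `|B| + 1)).
  rewrite ler_pM ?mulr_ge0// (@le_trans _ _ (q%:R * `|B|)) ?lerDl//.
  by rewrite ler_wpM2l// (le_trans At)// ler_norm.
by move=> /le_trans; apply; rewrite mulrC divfK// gt_eqF.
Qed.

Lemma cvg_mulmx_cst {T : Type} {F : set_system T} {FF : Filter F} m q r
    (X : T -> 'M[R]_(m, q)) (A : 'M[R]_(q, r)) :
  X t @[t --> F] --> (0 : 'M[R]_(m, q)) -> X t *m A @[t --> F] --> (0 : 'M[R]_(m, r)).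
Proof.
move=> X0.
have X0' : (X t)^T @[t --> F] --> (0 : 'M[R]_(q, m)).
  apply/cvgr0Pnorm_le => e e0; move/cvgr0Pnorm_le/(_ _ e0) : X0.
  by apply: filterS => t; apply: le_trans; exact: norm_trmx_le.
have := @cvg_mulmx_bounded _ _ _ _ _ _ (fun=> A^T) _ `|A^T| _ X0'.
have h : \forall t \near F, `|A^T| <= `|A^T| by apply: filterE.
move=> /(_ FF h) /cvgr0Pnorm_le H; apply/cvgr0Pnorm_le => e e0.
apply: filterS (H _ e0) => t; rewrite -trmx_mul; apply: le_trans.
by rewrite -{1}(trmxK (X t *m A)) norm_trmx_le.
Qed.

Lemma linear_le_quadratic (a b : R) : (forall t, t * b <= t ^+ 2 * a) -> b = 0.
Proof.
move=> h; apply/eqP; rewrite -sqrf_eq0 eq_le sqr_ge0 andbT.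
have a1 : 0 < `|a| + 1 by rewrite ltr_wpDl.
(* At this value the linear term dominates; the [+ 1] makes the denominator positive and larger than
   [a]. *)
have := h (b / (`|a| + 1)); rewrite -subr_ge0.
have -> : (b / (`|a| + 1)) ^+ 2 * a - b / (`|a| + 1) * b =
   - (b ^+ 2 * ((`|a| + 1 - a) / (`|a| + 1) ^+ 2)) by field; rewrite gt_eqF.
rewrite oppr_ge0 pmulr_lle0// divr_gt0 ?exprn_gt0//.
by have := ler_norm a; lra.
Qed.

Lemma cvg_quotient {W : normedModType R} (f : R -> W) df :
  is_derive (0 : R) (1 : R) f df ->
  t^-1 *: (f t - f 0) @[t --> (0 : R)^'+] --> df.
Proof.
move=> hf; apply/cvgrPdist_le => c c0.
have := is_derive_eps hf c0 => h.
near=> t.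
have t0 : 0 < t by [].
have : `|f t - f 0 - t *: df| <= c * `|t|.
  by near: t; exact: (cvg_within _ h).
rewrite (gtr0_norm t0) -ler_pdivrMr// => H.
apply: le_trans H; rewrite distrC ler_pdivlMr//.
rewrite -[X in _ * X](gtr0_norm t0) mulrC -normrZ scalerBr scalerA.
by rewrite divff ?gt_eqF// scale1r.
Unshelve. all: by end_near. Qed.

Lemma cvg_mx {T : Type} {F : set_system T} {FF : Filter F} m q
    (f : T -> 'M[R]_(m, q)) (a : 'M[R]_(m, q)) :
  (forall i j, f x i j @[x --> F] --> a i j) -> f x @[x --> F] --> a.
Proof.
move=> h; apply/cvgrPdist_le => e e0.
have H i j : \forall x \near F, `|a i j - f x i j| <= e.
  by move/cvgrPdist_le : (h i j); apply.
have : \forall x \near F, forall i j, `|a i j - f x i j| <= e.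
  by apply: filter_forall => i; apply: filter_forall => j; exact: H.
apply: filterS => x hx; apply: norm_le_coord => [|i j]; first exact: ltW.
by rewrite !mxE.
Qed.

(** With the integrating factor, [f t * expR (- C * t)] is nonincreasing. *)
Lemma gronwall_zero (f df : R -> R) (C : R) :
  (forall t : R, 0 <= t <= 1 -> is_derive t (1 : R) f (df t)) ->
  (forall t : R, 0 <= t <= 1 -> df t <= C * f t) -> f 0 = 0 -> f 1 <= 0.
Proof.
move=> hf hdf f0.
pose h t := f t * expR (- C * t).
have dh (t : R) : 0 <= t <= 1 -> is_derive t (1 : R) h ((df t - C * f t) * expR (- C * t)).
  move=> ht; have d1 := hf _ ht.
  have d2 : is_derive t (1 : R) (fun t => expR (- C * t)) (- C * expR (- C * t)).
    have d3 : is_derive t (1 : R) (fun t => - C * t) (- C).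
      have := is_deriveZ (- C) (is_derive_id t (1 : R)).
      by move=> /is_derive_eq; apply; rewrite /GRing.scale/= mulr1.
    have := @is_derive1_comp _ _ _ _ _ _ (is_derive_expR (- C * t)) d3.
    by move=> /is_derive_eq; apply; rewrite /GRing.scale/= mulrC.
  have := is_deriveM d1 d2.
  by move=> /is_derive_eq; apply; rewrite /GRing.scale/=; ring.
have : h 1 <= h 0.
  apply: (@ler0_derive1_nincr _ h 0 1) => //.
  - by move=> t /[!in_itv]/= /andP[t0 t1]; have [] := dh t; rewrite ?ltW.
  - move=> t /[!in_itv]/= /andP[t0 t1]; have ht : 0 <= t <= 1 by rewrite !ltW.
    have [_ e] := dh t ht; rewrite derive1E e pmulr_lle0 ?expR_gt0//.
    by rewrite subr_le0; exact: hdf.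
  - apply: derivable_within_continuous => t /[!in_itv]/= ht.
    by have [] := dh t ht.
rewrite /h f0 mul0r pmulr_lle0 ?expR_gt0//.
Qed.

Lemma near_forall2 {T : Type} {F : set_system T} {FF : Filter F} m q
    (P : 'I_m -> 'I_q -> T -> Prop) : (forall i j, \forall x \near F, P i j x) ->
  \forall x \near F, forall i j, P i j x.
Proof. by move=> h; apply: filter_forall => i; apply: filter_forall => j; exact: h. Qed.

Lemma sqr_sum_norm m (a : 'I_m -> R) :
  (\sum_i `|a i|) * (\sum_i `|a i|) <= m%:R * \sum_i a i ^+ 2.
Proof.
have -> : m%:R * (\sum_i a i ^+ 2) = \sum_i \sum_j (a i ^+ 2 + a j ^+ 2) / 2.
  have -> : \sum_i \sum_j (a i ^+ 2 + a j ^+ 2) / 2 =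
    (\sum_i \sum_(j < m) a i ^+ 2 + \sum_(i < m) \sum_j a j ^+ 2) / 2.
    rewrite -big_split mulr_suml; apply: eq_bigr => i _.
    by rewrite -big_split mulr_suml.
  have E1 : \sum_(i < m) \sum_(j < m) a i ^+ 2 = m%:R * \sum_i a i ^+ 2.
    by rewrite mulr_sumr; apply: eq_bigr => i _; rewrite sumr_const card_ord mulr_natl.
  have E2 : \sum_(i < m) \sum_(j < m) a j ^+ 2 = m%:R * \sum_i a i ^+ 2.
    by rewrite sumr_const card_ord mulr_natl.
  by rewrite E1 E2; field.
rewrite mulr_suml ler_sum// => i _; rewrite mulr_sumr ler_sum// => j _.
rewrite -(real_normK (num_real (a i))) -(real_normK (num_real (a j))).
rewrite ler_pdivlMr// -subr_ge0.
have -> : `|a i| ^+ 2 + `|a j| ^+ 2 - `|a i| * `|a j| * 2 = (`|a i| - `|a j|) ^+ 2 by ring.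
exact: sqr_ge0.
Qed.

(** * Tangent and normal vectors of a spacelike immersion [Y] of an open set [U] *)

Variables (U : set 'rV[R]_n) (Y : 'rV[R]_n -> 'rV[R]_(n + p)).
Hypothesis oU : open U.
Hypothesis sY : smooth_on U Y.
Hypothesis posY : forall u v, U u -> v != 0 -> 0 < ip (dd v Y u) (dd v Y u).

Definition tangent_at u w := exists v, w = dd v Y u.
Definition normal_at u z := forall v, ip (dd v Y u) z = 0.

Let dY u (Uu : U u) : differentiable Y u := smooth_on_differentiable sY Uu.

Let sDY v : smooth_on U (dd v Y) := smooth_on_dd v sY.

Let dDY v u (Uu : U u) : differentiable (dd v Y) u :=
  smooth_on_differentiable (sDY v) Uu.

Let ddJ v u (Uu : U u) : dd v Y u = v *m 'J Y u.
Proof. by rewrite ddE deriveEjacobian//; exact: dY. Qed.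

Let posJ u : U u -> forall v : 'rV_n, v != 0 -> 0 < ip (v *m 'J Y u) (v *m 'J Y u).
Proof. by move=> Uu v v0; rewrite -ddJ//; exact: posY. Qed.

Lemma tangential_part u w : U u -> exists v, normal_at u (w - dd v Y u).
Proof.
move=> Uu; have [v hv] := ortho_decomposition (posJ Uu) w; exists v => x.
by have := hv x; rewrite -!ddJ.
Qed.

Lemma normal_le0 u z : U u -> normal_at u z -> ip z z <= 0.
Proof.
move=> Uu nz; apply: (nor_ip_le0 (posJ Uu)) => v.
by rewrite -ddJ//; exact: nz.
Qed.

Lemma normal_eq0 u z : U u -> normal_at u z -> 0 <= ip z z -> z = 0.
Proof.
move=> Uu nz; apply: (nor_ip_eq0 (posJ Uu)) => v.
by rewrite -ddJ//; exact: nz.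
Qed.

(** On the unit sphere of coordinate vectors the metric at [u0] has a positive minimum. By
    compactness of the sphere, half of it bounds the metric below at all nearby points; homogeneity
    does the rest. *)
Lemma coercive u0 : U u0 -> exists2 c : R, 0 < c &
  \forall u \near u0, U u /\ forall v, c * `|v| ^+ 2 <= ip (dd v Y u) (dd v Y u).
Proof.
move=> Uu0; pose S : set 'rV[R]_n := [set v | `|v| = 1].
have cS : compact S.
  apply: bounded_closed_compact.
    by exists 1; split=> [|x x1 v /= ->]; [exact: num_real|exact: ltW].
  have -> : S = (fun v : 'rV[R]_n => `|v|) @^-1` [set 1 : R] by [].
  apply: preimage_closed; last exact: closed_eq.
  by move=> v _; exact: norm_continuous.
have cg v u : U u -> ip (dd (z.1) Y z.2) (dd (z.1) Y z.2) @[z --> (v, u)] -->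
    ip (dd v Y u) (dd v Y u).
  by move=> Uu; apply: cvg_ip; exact: cvg_dd_pair oU sY Uu.
suff [c c0 nc] : exists2 c : R, 0 < c & \forall u \near u0,
    S `<=` (fun v => c < ip (dd v Y u) (dd v Y u)).
  exists c => //; have : \forall u \near u0, U u by exact: open_nbhs_nbhs.
  apply: filterS2 nc => u h Uu; split => // v.
  have [->|v0] := eqVneq v 0; first by rewrite normr0 expr0n mulr0 dd0l ip0l.
  have nv : 0 < `|v| by rewrite normr_gt0.
  have Sv : S (`|v|^-1 *: v) by rewrite /S/= normrZ normfV normr_id mulVf ?gt_eqF.
  have := ltW (h _ Sv); rewrite ddZl; last exact: dY.
  by rewrite ipZl ipZr mulrA -invfM mulrC ler_pdivlMr ?mulr_gt0// expr2.
(* In dimension 0 the sphere is empty and any constant works. *)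
have [[v1 Sv1]|S0] := pselect (S !=set0); last first.
  exists 1 => //; apply: (@filterE _ (nbhs u0)) => u v Sv.
  by exfalso; apply: S0; exists v.
have [||v2 v2S hv2] := @EVT_min_rV _ n (fun v => ip (dd v Y u0) (dd v Y u0)) S _ cS.
- by exists v1.
- apply: continuous_subspaceT => v.
  have -> : (fun w => ip (dd w Y u0) (dd w Y u0)) = (fun w => ip ('d Y u0 w) ('d Y u0 w)).
    by apply/funext => w; rewrite ddE deriveE//; exact: dY.
  have cd : continuous ('d Y u0) by apply: diff_continuous; exact: dY.
  exact: (cvg_ip (cd v) (cd v)).
rewrite inE in v2S.
have m0 : 0 < ip (dd v2 Y u0) (dd v2 Y u0).
  by apply: posY => //; rewrite -normr_eq0 (v2S : `|v2| = 1) oner_neq0.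
exists (ip (dd v2 Y u0) (dd v2 Y u0) / 2); first by rewrite divr_gt0.
have /compact_near_coveringP/(_ _ (nbhs u0)) := cS; apply.
move=> v Sv; have := cg v u0 Uu0.
move=> /cvgr_gt; apply; apply: lt_le_trans (hv2 v _); last by rewrite inE.
by rewrite ltr_pdivrMr// ltr_pMr// ltr1n.
Qed.

Lemma cvg_line (f : 'rV[R]_n -> 'rV[R]_(n + p)) u v : {for u, continuous f} ->
  f (u + t *: v) @[t --> (0 : R)^'+] --> f u.
Proof.
move=> cf; apply: (cvg_comp (fun t : R => u + t *: v) f _ cf).
exact: cvg_point_line.
Qed.

(* Tangency passes to the limit because the coefficients stay bounded. *)
Lemma tangent_limit u0 w (c : R -> 'rV[R]_(n + p)) c0 z : U u0 ->
  (\forall t \near (0 : R)^'+, tangent_at (u0 + t *: w) (c t)) ->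
  c t @[t --> (0 : R)^'+] --> c0 -> normal_at u0 z -> ip c0 z = 0.
Proof.
move=> Uu0 tc cc nz.
have [k k0 nk] := coercive Uu0.
have cD v : {for u0, continuous (dd v Y)} := smooth_on_continuous (sDY v) Uu0.
have cz : ip (c t) z @[t --> (0 : R)^'+] --> ip c0 z.
  by apply: cvg_ip => //; exact: cvg_cst.
apply: (cvg_unique _ cz) => //.
(* By coercivity [K] bounds the coefficient vector of [c t] as soon as [ip (c t) (c t)] is below
   [|ip c0 c0| + 1]. The pairings of [z] with the coordinate tangent vectors tend to 0, hence so
   does [ip (c t) z]. *)
pose K := Num.sqrt ((`|ip c0 c0| + 1) / k).
have c20 : K * \sum_i `|ip (dd (delta_mx 0 i) Y (u0 + t *: w)) z| @[t --> (0 : R)^'+] --> (0 : R).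
  have E : K * (\sum_(i < n) `|ip (dd (delta_mx 0 i) Y u0) z|) = 0.
    by rewrite [X in K * X]big1 ?mulr0// => i _; rewrite nz normr0.
  rewrite -[X in _ `=>` nbhs X]E.
  apply: cvgM; first exact: cvg_cst.
  apply: cvg_big => [|i _]; first exact: add_continuous.
  apply: cvg_norm; apply: cvg_ip; last exact: cvg_cst.
  exact: (cvg_line w (cD (delta_mx 0 i))).
apply/cvgr0Pnorm_le => e e0.
near=> t.
have [Ut kt] : U (u0 + t *: w) /\ forall v, k * `|v| ^+ 2 <=
    ip (dd v Y (u0 + t *: w)) (dd v Y (u0 + t *: w)).
  near: t.
  exact: (@cvg_point_line _ u0 w _ nk).
have [th cE] : tangent_at (u0 + t *: w) (c t) by near: t.
have cB : ip (c t) (c t) <= `|ip c0 c0| + 1.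
  near: t; apply: (cvgr_le (ip c0 c0)); first exact: cvg_ip.
  by rewrite (le_lt_trans (ler_norm _))// ltrDl.
have thK : `|th| <= K.
  rewrite -(ger0_norm (normr_ge0 th)) -sqrtr_sqr ler_wsqrtr//.
  by rewrite ler_pdivlMr// mulrC (le_trans (kt _))// -cE.
have : `|K * \sum_i `|ip (dd (delta_mx 0 i) Y (u0 + t *: w)) z| | <= e.
  by near: t; move/cvgr0Pnorm_le : c20; apply.
apply: le_trans; rewrite [leRHS]ger0_norm ?mulr_ge0 ?sqrtr_ge0 ?sumr_ge0//.
rewrite cE (dd_basis _ (dY Ut)) ip_suml (le_trans (ler_norm_sum _ _ _))//.
rewrite mulr_sumr ler_sum// => i _; rewrite ipZl normrM ler_wpM2r//.
exact: le_trans (coord_le_norm _ _ _) thK.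
Unshelve. all: by end_near. Qed.

Local Opaque ip.

(** First variation: the best tangential correction is the orthogonal projection, because the linear
    term in any direction [v] must vanish. *)
Lemma tangential_part_max u w th : U u ->
  (forall th', - ip (w - dd th' Y u) (w - dd th' Y u) <=
               - ip (w - dd th Y u) (w - dd th Y u)) ->
  normal_at u (w - dd th Y u).
Proof.
move=> Uu h v; have dYu := dY Uu.
suff /eqP : 2 * ip (dd v Y u) (w - dd th Y u) = 0.
  by rewrite mulf_eq0 pnatr_eq0 => /eqP.
apply: (@linear_le_quadratic (ip (dd v Y u) (dd v Y u))) => t.
have := h (th + t *: v); rewrite (ddDl _ _ dYu) (ddZl _ _ dYu) (opprD (dd th Y u)) addrA.
set z := w - _; set d := dd v Y u.
move: z d => z d.
rewrite !ipBl !ipBr !ipZl !ipZr (ipC z d).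
by set a := ip z z; set b := ip d z; set c := ip d d; lra.
Qed.

(* The tangential correction is affine along a line; its second order term
   would not contribute. *)
Lemma line_second_order u0 v xi xi1 : U u0 ->
  let W t := Y (u0 + t *: v) - dd xi Y (u0 + t *: v) - t *: dd xi1 Y (u0 + t *: v) in
  let W1 t := dd v Y (u0 + t *: v) - dd v (dd xi Y) (u0 + t *: v)
     - (dd xi1 Y (u0 + t *: v) + t *: dd v (dd xi1 Y) (u0 + t *: v)) in
  let W2 := dd v (dd v Y) u0 - dd v (dd v (dd xi Y)) u0 - dd v (dd xi1 Y) u0 *+ 2 in
  (\forall t \near (0 : R), is_derive t (1 : R) W (W1 t)) /\
  is_derive (0 : R) (1 : R) W1 W2.
Proof.
move=> Uu0 W W1 W2.
have line (f : 'rV[R]_n -> 'rV[R]_(n + p)) : smooth_on U f -> forall t : R, U (u0 + t *: v) ->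
    is_derive t (1 : R) (fun s : R => f (u0 + s *: v)) (dd v f (u0 + t *: v)).
  by move=> sf t Ut; apply: is_derive_dd; exact: smooth_on_differentiable sf Ut.
have is_derive_tid (t : R) : is_derive t (1 : R) (id : R -> R) 1 by exact: is_derive_id.
split.
  have : \forall t \near (0 : R), U (u0 + t *: v).
    have : nbhs (u0 + (0 : R) *: v) U by rewrite scale0r addr0; exact: open_nbhs_nbhs.
    have : u0 + t *: v @[t --> (0 : R)] --> u0 + (0 : R) *: v.
      by apply: cvgD; [exact: cvg_cst|apply: cvgZr_tmp; exact: cvg_id].
    by apply.
  apply: filterS => t Ut.
  apply: is_deriveB; first by apply: is_deriveB; exact: line.
  have := is_derive_scale (is_derive_tid t) (line _ (sDY xi1) t Ut).
  by rewrite scale1r.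
have U0 : U (u0 + (0 : R) *: v) by rewrite scale0r addr0.
have -> : W2 = dd v (dd v Y) (u0 + (0 : R) *: v) -
    dd v (dd v (dd xi Y)) (u0 + (0 : R) *: v) -
    (dd v (dd xi1 Y) (u0 + (0 : R) *: v) +
     (1 *: dd v (dd xi1 Y) (u0 + (0 : R) *: v) +
      (0 : R) *: dd v (dd v (dd xi1 Y)) (u0 + (0 : R) *: v))).
  rewrite (scale0r v) (addr0 u0) scale1r (scale0r (dd v (dd v _) _)).
  by rewrite (addr0 (dd v (dd xi1 Y) u0)) /W2 mulr2n.
have sDDY x y : smooth_on U (dd x (dd y Y)) by exact/smooth_on_dd/sDY.
apply: is_deriveB; first by apply: is_deriveB; apply: line.
apply: is_deriveD; first exact: line.
exact: (is_derive_scale (is_derive_tid 0) (line _ (sDDY v xi1) 0 U0)).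
Qed.

(** At the parameter [t] the correction [xi + t *: xi1] is one competitor among all [th], so the
    defect that it leaves is at most [s], with equality at [t = 0]. The conclusion is the pair of
    derivative tests at that maximum; [xi1] stays free, to be adapted to [v]. *)
Lemma max_second_variation u0 v xi xi1 s : U u0 ->
  (\forall u \near u0, forall th, - ip (Y u - dd th Y u) (Y u - dd th Y u) <= s) ->
  - ip (Y u0 - dd xi Y u0) (Y u0 - dd xi Y u0) = s ->
  let z := Y u0 - dd xi Y u0 in
  let W1 := dd v Y u0 - dd v (dd xi Y) u0 - dd xi1 Y u0 in
  let W2 := dd v (dd v Y) u0 - dd v (dd v (dd xi Y)) u0 - dd v (dd xi1 Y) u0 *+ 2 in
  ip z W1 = 0 /\ - ip W1 W1 - ip z W2 <= 0.
Proof.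
move=> Uu0 hmax hs z W1 W2.
pose W (t : R) := Y (u0 + t *: v) - dd xi Y (u0 + t *: v) - t *: dd xi1 Y (u0 + t *: v).
pose V1 (t : R) := dd v Y (u0 + t *: v) - dd v (dd xi Y) (u0 + t *: v)
     - (dd xi1 Y (u0 + t *: v) + t *: dd v (dd xi1 Y) (u0 + t *: v)).
have [dW dW1] : (\forall t \near (0 : R), is_derive t (1 : R) W (V1 t)) /\
  is_derive (0 : R) (1 : R) V1 W2 by exact: line_second_order.
have Wz : W 0 = z by rewrite /W (scale0r v) (addr0 u0) (scale0r (dd xi1 _ _)) subr0.
have V1z : V1 0 = W1 by rewrite /V1 (scale0r v) (addr0 u0) (scale0r (dd v _ _)) (addr0 (dd xi1 Y u0)).
pose phi t := - ip (W t) (W t).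
pose psi t := - (ip (V1 t) (W t) + ip (W t) (V1 t)).
have hphi : \forall t \near (0 : R), is_derive t (1 : R) phi (psi t).
  by apply: filterS dW => t dWt; apply: is_deriveN; exact: is_derive_ip.
have dW0 := nbhs_singleton dW.
have dpsi : is_derive (0 : R) (1 : R) psi
    (- (ip W2 (W 0) + ip (V1 0) (V1 0) + (ip (V1 0) (V1 0) + ip (W 0) W2))).
  by apply: is_deriveN; apply: is_deriveD; exact: is_derive_ip.
have hm : \forall t \near (0 : R), phi t <= phi 0.
  have -> : phi 0 = s by rewrite /phi Wz.
  have : \forall t \near (0 : R), U (u0 + t *: v) /\
      forall th, - ip (Y (u0 + t *: v) - dd th Y (u0 + t *: v)) (Y (u0 + t *: v) - dd th Y (u0 + t *: v)) <= s.
    have hU : nbhs u0 U by exact: open_nbhs_nbhs.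
    have : nbhs (u0 + (0 : R) *: v) (U `&` [set u | forall th, - ip (Y u - dd th Y u) (Y u - dd th Y u) <= s]).
      by rewrite scale0r addr0; exact: filterI.
    have : u0 + t *: v @[t --> (0 : R)] --> u0 + (0 : R) *: v.
      by apply: cvgD; [exact: cvg_cst|apply: cvgZr_tmp; exact: cvg_id].
    by apply.
  apply: filterS => t [Ut ht]; have := ht (xi + t *: xi1).
  by rewrite (ddDl _ _ (dY Ut)) (ddZl _ _ (dY Ut)) (opprD (dd xi Y _)) addrA.
have [] := second_derivative_max hphi dpsi hm.
rewrite /psi Wz V1z (ipC W1 z) (ipC W2 z); rewrite -/W1 => + c0; split; lra.
Qed.

Lemma tangent_atB u a b : U u -> tangent_at u a -> tangent_at u b -> tangent_at u (a - b).
Proof.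
move=> Uu [x ->] [y ->]; exists (x - y).
by rewrite (ddDl _ _ (dY Uu)) (ddNl _ (dY Uu)).
Qed.

Lemma tangent_atZ u k a : U u -> tangent_at u a -> tangent_at u (k *: a).
Proof. by move=> Uu [x ->]; exists (k *: x); rewrite (ddZl _ _ (dY Uu)). Qed.

Lemma dd2_bilinear u m (a b : 'I_m -> R) (e : 'I_m -> 'rV[R]_n) : U u ->
  dd (\sum_i a i *: e i) (dd (\sum_j b j *: e j) Y) u =
  \sum_i \sum_j (a i * b j) *: dd (e i) (dd (e j) Y) u.
Proof.
move=> Uu; rewrite dd_suml; last exact: dDY.
apply: eq_bigr => i _; rewrite (ddZl _ _ (dDY _ Uu)) (dd_comm _ _ oU sY Uu).
rewrite dd_suml; last exact: dDY.
rewrite scaler_sumr; apply: eq_bigr => j _.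
by rewrite (ddZl _ _ (dDY _ Uu)) scalerA (dd_comm _ _ oU sY Uu).
Qed.

Definition orthonormal_at u (E : 'M[R]_n) :=
  forall i j, ip (dd (row i E) Y u) (dd (row j E) Y u) = (i == j)%:R.

(** The equation [H = - X^perp / 2] without a projection: the trace of the second derivative and
    [- Y / 2] differ by a tangent vector. The frame only has to exist at each point, with no
    regularity in [u]. *)
Definition self_shrinker_at u := exists2 E : 'M[R]_n, orthonormal_at u E &
  tangent_at u (\sum_k dd (row k E) (dd (row k E) Y) u + 2^-1 *: Y u).

Lemma orthonormal_at_unit u E : U u -> orthonormal_at u E -> E \in unitmx.
Proof.
move=> Uu oE.
have [|h _] := @mulmx1_unit _ n E ('J Y u *m diag_mx ip_sign *m ('J Y u)^T *m E^T); last by [].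
apply/matrixP => i j; rewrite !mulmxA.
by rewrite [RHS]mxE -oE !ddJ// -!row_mul ip_row trmx_mul !mulmxA.
Qed.

(** * The self-shrinker equation differentiated along a line *)

Section ShrinkerDerivative.
Variables (u0 xi ze : 'rV[R]_n) (E : 'M[R]_n) (z : 'rV[R]_(n + p)).
Hypothesis Uu0 : U u0.
Hypothesis oE : orthonormal_at u0 E.
Hypothesis shr : forall u, U u -> self_shrinker_at u.
Hypothesis zeE : dd ze Y u0 = \sum_k dd (row k E) (dd (row k E) Y) u0 + 2^-1 *: Y u0.
Hypothesis nz : normal_at u0 z.

Let e i := row i E.
(** The derivative at [u0] along [xi] of the Gram matrix [M] of the constant coordinate frame
    [E]. *)
Let g1 : 'M[R]_n := \matrix_(i, j) (ip (dd xi (dd (e i) Y) u0) (dd (e j) Y u0) +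
  ip (dd (e i) Y u0) (dd xi (dd (e j) Y) u0)).
Let S i j (t : R) := dd (e i) (dd (e j) Y) (u0 + t *: xi).
Let M (t : R) : 'M[R]_n :=
  \matrix_(i, j) ip (dd (e i) Y (u0 + t *: xi)) (dd (e j) Y (u0 + t *: xi)).

Let line0 (f : 'rV[R]_n -> 'rV[R]_(n + p)) : smooth_on U f ->
  is_derive (0 : R) (1 : R) (fun s : R => f (u0 + s *: xi)) (dd xi f u0).
Proof.
move=> sf; have := @is_derive_dd _ _ _ f u0 xi (0 : R).
rewrite (scale0r xi) (addr0 u0); apply.
exact: smooth_on_differentiable sf Uu0.
Qed.

Let dM : is_derive (0 : R) (1 : R) M g1.
Proof.
apply: is_derive_mx => i j; rewrite mxE.
have := is_derive_ip (line0 (sDY (e i))) (line0 (sDY (e j))).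
by rewrite (scale0r xi) (addr0 u0); under [in X in _ -> X]eq_fun do rewrite mxE.
Qed.

Let M0 : M 0 = 1%:M.
Proof.
apply/matrixP => i j; rewrite [LHS]mxE (scale0r xi) (addr0 u0).
by rewrite oE mxE.
Qed.

Let near_U : \forall t \near (0 : R)^'+, U (u0 + t *: xi).
Proof.
have nU : nbhs u0 U by exact: open_nbhs_nbhs.
exact: (@cvg_point_line _ u0 xi _ nU).
Qed.

(* The inverse metric in the frame [E] is [1 - t g1 + o(t)] along the line, and
   tangency of the self-shrinker equation divided by [t] survives the limit. *)
Lemma shrinker_derivative :
  ip (\sum_i dd xi (dd (e i) (dd (e i) Y)) u0
      - \sum_i \sum_j g1 i j *: dd (e i) (dd (e j) Y) u0
      - dd xi (dd ze Y) u0) z = 0.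
Proof.
have Eu := orthonormal_at_unit Uu0 oE.
pose P t F := U (u0 + t *: xi) -> orthonormal_at (u0 + t *: xi) F /\
    tangent_at (u0 + t *: xi) (\sum_k dd (row k F) (dd (row k F) Y) (u0 + t *: xi)
       + 2^-1 *: Y (u0 + t *: xi)).
have exF t : exists F, P t F.
  have [Ut|nUt] := pselect (U (u0 + t *: xi)); last by exists 0.
  by have [F oF tF] := shr Ut; exists F.
have [F hF] := choice exF.
(* The frames [F t] come from a choice and may jump with [t]. The trace depends on them only through
   [G t], which is the inverse of [M t] and hence determined by the point. *)
pose C t := F t *m invmx E.
have CE t : F t = C t *m E by rewrite mulmxKV.
pose G t := (C t)^T *m C t.
have GM t : U (u0 + t *: xi) -> G t *m M t = 1%:M.
  move=> Ut; have [oF _] := hF _ Ut.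
  have CMC : C t *m (M t *m (C t)^T) = 1%:M.
    have ME : M t = E *m ('J Y (u0 + t *: xi) *m diag_mx ip_sign *m ('J Y (u0 + t *: xi))^T) *m E^T.
      apply/matrixP => i j; rewrite mxE !ddJ// /e -!row_mul ip_row.
      by rewrite trmx_mul !mulmxA.
    rewrite ME !mulmxA -CE -!mulmxA -trmx_mul -CE.
    apply/matrixP => i j; rewrite [RHS]mxE -oF !ddJ// -!row_mul ip_row.
    by rewrite trmx_mul !mulmxA.
  by apply: mulmx1C; rewrite /G mulmxA; exact: mulmx1C.
(* Coercivity bounds the rows of any orthonormal frame, which replaces continuity of [F]. *)
have [B hB] : exists B, \forall t \near (0 : R)^'+, `|G t| <= B.
  have [k k0 nk] := coercive Uu0.
  pose K := Num.sqrt k^-1; pose K1 := n%:R * K * `|invmx E|.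
  have K1_ge0 : 0 <= K1 by rewrite !mulr_ge0// sqrtr_ge0.
  exists (n%:R * K1 * K1).
  apply: filterS (near_line xi nk) => t [Ut kt].
  have [oF _] := hF _ Ut.
  have FK : `|F t| <= K.
    apply: norm_le_coord => [|i j]; first exact: sqrtr_ge0.
    have -> : F t i j = row i (F t) 0 j by rewrite mxE.
    apply: le_trans (coord_le_norm _ _ _) _.
    rewrite -(ger0_norm (normr_ge0 (row i (F t)))) -sqrtr_sqr ler_wsqrtr//.
    rewrite -[leRHS]mul1r ler_pdivlMr// mulrC (le_trans (kt _))// oF eqxx.
    by [].
  have CK : `|C t| <= K1.
    rewrite (le_trans (norm_mulmx _ _))// /K1 ler_wpM2r// ler_wpM2l//.
  rewrite (le_trans (norm_mulmx _ _))// ler_pM ?mulr_ge0// ler_wpM2l//.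
  exact: le_trans (norm_trmx_le _) CK.
pose D t : 'M[R]_n := t^-1 *: (G t - 1%:M + t *: g1).
have cD : D t @[t --> (0 : R)^'+] --> (0 : 'M[R]_n).
  have cQ := cvg_quotient dM; rewrite M0 in cQ.
  have cP : t^-1 *: (M t - 1%:M) - g1 @[t --> (0 : R)^'+] --> (0 : 'M[R]_n).
    by rewrite -(subrr g1); apply: cvgB => //; exact: cvg_cst.
  have cM : M t - 1%:M @[t --> (0 : R)^'+] --> (0 : 'M[R]_n).
    have ct : t @[t --> (0 : R)^'+] --> (0 : R) by apply: cvg_at_right_filter; exact: cvg_id.
    have h : t *: (t^-1 *: (M t - 1%:M)) @[t --> (0 : R)^'+] --> (0 : R) *: g1 by exact: cvgZ.
    rewrite scale0r in h; apply: (cvg_near_eq_to _ h).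
    near=> t; have t0 : 0 < t by [].
    by rewrite scalerA divff ?gt_eqF// scale1r.
  (* From [G M = 1] this difference equals [g1 - t^-1 (1 - G) = D t]; each term is a bounded factor
     times one that tends to 0. *)
  have h : G t *m ((M t - 1%:M) *m g1) - G t *m (t^-1 *: (M t - 1%:M) - g1) @[t --> (0 : R)^'+]
      --> (0 - 0 : 'M[R]_n).
    by apply: cvgB; apply: (cvg_mulmx_bounded hB) => //; exact: cvg_mulmx_cst.
  rewrite subr0 in h; apply: (cvg_near_eq_to _ h).
  near=> t; have t0 : 0 < t by [].
  have Ut : U (u0 + t *: xi) by near: t.
  rewrite /D mulmxBr -scalemxAr mulmxA !mulmxBr mulmx1 GM// mulmxBl mul1mx.
  have -> : t^-1 *: (G t - 1%:M + t *: g1) = g1 - t^-1 *: (1%:M - G t).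
    by rewrite [LHS]scalerDr scalerA mulVf ?gt_eqF// scale1r addrC -(opprB 1%:M) scalerN.
  by move: (G t *m g1) (t^-1 *: _) => x y; rewrite opprB addrA subrK.
(* [Q] is the self-shrinker expression with [1 - t g1] in place of [G t], hence differentiable.
   Subtracting the tangent vector [dd ze Y] makes it vanish at 0, so that [c t], the true expression
   divided by [t], has a limit. *)
pose Q t := \sum_i S i i t - t *: (\sum_i \sum_j g1 i j *: S i j t)
  + 2^-1 *: Y (u0 + t *: xi) - dd ze Y (u0 + t *: xi).
pose c t := t^-1 *: (Q t - Q 0) + \sum_i \sum_j D t i j *: S i j t.
have S0 i j : S i j 0 = dd (e i) (dd (e j) Y) u0.
  by rewrite /S (scale0r xi) (addr0 u0).
have dS i j : is_derive (0 : R) (1 : R) (S i j) (dd xi (dd (e i) (dd (e j) Y)) u0).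
  by apply: line0; exact/smooth_on_dd/sDY.
have Q0 : Q 0 = 0.
  rewrite /Q (scale0r xi) (addr0 u0) (scale0r (\sum_i _)) zeE.
  under eq_bigr do rewrite S0.
  by rewrite (subr0 (\sum_i _)) subrr.
have dQ : is_derive (0 : R) (1 : R) Q
    (\sum_i dd xi (dd (e i) (dd (e i) Y)) u0
      - \sum_i \sum_j g1 i j *: dd (e i) (dd (e j) Y) u0
      + 2^-1 *: dd xi Y u0 - dd xi (dd ze Y) u0).
  apply: is_deriveB; last by apply: line0.
  apply: is_deriveD; last by apply: is_deriveZ; exact: line0.
  apply: is_deriveB; first by apply: is_derive_sumf => i; exact: dS.
  pose SS t := \sum_i \sum_j g1 i j *: S i j t.
  have dSS : is_derive (0 : R) (1 : R) SS (\sum_i \sum_j g1 i j *: dd xi (dd (e i) (dd (e j) Y)) u0).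
    by apply: is_derive_sumf => i; apply: is_derive_sumf => j; exact: is_deriveZ.
  have := is_derive_scale (is_derive_id (0 : R) (1 : R)) dSS.
  rewrite scale1r (scale0r (\sum_i _)) (addr0 (SS 0)) /SS.
  by under [X in is_derive _ _ _ X -> _]eq_bigr do under eq_bigr do rewrite S0.
have tc : \forall t \near (0 : R)^'+, tangent_at (u0 + t *: xi) (c t).
  near=> t; have t0 : 0 < t by [].
  have Ut : U (u0 + t *: xi) by near: t.
  have [_ tF] := hF _ Ut.
  have -> : c t = t^-1 *: (\sum_k dd (row k (F t)) (dd (row k (F t)) Y) (u0 + t *: xi)
       + 2^-1 *: Y (u0 + t *: xi) - dd ze Y (u0 + t *: xi)).
    pose L (A : 'M[R]_n) := \sum_i \sum_j A i j *: S i j t.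
    have LD A A' : L (A + A') = L A + L A'.
      rewrite /L -big_split; apply: eq_bigr => i _; rewrite -big_split.
      by apply: eq_bigr => j _; rewrite mxE scalerDl.
    have LZ k A : L (k *: A) = k *: L A.
      rewrite /L scaler_sumr; apply: eq_bigr => i _; rewrite scaler_sumr.
      by apply: eq_bigr => j _; rewrite mxE scalerA.
    have L1 : L 1%:M = \sum_i S i i t.
      apply: eq_bigr => i _; rewrite (bigD1 i)//= big1 => [|j ji].
        by rewrite mxE eqxx scale1r (addr0 (S i i t)).
      by rewrite mxE eq_sym (negbTE ji) scale0r.
    have -> : \sum_k dd (row k (F t)) (dd (row k (F t)) Y) (u0 + t *: xi) = L (G t).
      have FE k : row k (F t) = \sum_i C t k i *: e i.
        rewrite CE row_mul mulmx_sum_row; apply: eq_bigr => i _.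
        by rewrite mxE.
      under eq_bigr => k _ do rewrite FE dd2_bilinear//.
      rewrite exchange_big; apply: eq_bigr => i _ /=.
      rewrite exchange_big; apply: eq_bigr => j _ /=.
      rewrite mxE scaler_suml; apply: eq_bigr => k _.
      by rewrite [(C t)^T i k]mxE.
    have GE : G t = 1%:M - t *: g1 + t *: D t.
      rewrite /D scalerA divff ?gt_eqF// scale1r addrCA addrC.
      by rewrite subrK addrC subrK.
    have LN A : L (- A) = - L A by rewrite -scaleN1r LZ scaleN1r.
    have -> : L (G t) = \sum_i S i i t - t *: L g1 + t *: L (D t).
      by rewrite GE LD (LD 1%:M) L1 LN (LZ t g1) (LZ t (D t)).
    rewrite /c Q0 (subr0 (Q t)) /Q -/(L g1) -/(L (D t)).
    move: (\sum_i S i i t) (L g1) (L (D t)) (2^-1 *: Y _) (dd ze Y _) => x1 x2 x3 x4 x5.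
    have tn0 : t != 0 by rewrite gt_eqF.
    rewrite -[in LHS](scale1r x3) -(mulVf tn0) -scalerA -scalerDr.
    by congr (_ *: _); rewrite addrAC (addrAC _ x4).
  by apply: tangent_atZ => //; apply: tangent_atB => //; exists ze.
have cc : c t @[t --> (0 : R)^'+] --> \sum_i dd xi (dd (e i) (dd (e i) Y)) u0
      - \sum_i \sum_j g1 i j *: dd (e i) (dd (e j) Y) u0
      + 2^-1 *: dd xi Y u0 - dd xi (dd ze Y) u0.
  have h : \sum_i \sum_j D t i j *: S i j t @[t --> (0 : R)^'+] -->
      \sum_(i < n) \sum_(j < n) (0 : 'M[R]_n) i j *: S i j 0.
    apply: cvg_big => [|i _]; first exact: add_continuous.
    apply: cvg_big => [|j _]; first exact: add_continuous.
    apply: cvgZ; first exact: cvg_coord.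
    have cS : {for u0, continuous (dd (e i) (dd (e j) Y))}.
      exact: smooth_on_continuous (smooth_on_dd _ (sDY _)) Uu0.
    by rewrite S0; exact: (cvg_line xi cS).
  have E0 : \sum_(i < n) \sum_(j < n) (0 : 'M[R]_n) i j *: S i j 0 = 0.
    by rewrite big1 // => i _; rewrite big1// => j _; rewrite mxE scale0r.
  rewrite E0 in h.
  by rewrite -[X in _ `=>` nbhs X]addr0; apply: cvgD => //; exact: cvg_quotient.
have := tangent_limit Uu0 tc cc nz.
by rewrite !ipBl ipDl ipZl (nz xi) mulr0 addr0 !ipBl.
Unshelve. all: by end_near. Qed.

End ShrinkerDerivative.

Lemma dd_near_eq (f g : 'rV[R]_n -> 'rV[R]_(n + p)) u v : U u ->
  (forall x, U x -> f x = g x) -> dd v f u = dd v g u.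
Proof.
move=> Uu fg; rewrite !ddE; apply: near_eq_derive.
have nU : nbhs u U by exact: open_nbhs_nbhs.
by apply: filterS nU => x /fg.
Qed.

Lemma dd3_comm u v xi : U u -> dd xi (dd v (dd v Y)) u = dd v (dd v (dd xi Y)) u.
Proof.
move=> Uu; rewrite (dd_comm _ _ oU (sDY v) Uu).
by apply: dd_near_eq => // x Ux; exact: dd_comm oU sY Ux.
Qed.

Lemma orthonormal_coord u E a : U u -> orthonormal_at u E ->
  a = \sum_j ip (dd a Y u) (dd (row j E) Y u) *: row j E.
Proof.
move=> Uu oE; have Eu := orthonormal_at_unit Uu oE.
pose d := a *m invmx E.
have aE : a = \sum_j d 0 j *: row j E by rewrite -mulmx_sum_row mulmxKV.
rewrite {1}aE; apply: eq_bigr => j _; congr (_ *: _).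
rewrite aE dd_suml; last exact: dY.
rewrite ip_suml (bigD1 j)//= big1 => [|k kj].
  by rewrite (ddZl _ _ (dY Uu)) ipZl oE eqxx mulr1 addr0.
by rewrite (ddZl _ _ (dY Uu)) ipZl oE (negbTE kj) mulr0.
Qed.

(** The core of Step 1. The second variations summed over an orthonormal frame give
    [0 <= S - T - 2 K] for the sums [S], [T], [K] of [ip z (S i)], [ip z (T i)], [ip z (K i)]. The
    derivative of the self-shrinker equation along [xi] gives [T = 2 S - 2 K], and the equation
    itself gives [S = s / 2]. Together these say [0 <= - s / 2]. *)
Lemma shrinker_max_defect u0 xi s : U u0 ->
  (forall u, U u -> self_shrinker_at u) ->
  (\forall u \near u0, forall th, - ip (Y u - dd th Y u) (Y u - dd th Y u) <= s) ->
  - ip (Y u0 - dd xi Y u0) (Y u0 - dd xi Y u0) = s -> s <= 0.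
Proof.
move=> Uu0 shr hmax hs.
pose z := Y u0 - dd xi Y u0.
have nz : normal_at u0 z.
  by apply: tangential_part_max => // th; rewrite hs; have := nbhs_singleton hmax; exact.
have nz' v : ip z (dd v Y u0) = 0 by rewrite ipC nz.
have zY : ip z (Y u0) = - s.
  by rewrite -hs opprK -/z {3}/z ipBr nz' subr0.
have [E oE [ze zeE]] := shr _ Uu0.
pose e i := row i E.
(* The first variation with no correction of first order; taken at [v = ze], it removes the last
   term of [shrinker_derivative]. *)
have B1 v : ip z (dd v (dd xi Y) u0) = 0.
  have [+ _] := max_second_variation v 0 Uu0 hmax hs.
  rewrite !(ipBr z) nz' nz' sub0r subr0 => /eqP.
  by rewrite oppr_eq0 => /eqP.
have [a ha] := choice (fun i =>
  tangential_part (dd (e i) Y u0 - dd (e i) (dd xi Y) u0) Uu0).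
pose S i := dd (e i) (dd (e i) Y) u0.
pose T i := dd (e i) (dd (e i) (dd xi Y)) u0.
pose K i := dd (e i) (dd (a i) Y) u0.
have W2_ge0 i : 0 <= ip z (S i) - ip z (T i) - ip z (K i) *+ 2.
  have [_] := max_second_variation (e i) (a i) Uu0 hmax hs.
  have := normal_le0 Uu0 (ha i).
  set W1 := _ - _ - _; rewrite mulr2n !(ipBr z) (ipDr z) -/(S i) -/(T i) -/(K i).
  by lra.
pose c i j := ip (dd (a i) Y u0) (dd (e j) Y u0).
have KE i : K i = \sum_j c i j *: dd (e i) (dd (e j) Y) u0.
  rewrite /K (dd_comm _ _ oU sY Uu0) {1}(orthonormal_coord (a i) Uu0 oE).
  rewrite dd_suml; last exact: dDY.
  apply: eq_bigr => j _.
  by rewrite (ddZl _ _ (dDY _ Uu0)) (dd_comm _ _ oU sY Uu0).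
(* Normality of the first-order term, tested on [dd (e j) Y], expresses the derivative of the metric
   by the coefficients [c] of the vectors [a i]. *)
have gE i j : ip (dd xi (dd (e i) Y) u0) (dd (e j) Y u0) = (i == j)%:R - c i j.
  rewrite (dd_comm _ _ oU sY Uu0) -oE /c -ipBl.
  apply/eqP; rewrite eq_sym -subr_eq0 -ipBl ipC; apply/eqP.
  by rewrite -[RHS](ha i (e j)); congr (ip _ _); rewrite addrAC.
have := shrinker_derivative xi Uu0 oE shr (esym zeE) nz.
rewrite ipC (ipBr z) (dd_comm _ _ oU sY Uu0) B1 subr0 (ipBr z).
have -> : \sum_i dd xi (dd (row i E) (dd (row i E) Y)) u0 = \sum_i T i.
  by apply: eq_bigr => i _; exact: dd3_comm.
have -> : ip z (\sum_i \sum_j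
  (\matrix_(i', j') (ip (dd xi (dd (row i' E) Y) u0) (dd (row j' E) Y u0) +
     ip (dd (row i' E) Y u0) (dd xi (dd (row j' E) Y) u0))) i j *:
     dd (row i E) (dd (row j E) Y) u0) = (\sum_i ip z (S i)) *+ 2 - (\sum_i ip z (K i)) *+ 2.
  pose sg i j := ip z (dd (e i) (dd (e j) Y) u0).
  have sgC i j : sg i j = sg j i by rewrite /sg (dd_comm _ _ oU sY Uu0).
  have KS : \sum_i ip z (K i) = \sum_i \sum_j c i j * sg i j.
    by apply: eq_bigr => i _; rewrite KE ip_sumr; apply: eq_bigr => j _; rewrite ipZr.
  have KS' : \sum_i ip z (K i) = \sum_i \sum_j c j i * sg i j.
    rewrite KS exchange_big; apply: eq_bigr => i _; apply: eq_bigr => j _.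
    by rewrite sgC.
  transitivity (\sum_i (\sum_j ((i == j)%:R * sg i j) *+ 2
      - \sum_j c i j * sg i j - \sum_j c j i * sg i j)).
    rewrite ip_sumr; apply: eq_bigr => i _; rewrite ip_sumr -!sumrB.
    apply: eq_bigr => j _; rewrite mxE gE (ipC (dd (row i E) Y u0)) gE (eq_sym j).
    by rewrite ipZr /sg /e; ring.
  rewrite 2!sumrB -KS -KS' [X in _ = _ - X]mulr2n opprD addrA.
  congr (_ - _ - _); rewrite -sumrMnl; apply: eq_bigr => i _ /=.
  rewrite (bigD1 i)//= big1 => [|j ji]; first by rewrite eqxx mul1r addr0.
  by rewrite eq_sym (negbTE ji) mul0r mul0rn.
rewrite ip_sumr => hT.
have SS : \sum_i ip z (S i) = s / 2.
  rewrite -ip_sumr; have -> : \sum_i S i = dd ze Y u0 - 2^-1 *: Y u0.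
    by rewrite -zeE addrK.
  by rewrite ipBr nz' ipZr zY; lra.
have W2s : 0 <= \sum_i ip z (S i) - \sum_i ip z (T i) - (\sum_i ip z (K i)) *+ 2.
  by rewrite -sumrMnl -!sumrB sumr_ge0.
rewrite SS in hT W2s.
have fin (x y : R) : x - (s / 2 *+ 2 - y *+ 2) = 0 -> 0 <= s / 2 - x - y *+ 2 -> s <= 0.
  by rewrite !mulr2n; lra.
exact: fin hT W2s.
Qed.

(** * Immersions whose position vector is tangent *)

Section TangentPosition.
Hypothesis tY : forall u, U u -> tangent_at u (Y u).

Let near_tangent u0 v xi xi1 : U u0 -> \forall t \near (0 : R)^'+,
  tangent_at (u0 + t *: v) (Y (u0 + t *: v) - dd xi Y (u0 + t *: v) - t *: dd xi1 Y (u0 + t *: v)).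
Proof.
move=> Uu0; have nU : \forall u \near u0, U u by exact: open_nbhs_nbhs.
apply: filterS (near_line v nU) => t Ut.
apply: tangent_atB => //; last by apply: tangent_atZ => //; exists xi1.
by apply: tangent_atB => //; [exact: tY|exists xi].
Qed.

(** [Y - dd xi Y] is tangent along the line and vanishes at [u0], so its derivative there is
    tangent. Thus the second fundamental form annihilates the position direction [xi]. *)
Lemma position_first_order u0 xi v z : U u0 -> Y u0 = dd xi Y u0 ->
  normal_at u0 z -> ip (dd v (dd xi Y) u0) z = 0.
Proof.
move=> Uu0 xiE nz.
pose W (t : R) := Y (u0 + t *: v) - dd xi Y (u0 + t *: v) - t *: dd 0 Y (u0 + t *: v).
pose W1 (t : R) := dd v Y (u0 + t *: v) - dd v (dd xi Y) (u0 + t *: v)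
     - (dd 0 Y (u0 + t *: v) + t *: dd v (dd 0 Y) (u0 + t *: v)).
have [dW _] : (\forall t \near (0 : R), is_derive t (1 : R) W (W1 t)) /\ _ :=
  line_second_order v xi 0 Uu0.
have W0 : W 0 = 0.
  by rewrite /W (scale0r v) (addr0 u0) (scale0r (dd 0 _ _)) subr0 xiE subrr.
have W10 : W1 0 = dd v Y u0 - dd v (dd xi Y) u0.
  by rewrite /W1 (scale0r v) (addr0 u0) (scale0r (dd v (dd 0 _) _)) (addr0 (dd 0 _ _)) dd0l subr0.
have cW : t^-1 *: W t @[t --> (0 : R)^'+] --> W1 0.
  have := cvg_quotient (nbhs_singleton dW); rewrite W0.
  by under eq_cvg do rewrite subr0.
have tW : \forall t \near (0 : R)^'+, tangent_at (u0 + t *: v) (t^-1 *: W t).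
  have nU : \forall u \near u0, U u by exact: open_nbhs_nbhs.
  by apply: filterS2 (near_tangent v xi 0 Uu0) (near_line v nU) => t tt Ut; exact: tangent_atZ.
have := tangent_limit Uu0 tW cW nz.
by rewrite W10 ipBl nz sub0r => /eqP; rewrite oppr_eq0 => /eqP.
Qed.

(** Once [xi1] cancels the first derivative as well, the tangent vectors [W t / t ^+ 2] converge to
    [W2 / 2], and tangency passes to the limit. *)
Lemma position_second_order u0 xi xi1 v z : U u0 -> Y u0 = dd xi Y u0 ->
  dd v Y u0 - dd v (dd xi Y) u0 - dd xi1 Y u0 = 0 -> normal_at u0 z ->
  ip (dd v (dd v Y) u0 - dd v (dd v (dd xi Y)) u0 - dd v (dd xi1 Y) u0 *+ 2) z = 0.
Proof.
move=> Uu0 xiE xi1E nz.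
pose W (t : R) := Y (u0 + t *: v) - dd xi Y (u0 + t *: v) - t *: dd xi1 Y (u0 + t *: v).
pose W1 (t : R) := dd v Y (u0 + t *: v) - dd v (dd xi Y) (u0 + t *: v)
     - (dd xi1 Y (u0 + t *: v) + t *: dd v (dd xi1 Y) (u0 + t *: v)).
pose W2 := dd v (dd v Y) u0 - dd v (dd v (dd xi Y)) u0 - dd v (dd xi1 Y) u0 *+ 2.
have [dW dW1] : (\forall t \near (0 : R), is_derive t (1 : R) W (W1 t)) /\
  is_derive (0 : R) (1 : R) W1 W2 := line_second_order v xi xi1 Uu0.
have W0 : W 0 = 0.
  by rewrite /W (scale0r v) (addr0 u0) (scale0r (dd xi1 _ _)) subr0 xiE subrr.
have W10 : W1 0 = 0.
  by rewrite /W1 (scale0r v) (addr0 u0) (scale0r (dd v (dd xi1 _) _)) (addr0 (dd xi1 _ _)) xi1E.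
have cW : t ^- 2 *: W t @[t --> (0 : R)^'+] --> 2^-1 *: W2.
  apply: cvg_mx => i j; rewrite mxE mulrC.
  under eq_cvg do rewrite mxE.
  apply: (@second_order_limit _ (fun t => W t i j) (fun t => W1 t i j)).
  - by rewrite W0 mxE.
  - by rewrite W10 mxE.
  - by apply: filterS dW => t; exact: is_derive_coord.
  - exact: is_derive_coord.
have tW : \forall t \near (0 : R)^'+, tangent_at (u0 + t *: v) (t ^- 2 *: W t).
  have nU : \forall u \near u0, U u by exact: open_nbhs_nbhs.
  by apply: filterS2 (near_tangent v xi xi1 Uu0) (near_line v nU) => t tt Ut; exact: tangent_atZ.
have /eqP := tangent_limit Uu0 tW cW nz.
by rewrite ipZl mulf_eq0 invr_eq0 pnatr_eq0/= => /eqP.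
Qed.

(** The first-order test at a maximum of [|A(v, v)|^2 / |v|^4]. While the point moves along [w], the
    direction moves as [v0 + t *: v1], with [v1] chosen so that its image under the differential is
    stationary; hence its length contributes nothing. *)
Lemma second_form_first_variation u0 w v0 v1 th0 s : U u0 ->
  (forall u, U u -> forall v th, - ip (dd v (dd v Y) u - dd th Y u) (dd v (dd v Y) u - dd th Y u)
     <= s * ip (dd v Y u) (dd v Y u) ^+ 2) ->
  - ip (dd v0 (dd v0 Y) u0 - dd th0 Y u0) (dd v0 (dd v0 Y) u0 - dd th0 Y u0) = s ->
  ip (dd v0 Y u0) (dd v0 Y u0) = 1 ->
  dd w (dd v0 Y) u0 + dd v1 Y u0 = 0 ->
  0 <= ip (dd v0 (dd v0 Y) u0 - dd th0 Y u0)
     (dd w (dd v0 (dd v0 Y)) u0 + dd v0 (dd v1 Y) u0 *+ 2 - dd w (dd th0 Y) u0).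
Proof.
move=> Uu0 hmax hs g1 wv.
have line0 (f : 'rV[R]_n -> 'rV[R]_(n + p)) : smooth_on U f ->
    is_derive (0 : R) (1 : R) (fun s : R => f (u0 + s *: w)) (dd w f u0).
  move=> sf; have := @is_derive_dd _ _ _ f u0 w (0 : R).
  by rewrite (scale0r w) (addr0 u0); apply; exact: smooth_on_differentiable sf Uu0.
have sDDY x y : smooth_on U (dd x (dd y Y)) by exact/smooth_on_dd/sDY.
have did : is_derive (0 : R) (1 : R) (id : R -> R) 1 by exact: is_derive_id.
pose S00 t := dd v0 (dd v0 Y) (u0 + t *: w).
pose S01 t := dd v0 (dd v1 Y) (u0 + t *: w).
pose S11 t := dd v1 (dd v1 Y) (u0 + t *: w).
(* The bilinear expansion of the second derivative in the direction [v0 + t *: v1], written with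
   fixed directions so that it can be differentiated in [t]. *)
pose Z (t : R) := S00 t + t *: (S01 t *+ 2 + t *: S11 t) - dd th0 Y (u0 + t *: w).
pose V (t : R) := dd v0 Y (u0 + t *: w) + t *: dd v1 Y (u0 + t *: w).
have ZE t : U (u0 + t *: w) ->
   Z t = dd (v0 + t *: v1) (dd (v0 + t *: v1) Y) (u0 + t *: w) - dd th0 Y (u0 + t *: w).
  move=> Ut; rewrite /Z; congr (_ - _).
  rewrite (ddDl _ _ (dDY _ Ut)) (ddZl _ _ (dDY _ Ut)).
  rewrite (dd_comm _ _ oU sY Ut) (ddDl _ _ (dDY v0 Ut)) (ddZl _ _ (dDY v0 Ut)).
  rewrite (dd_comm _ (v0 + _) oU sY Ut) (ddDl _ _ (dDY v1 Ut)) (ddZl _ _ (dDY v1 Ut)).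
  rewrite -/(S00 t) -/(S11 t) (dd_comm v1 v0 oU sY Ut) -/(S01 t).
  by rewrite mulr2n !scalerDr !addrA.
have VE t : U (u0 + t *: w) -> V t = dd (v0 + t *: v1) Y (u0 + t *: w).
  by move=> Ut; rewrite /V (ddDl _ _ (dY Ut)) (ddZl _ _ (dY Ut)).
pose Z' := dd w (dd v0 (dd v0 Y)) u0 + dd v0 (dd v1 Y) u0 *+ 2 - dd w (dd th0 Y) u0.
have Z0 : Z 0 = dd v0 (dd v0 Y) u0 - dd th0 Y u0.
  by rewrite /Z /S00 (scale0r w) (addr0 u0) (scale0r (_ + _)) (addr0 (dd v0 (dd v0 Y) u0)).
have V0 : V 0 = dd v0 Y u0.
  by rewrite /V (scale0r w) (addr0 u0) (scale0r (dd v1 _ _)) (addr0 (dd v0 Y u0)).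
have dZ : is_derive (0 : R) (1 : R) Z Z'.
  apply: is_deriveB; last exact: line0.
  apply: is_deriveD; first exact: line0.
  pose L t := S01 t *+ 2 + t *: S11 t.
  have [dL _] : is_derive (0 : R) (1 : R) L
     (dd w (dd v0 (dd v1 Y)) u0 + dd w (dd v0 (dd v1 Y)) u0 + (1 *: S11 0 + (0 : R) *: dd w (dd v1 (dd v1 Y)) u0)).
    apply: is_deriveD; last by apply: is_derive_scale => //; exact: line0.
    rewrite (_ : (fun t => S01 t *+ 2) = (fun t => S01 t + S01 t)); last first.
      by apply/funext => t; rewrite mulr2n.
    by apply: is_deriveD; exact: line0.
  have := is_derive_scale did (derivableP dL).
  rewrite scale1r (scale0r ('D_1 L 0)) (addr0 (L 0)) /L (scale0r (S11 0)) (addr0 (S01 0 *+ 2)).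
  by rewrite /S01 (scale0r w) (addr0 u0).
have dV : is_derive (0 : R) (1 : R) V 0.
  rewrite -wv; apply: is_deriveD; first exact: line0.
  have := is_derive_scale did (line0 _ (sDY v1)).
  by rewrite scale1r (scale0r w) (addr0 u0) (scale0r (dd w _ _)) (addr0 (dd v1 Y u0)).
pose g t := ip (V t) (V t).
have dg : is_derive (0 : R) (1 : R) g 0.
  have := is_derive_ip dV dV; rewrite ip0l ip0r addr0; exact.
pose phi t := - ip (Z t) (Z t) - s * g t ^+ 2.
have g0 : g 0 = 1 by rewrite /g V0.
have phi0 : phi 0 = 0 by rewrite /phi Z0 g0 hs expr1n mulr1 subrr.
have dphi : is_derive (0 : R) (1 : R) phi (- (ip Z' (Z 0) + ip (Z 0) Z') - s *: 0).
  apply: is_deriveB; first by apply: is_deriveN; exact: is_derive_ip.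
  apply: is_deriveZ.
  have := is_deriveX 2 dg; rewrite scaler0; exact.
have cphi := cvg_quotient dphi.
have le0 : - (ip Z' (Z 0) + ip (Z 0) Z') - s *: 0 <= 0.
  apply: (cvgr_to_le cphi).
  have nU : \forall u \near u0, U u by exact: open_nbhs_nbhs.
  near=> t; have t0 : 0 < t by [].
  have Ut : U (u0 + t *: w) by near: t; exact: near_line.
  rewrite phi0 subr0 /GRing.scale/= pmulr_rle0 ?invr_gt0//.
  by rewrite /phi subr_le0 ZE// /g VE//; exact: hmax.
move: le0; rewrite scaler0 subr0 (ipC Z') -Z0 -/Z' oppr_le0.
by move: (ip _ _) => x; lra.
Unshelve. all: by end_near. Qed.

(* X is a tangent field under which the second fundamental form is
   homogeneous of negative degree, so |A(v, v)| cannot have a positive maximum. *)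
Lemma tangent_position_max u0 v0 th0 s : U u0 ->
  (forall u, U u -> forall v th, - ip (dd v (dd v Y) u - dd th Y u) (dd v (dd v Y) u - dd th Y u)
     <= s * ip (dd v Y u) (dd v Y u) ^+ 2) ->
  - ip (dd v0 (dd v0 Y) u0 - dd th0 Y u0) (dd v0 (dd v0 Y) u0 - dd th0 Y u0) = s ->
  ip (dd v0 Y u0) (dd v0 Y u0) = 1 -> s <= 0.
Proof.
move=> Uu0 hmax hs g1.
pose Z0 := dd v0 (dd v0 Y) u0 - dd th0 Y u0.
have nZ : normal_at u0 Z0.
  apply: tangential_part_max => // th; rewrite hs.
  by have := hmax _ Uu0 v0 th; rewrite g1 expr1n mulr1.
have [xi xiE] := tY Uu0.
have [xi1 nxi1] := tangential_part (dd v0 Y u0 - dd v0 (dd xi Y) u0) Uu0.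
(* The left side is normal by the choice of [xi1], and tangent by [position_first_order]. *)
have xi1E : dd v0 Y u0 - dd v0 (dd xi Y) u0 - dd xi1 Y u0 = 0.
  apply: (normal_eq0 Uu0 nxi1).
  rewrite {1}[X in ip X _](_ : _ = dd v0 Y u0 - dd v0 (dd xi Y) u0 - dd xi1 Y u0)//.
  by rewrite ipBl ipBl (position_first_order v0 Uu0 xiE nxi1) !nxi1 !subr0.
have W2 := position_second_order Uu0 xiE xi1E nZ.
(* The move is against the flow of [X], the direction in which [|A|] grows; by [xi1E], the variation
   [v0 - xi1] keeps the image of [v0] constant to first order. *)
have := @second_form_first_variation u0 (- xi) v0 (v0 - xi1) th0 s Uu0 hmax hs g1.
rewrite !(ddNl _ (dDY _ Uu0)) (ddDl _ _ (dY Uu0)) (ddNl _ (dY Uu0)).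
rewrite (dd_comm xi v0 oU sY Uu0) -/Z0.
have -> : - dd v0 (dd xi Y) u0 + (dd v0 Y u0 - dd xi1 Y u0) = 0.
  by rewrite addrA [X in X - _]addrC.
move=> /(_ erefl).
rewrite (ddNl _ (smooth_on_differentiable (smooth_on_dd v0 (sDY v0)) Uu0)).
rewrite (dd3_comm _ _ Uu0) (dd_comm xi th0 oU sY Uu0).
rewrite (dd_comm v0 (v0 - xi1) oU sY Uu0) (ddDl _ _ (dDY v0 Uu0)) (ddNl _ (dDY v0 Uu0)).
rewrite (dd_comm xi1 v0 oU sY Uu0).
have P0 : ip Z0 (dd th0 (dd xi Y) u0) = 0 by rewrite ipC (position_first_order th0 Uu0 xiE nZ).
(* Eliminating the third-order term by [W2] reduces the variation inequality to
   [0 <= ip Z0 (dd v0 (dd v0 Y) u0)], that is [0 <= - s]. *)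
have ZS : ip Z0 (dd v0 (dd v0 Y) u0) = - s.
  by rewrite -hs opprK -/Z0 {3}/Z0 ipBr (ipC _ (dd th0 _ _)) nZ subr0.
rewrite (ipC _ Z0) in W2; move: W2; rewrite !(mulr2n, ipBr Z0, ipDr Z0, ipNr) ZS P0.
by move: (ip Z0 _) (ip Z0 _) => x y; lra.
Qed.

End TangentPosition.

(* For [z] normal at [u], the sum of the squares of [ip (dd e_i Y) z] satisfies a
   linear differential inequality along segments from [u]. *)
Lemma tangent_plane_locally_constant u0 : U u0 ->
  (forall u, U u -> forall v w, tangent_at u (dd v (dd w Y) u)) ->
  \forall u \near u0, U u /\ forall z, (normal_at u z <-> normal_at u0 z).
Proof.
move=> Uu0 tS.
have [k k0 nk] := coercive Uu0.
pose e (i : 'I_n) : 'rV[R]_n := delta_mx 0 i.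
pose S i j := dd (e i) (dd (e j) Y).
have [B nB] : exists B, \forall u \near u0, forall i j, ip (S i j u) (S i j u) <= B.
  pose B := \sum_i \sum_j (`|ip (S i j u0) (S i j u0)| + 1).
  exists B; apply: (near_forall2 (F := nbhs u0)) => i j.
  have cS : ip (S i j u) (S i j u) @[u --> u0] --> ip (S i j u0) (S i j u0).
    have c : {for u0, continuous (S i j)} := smooth_on_continuous (smooth_on_dd _ (sDY _)) Uu0.
    exact: (cvg_ip c c).
  apply: (cvgr_le _ cS).
  apply: (@lt_le_trans _ _ (`|ip (S i j u0) (S i j u0)| + 1)).
    by rewrite (le_lt_trans (ler_norm _))// ltrDl.
  rewrite /B (bigD1 i)//= (bigD1 j)//= -addrA lerDl addr_ge0//; last first.
    by apply: sumr_ge0 => x _; apply: sumr_ge0 => y _; rewrite addr_ge0.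
  by apply: sumr_ge0 => y _; rewrite addr_ge0.
have [r /= r0 hr] := (nbhs_ballP u0 _).1 (filterI nk nB).
pose K := Num.sqrt (B / k).
have K0 : 0 <= K := sqrtr_ge0 _.
(* Stated for two arbitrary points of the ball, so that exchanging them gives the converse. *)
have step (u u' : 'rV[R]_n) z : ball u0 r u -> ball u0 r u' -> normal_at u z -> normal_at u' z.
  move=> bu bu' nz; pose w := u' - u.
  have bt (t : R) : 0 <= t <= 1 -> ball u0 r (u + t *: w).
    move=> /andP[t0 t1]; move: bu bu'; rewrite -!ball_normE /ball_/= => bu bu'.
    have -> : u0 - (u + t *: w) = (1 - t) *: (u0 - u) + t *: (u0 - u').
      by rewrite /w !scalerBr !scalerBl !scale1r; move: (t *: u0) (t *: u) (t *: u') => a b c;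
        rewrite opprD opprB; apply/rowP => i; rewrite !mxE; ring.
    apply: le_lt_trans (ler_normD _ _) _; rewrite !normrZ !ger0_norm ?subr_ge0//.
    have [t10|t10] := eqVneq t 0; first by rewrite t10 subr0 mul1r mul0r addr0.
    have tp : 0 < t by rewrite lt_def t10.
    have -> : r = (1 - t) * r + t * r by ring.
    by rewrite ler_ltD// ?ltr_pM2l// ler_wpM2l ?subr_ge0// ltW.
  pose a i t := ip (dd (e i) Y (u + t *: w)) z.
  pose psi t := \sum_i a i t ^+ 2.
  pose dpsi t := \sum_i (a i t * ip (dd w (dd (e i) Y) (u + t *: w)) z) *+ 2.
  have dpsiP (t : R) : 0 <= t <= 1 -> is_derive t (1 : R) psi (dpsi t).
    move=> ht; have [[Ut _] _] := hr _ (bt _ ht).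
    apply: is_derive_sumf => i.
    have d1 := is_derive_ip (is_derive_dd (dDY (e i) Ut)) (is_derive_cst z t (1 : R)).
    rewrite ip0r addr0 in d1.
    have := is_deriveX 2 d1; move=> /is_derive_eq; apply.
    rewrite /a /cst /= expr1 mulr2n; move: (ip _ _) (ip _ _) => x y.
    by rewrite /GRing.scale/=; ring.
  have bound (t : R) : 0 <= t <= 1 -> dpsi t <= (2 * `|w| * K * n%:R * n%:R) * psi t.
    move=> ht; have [[Ut kt] Bt] := hr _ (bt _ ht).
    (* Second derivatives are tangent, with coefficients bounded by [K] through coercivity; their
       pairings with [z] are thus controlled by the functions [a l], and the differential inequality
       closes. *)
    have Si i j : `|ip (S i j (u + t *: w)) z| <= K * \sum_l `|a l t|.
      have [th thE] := tS _ Ut (e i) (e j).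
      have thK : `|th| <= K.
        rewrite -(ger0_norm (normr_ge0 th)) -sqrtr_sqr ler_wsqrtr//.
        by rewrite ler_pdivlMr// mulrC (le_trans (kt _))// -thE; exact: Bt.
      rewrite /S thE (dd_basis _ (dY Ut)) ip_suml (le_trans (ler_norm_sum _ _ _))//.
      rewrite mulr_sumr ler_sum// => l _; rewrite ipZl normrM ler_wpM2r//.
      exact: le_trans (coord_le_norm _ _ _) thK.
    have Di i : `|ip (dd w (dd (e i) Y) (u + t *: w)) z| <=
        n%:R * (`|w| * (K * \sum_l `|a l t|)).
      rewrite (dd_basis _ (dDY (e i) Ut)) ip_suml (le_trans (ler_norm_sum _ _ _))//.
      rewrite -[n in n%:R]card_ord -sumr_const mulr_suml ler_sum// => j _.
      by rewrite mul1r ipZl normrM ler_pM// ?coord_le_norm//; exact: Si.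
    have A0 : 0 <= \sum_l `|a l t| by exact: sumr_ge0.
    apply: (@le_trans _ _ (\sum_i (`|a i t| * (n%:R * (`|w| * (K * \sum_l `|a l t|)))) *+ 2)).
      rewrite ler_sum// => i _; rewrite lerMn2r//=.
      by rewrite (le_trans (ler_norm _))// normrM ler_wpM2l.
    rewrite sumrMnl -mulr_suml.
    have := sqr_sum_norm (a ^~ t); rewrite -/(psi t).
    have c0 : 0 <= n%:R * `|w| * K by rewrite !mulr_ge0.
    move=> /(ler_wpM2l c0).
    have fin (A ps N nw KK : R) : N * nw * KK * (A * A) <= N * nw * KK * (N * ps) ->
        A * (N * (nw * (KK * A))) *+ 2 <= 2 * nw * KK * N * N * ps.
      by rewrite -mulr_natr; lra.
    exact: fin.
  have psi0 : psi 0 = 0.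
    by rewrite /psi big1// => i _; rewrite /a (scale0r w) (addr0 u) nz expr0n.
  have psi1 := gronwall_zero dpsiP bound psi0.
  have [[Uu' _] _] := hr _ bu'.
  have a1 i : a i 1 = 0.
    apply/eqP; rewrite -sqrf_eq0.
    have /psumr_eq0P -> // : \sum_i a i 1 ^+ 2 = 0.
      by apply/eqP; rewrite eq_le psi1 sumr_ge0// => j _; exact: sqr_ge0.
    by move=> j _; exact: sqr_ge0.
  move=> v; rewrite (dd_basis _ (dY Uu')) ip_suml big1// => i _.
  have := a1 i; rewrite /a (scale1r w) /w addrC subrK ipZl => ->.
  by rewrite mulr0.
have b0 : ball u0 r u0 by exact: ballxx.
have : nbhs u0 (ball u0 r) by exact: nbhsx_ballx.
apply: filterS => u bu; have [[Uu _] _] := hr _ bu; split => // z.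
by split; exact: step.
Qed.

End LocalGeometry.

Lemma dd_val {R : realType} {V W : normedModType R} (f : V -> W) u v df :
  is_derive u v f df -> dd v f u = df.
Proof. by move=> [_ <-]; rewrite ddE. Qed.

(** * Charts and pointwise estimates *)

Section Charts.
Context {R : realType} {n p : nat} (M : smooth_manifold R n).
Implicit Types (c d : chart R n M) (x : M).

Lemma chart_cod_inv c u : chart_cod c u ->
  chart_dom c (chart_inv c u) /\ chart_fun c (chart_inv c u) = u.
Proof. by move=> [x cx <-]; rewrite chart_funK. Qed.

Lemma chart_cod_fun c x : chart_dom c x -> chart_cod c (chart_fun c x).
Proof. by exists x. Qed.

Lemma open_chart_preimage c (A : set M) : open A ->
  open (chart_fun c @` (chart_dom c `&` A)).
Proof.
move=> oA; rewrite openE => u [x [cx Ax] xu].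
have Cu : chart_cod c u by exists x.
have nC : \forall w \near u, chart_cod c w by apply: open_nbhs_nbhs; split => //; exact: open_chart_cod.
have nA : \forall w \near u, A (chart_inv c w).
  have := continuous_chart_inv Cu; apply; rewrite -xu chart_funK//.
  exact: open_nbhs_nbhs.
apply: filterS2 nC nA => w Cw Aw; have [dw fw] := chart_cod_inv Cw.
by exists (chart_inv c w).
Qed.

Lemma near_chart_dom c x : chart_dom c x -> \forall y \near x, chart_dom c y.
Proof. by move=> cx; apply: open_nbhs_nbhs; split => //; exact: open_chart_dom. Qed.

Lemma near_chart_cod c u : chart_cod c u -> \forall w \near u, chart_cod c w.
Proof. by move=> cx; apply: open_nbhs_nbhs; split => //; exact: open_chart_cod. Qed.

Lemma near_chart_inv c x (P : M -> Prop) : chart_dom c x ->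
  (\forall y \near x, P y) -> \forall u \near chart_fun c x, P (chart_inv c u).
Proof.
move=> cx Px; have := continuous_chart_inv (chart_cod_fun cx); apply.
by rewrite chart_funK.
Qed.

Lemma near_chart_fun c x (P : 'rV[R]_n -> Prop) : chart_dom c x ->
  (\forall u \near chart_fun c x, P u) -> \forall y \near x, P (chart_fun c y).
Proof. by move=> cx; exact: continuous_chart_fun. Qed.

Variable X : M -> 'rV[R]_(n + p).
Hypothesis spX : spacelike_immersion X.

Definition in_chart c := X \o chart_inv c.

Lemma smooth_in_chart c : atlas c -> smooth_on (chart_cod c) (in_chart c).
Proof. by move=> ac; have [sX _ _] := spX; exact: sX. Qed.

(** The chain rule to second order. The second derivative of the transition map contributes a
    tangent vector only, which is why normal parts of second derivatives do not depend on the
    chart. *)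
Lemma transition_derive c d x : atlas c -> atlas d -> chart_dom c x -> chart_dom d x ->
  let tau := chart_fun d \o chart_inv c in
  (forall v, dd v (in_chart c) (chart_fun c x) =
     dd (dd v tau (chart_fun c x)) (in_chart d) (chart_fun d x)) /\
  (forall v w, dd v (dd w (in_chart c)) (chart_fun c x) =
     dd (dd v tau (chart_fun c x)) (dd (dd w tau (chart_fun c x)) (in_chart d)) (chart_fun d x)
   + dd (dd v (dd w tau) (chart_fun c x)) (in_chart d) (chart_fun d x)).
Proof.
move=> ac ad cx dx tau; pose u := chart_fun c x.
pose D := chart_fun c @` (chart_dom c `&` chart_dom d).
have oD : open D by apply: open_chart_preimage; exact: open_chart_dom.
have sT : smooth_on D tau := transition_smooth ac ad.
have Du : D u by exists x.
have tauE y : chart_dom c y -> tau (chart_fun c y) = chart_fun d y.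
  by move=> cy; rewrite /tau/= chart_funK.
have sYd := smooth_in_chart ad.
have E1 w : D w -> in_chart c w = (in_chart d \o tau) w.
  by move=> [y [cy dy] <-]; rewrite /= tauE// /in_chart/= !chart_funK.
have DT w : D w -> chart_cod d (tau w).
  by move=> [y [cy dy] <-]; rewrite tauE//; exact: chart_cod_fun.
have key v w : D w -> dd v (in_chart c) w = dd (dd v tau w) (in_chart d) (tau w).
  move=> Dw.
  have -> : dd v (in_chart c) w = dd v (in_chart d \o tau) w.
    rewrite !ddE; apply: near_eq_derive.
    have : \forall z \near w, D z by exact: open_nbhs_nbhs.
    by apply: filterS => z; exact: E1.
  have := is_derive_chain v (smooth_on_differentiable sT Dw)
    (smooth_on_differentiable sYd (DT _ Dw)).
  by rewrite !ddE => -[_].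
split=> [v|v w]; first by rewrite -(tauE _ cx); exact: key.
have near_dd (f g : 'rV[R]_n -> 'rV[R]_(n + p)) a : (forall z, D z -> f z = g z) ->
    dd a f u = dd a g u.
  move=> fg; rewrite !ddE; apply: near_eq_derive.
  have : \forall z \near u, D z by exact: open_nbhs_nbhs.
  by apply: filterS => z; exact: fg.
(* The direction [dd w tau z] varies with [z]; expanding it in the basis turns the expression into a
   sum of products. *)
have -> : dd v (dd w (in_chart c)) u = dd v (fun z => \sum_i (dd w tau z) 0 i *:
    dd (delta_mx 0 i) (in_chart d) (tau z)) u.
  apply: near_dd => z Dz; rewrite key// [LHS]dd_basis//.
  exact: smooth_on_differentiable sYd (DT _ Dz).
have CT := DT _ Du.
have oC : open (chart_cod d) by exact: open_chart_cod.
have sDYd i : smooth_on (chart_cod d) (dd (delta_mx 0 i) (in_chart d)) by exact: smooth_on_dd.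
have h i : is_derive u v (fun z => (dd w tau z) 0 i *: dd (delta_mx 0 i) (in_chart d) (tau z))
   ((dd v (dd w tau) u) 0 i *: dd (delta_mx 0 i) (in_chart d) (tau u) +
    (dd w tau u) 0 i *: dd (dd v tau u) (dd (delta_mx 0 i) (in_chart d)) (tau u)).
  apply: is_derive_scale.
    apply: is_derive_coord; rewrite (ddE v); apply: derivableP; apply: diff_derivable.
    exact: (smooth_on_differentiable (smooth_on_dd w sT) Du).
  have := is_derive_chain v (smooth_on_differentiable sT Du)
    (smooth_on_differentiable (sDYd i) CT).
  by rewrite (ddE v tau) (ddE ('D_v tau u)).
rewrite (dd_val (is_derive_sumf h)).
rewrite big_split/= addrC -(tauE _ cx) -/u; congr (_ + _); last first.
  by rewrite [RHS]dd_basis//; exact: smooth_on_differentiable sYd CT.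
rewrite (dd_comm _ _ oC sYd CT) [RHS]dd_basis; last first.
  exact: (smooth_on_differentiable (smooth_on_dd _ sYd) CT).
by apply: eq_bigr => i _; rewrite (dd_comm _ _ oC sYd CT).
Qed.

Lemma transition_derive_inv c d x : atlas c -> atlas d -> chart_dom c x -> chart_dom d x ->
  forall v, dd (dd v (chart_fun d \o chart_inv c) (chart_fun c x))
    (chart_fun c \o chart_inv d) (chart_fun d x) = v.
Proof.
move=> ac ad cx dx v.
pose D := chart_fun c @` (chart_dom c `&` chart_dom d).
have oD : open D by apply: open_chart_preimage; exact: open_chart_dom.
have Du : D (chart_fun c x) by exists x.
have s1 := transition_smooth ac ad; have s2 := transition_smooth ad ac.
have tE : (chart_fun d \o chart_inv c) (chart_fun c x) = chart_fun d x by rewrite /= chart_funK.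
have D2 : (chart_fun d @` (chart_dom d `&` chart_dom c)) (chart_fun d x) by exists x.
have := @is_derive_chain _ _ _ _ (chart_fun d \o chart_inv c) (chart_fun c \o chart_inv d)
  (chart_fun c x) v (smooth_on_differentiable s1 Du).
rewrite tE => /(_ (smooth_on_differentiable s2 D2)) -[_].
rewrite !ddE => <-.
have -> : 'D_v ((chart_fun c \o chart_inv d) \o (chart_fun d \o chart_inv c)) (chart_fun c x) =
    'D_v id (chart_fun c x).
  apply: near_eq_derive.
  have : \forall z \near chart_fun c x, D z by exact: open_nbhs_nbhs.
  by apply: filterS => z [y [cy dy] <-]; rewrite /= !chart_funK.
by rewrite derive_id.
Qed.

Lemma dXE x v : dX X x v = dd v (in_chart (chart_at x)) (Defs.coord x).
Proof. by rewrite ddE. Qed.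

Lemma coord_cod x : chart_cod (chart_at x) (Defs.coord x).
Proof. by apply: chart_cod_fun; exact: chart_at_dom. Qed.

Lemma in_chart_pos c u v : atlas c -> chart_cod c u -> v != 0 ->
  0 < ip (dd v (in_chart c) u) (dd v (in_chart c) u).
Proof.
move=> ac Cu v0; have [cx xu] := chart_cod_inv Cu; move: xu cx.
set x := chart_inv c u => xu cx.
have ad := chart_at_atlas x; have dx := chart_at_dom x.
have [h _] := transition_derive ac ad cx dx.
rewrite -xu h; set w := dd v _ _; have [_ _ pos] := spX.
have := pos x w; rewrite /induced_metric !dXE; apply.
apply/negP => /eqP w0; have := transition_derive_inv ac ad cx dx v.
by rewrite -/w w0 dd0l => /esym /eqP; rewrite (negbTE v0).
Qed.

Definition jacX x := 'J (in_chart (chart_at x)) (Defs.coord x).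

Lemma dXJ x v : dX X x v = v *m jacX x.
Proof.
rewrite /dX deriveEjacobian//.
exact: smooth_on_differentiable (smooth_in_chart (chart_at_atlas x)) (coord_cod x).
Qed.

Let posJ x (v : 'rV[R]_n) : v != 0 -> 0 < ip (v *m jacX x) (v *m jacX x).
Proof. by move=> v0; have [_ _ /(_ x v v0)] := spX; rewrite /induced_metric !dXJ. Qed.

Lemma normal_nor x z : normal X x z <-> nor (jacX x) z.
Proof. by split=> h v; have := h v; rewrite dXJ. Qed.

Lemma tangent_frameP x : is_tangent_frame X x (tangent_frame X x).
Proof.
rewrite /tangent_frame; case: xgetP => [E _ //|h]; exfalso.
have [E hE] := tframe_exists (posJ x); apply: (h E) => i j.
by rewrite /induced_metric !dXJ; exact: hE.
Qed.

Lemma normal_frameP x : is_normal_frame X x (normal_frame X x).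
Proof.
rewrite /normal_frame; case: xgetP => [N _ //|h]; exfalso.
have [N [h1 h2]] := nframe_exists (posJ x); apply: (h N); split => // a.
exact/normal_nor.
Qed.

Lemma normal_partP x w :
  normal X x (normal_part X x w) /\ exists v, w = dX X x v + normal_part X x w.
Proof.
rewrite /normal_part; case: xgetP => [z _ //|h]; exfalso.
have [v hv] := ortho_decomposition (posJ x) w; apply: (h (w - v *m jacX x)).
by split; [exact/normal_nor|exists v; rewrite dXJ addrC subrK].
Qed.

Lemma ip_normal_frame_sum x z w : normal X x z ->
  ip z w = - \sum_a ip z (row a (normal_frame X x)) * ip w (row a (normal_frame X x)).
Proof.
move=> nz; have [h1 h2] := normal_frameP x.
have tE : tframe (jacX x) (tangent_frame X x).
  by move=> i j; have := tangent_frameP x i j; rewrite /induced_metric !dXJ.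
have nN : nframe (jacX x) (normal_frame X x) by split=> // a; exact/normal_nor.
rewrite (ip_frame_sum _ _ tE nN) big1 ?sub0r// => i _.
by rewrite ipC -dXJ nz mul0r.
Qed.

Lemma normal_ip_eq0 x z : normal X x z -> 0 <= ip z z -> z = 0.
Proof. by move=> /normal_nor; exact: (nor_ip_eq0 (posJ x)). Qed.

Lemma ip_normal_part x w z : normal X x z -> ip (normal_part X x w) z = ip w z.
Proof.
by move=> nz; have [_ [v wE]] := normal_partP x w; rewrite [in RHS]wE ipDl nz add0r.
Qed.

Lemma h_coef_le x a i j : `|h_coef X x a i j| <= norm_A X x.
Proof.
rewrite /norm_A -sqrtr_sqr ler_wsqrtr//.
have le1 m (F : 'I_m -> R) k : (forall l, 0 <= F l) -> F k <= \sum_l F l.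
  by move=> F0; rewrite (bigD1 k)//= lerDl sumr_ge0.
have h0 k l b : 0 <= h_coef X x b k l ^+ 2 by exact: sqr_ge0.
apply: le_trans (le1 _ (fun b => h_coef X x b i j ^+ 2) a _) _ => //.
apply: le_trans (le1 _ (fun l => \sum_b h_coef X x b i l ^+ 2) j _) _ => [l|].
  exact: sumr_ge0.
apply: (le1 _ (fun k => \sum_l \sum_b h_coef X x b k l ^+ 2)) => k.
by apply: sumr_ge0 => l _; exact: sumr_ge0.
Qed.

Definition d2X x v w := dd v (dd w (in_chart (chart_at x))) (Defs.coord x).

Lemma h_coefE x a i j : h_coef X x a i j =
  - ip (d2X x (row i (tangent_frame X x)) (row j (tangent_frame X x))) (row a (normal_frame X x)).
Proof.
rewrite /h_coef /second_fundamental_form ip_normal_part; first by rewrite /d2X !ddE.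
by have [] := normal_frameP x.
Qed.

Hypothesis shX : self_shrinker X.

(** Both sides of the self-shrinker equation are paired with [e_b], whose square -1 cancels the sign
    of the equation. *)
Lemma shrinker_position_normal x b :
  ip (X x) (row b (normal_frame X x)) = 2 * \sum_k h_coef X x b k k.
Proof.
have [nN oN] := normal_frameP x.
have := congr1 (fun w => ip w (row b (normal_frame X x))) (shX x).
rewrite /mean_curvature ipZl (ip_normal_part _ (nN b)) ip_suml (bigD1 b)//=.
rewrite [X in _ + X]big1 => [|a ab]; last by rewrite ipZl oN (negbTE ab) oppr0 mulr0.
rewrite ipZl oN eqxx.
have fin (y z : R) : z * -1%:R + 0 = - 2^-1 * y -> y = 2 * z by lra.
exact: fin.
Qed.

Lemma shrinker_tangent x : exists v,
  \sum_k d2X x (row k (tangent_frame X x)) (row k (tangent_frame X x)) + 2^-1 *: X x = dX X x v.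
Proof.
set w := _ + _; have [nz [v wE]] := normal_partP x w.
suff z0 : normal_part X x w = 0 by exists v; rewrite wE z0 addr0.
apply: (normal_ip_eq0 nz); rewrite (ip_normal_frame_sum _ nz) big1 ?oppr0// => b _.
rewrite (ip_normal_part w); last by have [] := normal_frameP x.
suff -> : ip w (row b (normal_frame X x)) = 0 by rewrite mul0r.
rewrite /w ipDl ipZl shrinker_position_normal ip_suml.
under eq_bigr => k _ do rewrite -[ip _ _]opprK -h_coefE.
by rewrite sumrN; lra.
Qed.

Lemma defect_le_normal x w v : - ip (w - dX X x v) (w - dX X x v) <=
  - ip (normal_part X x w) (normal_part X x w).
Proof.
have [nz [u wE]] := normal_partP x w; set z := normal_part _ _ _ in nz wE *.
have -> : w - dX X x v = dX X x (u - v) + z by rewrite wE !dXJ mulmxBl addrAC.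
rewrite ipDl !ipDr nz (ipC z) nz addr0 add0r opprD gerDr oppr_le0.
have [->|uv] := eqVneq (u - v) 0; first by rewrite dXJ mul0mx ip0l.
by rewrite dXJ ltW// posJ.
Qed.

(** Each of the [p] normal components of [X] is twice a trace of [n] coefficients bounded by
    [|A|]. *)
Lemma position_defect_le x v :
  - ip (X x - dX X x v) (X x - dX X x v) <= p%:R * (2 * n%:R * norm_A X x) ^+ 2.
Proof.
have [nz _] := normal_partP x (X x).
apply: le_trans (defect_le_normal _ _ _) _.
rewrite (ip_normal_frame_sum _ nz) opprK mulr_natl -[p in _ *+ p]card_ord -sumr_const.
apply: ler_sum => a _; rewrite -expr2 -ler_sqrt ?sqr_ge0// !sqrtr_sqr.
rewrite ip_normal_part; last by have [] := normal_frameP x.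
rewrite shrinker_position_normal [leRHS]ger0_norm ?mulr_ge0 ?sqrtr_ge0// normrM.
rewrite -mulrA ger0_norm// ler_pM2l// (le_trans (ler_norm_sum _ _ _))//.
rewrite mulr_natl -[n in _ *+ n]card_ord -sumr_const; apply: ler_sum => k _.
exact: h_coef_le.
Qed.

(** In an orthonormal frame each product [|a i * a j|] of components of [v] is at most the squared
    length of [v]; there are [n * n] of them in each of the [p] normal components. *)
Lemma second_form_defect_le x v th :
  - ip (d2X x v v - dX X x th) (d2X x v v - dX X x th) <=
  p%:R * (n%:R * n%:R * norm_A X x) ^+ 2 * induced_metric X x v v ^+ 2.
Proof.
set S := d2X x v v; have [nz [u wE]] := normal_partP x S.
apply: le_trans (defect_le_normal _ _ _) _.
rewrite (ip_normal_frame_sum _ nz) opprK mulr_natl -[p in _ *+ p]card_ord -sumr_const mulr_suml.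
apply: ler_sum => b _; rewrite -expr2 -exprMn -ler_sqrt ?sqr_ge0// !sqrtr_sqr.
have [nN _] := normal_frameP x; rewrite (ip_normal_part _ (nN b)).
set E := tangent_frame X x; have tE := tangent_frameP x.
have ac := chart_at_atlas x; have Cx := coord_cod x.
have sY := smooth_in_chart ac.
have oC : open (chart_cod (chart_at x)) by exact: open_chart_cod.
have oE : orthonormal_at (in_chart (chart_at x)) (Defs.coord x) E.
  by move=> i j; rewrite -!dXE; exact: tE.
pose Y := in_chart (chart_at x); pose y := Defs.coord x.
pose a j := ip (dd v Y y) (dd (row j E) Y y).
have vE : v = \sum_j a j *: row j E := orthonormal_coord sY v Cx oE.
have gE : induced_metric X x v v = \sum_j a j ^+ 2.
  rewrite /induced_metric !dXE -/Y -/y [X in ip X _](_ : _ = \sum_j a j *: dd (row j E) Y y).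
    by rewrite ip_suml; apply: eq_bigr => j _; rewrite ipZl ipC.
  have dY : differentiable Y y := smooth_on_differentiable sY Cx.
  by rewrite {1}vE dd_suml//; apply: eq_bigr => j _; rewrite ddZl.
have g0 : 0 <= induced_metric X x v v by rewrite gE sumr_ge0// => j _; exact: sqr_ge0.
have ag i : a i ^+ 2 <= induced_metric X x v v.
  by rewrite gE (bigD1 i)//= lerDl sumr_ge0// => j _; exact: sqr_ge0.
have SE : S = \sum_i \sum_j (a i * a j) *: d2X x (row i E) (row j E).
  by rewrite /S /d2X {1 2}vE; exact: (dd2_bilinear oC sY).
rewrite SE ip_suml (le_trans (ler_norm_sum _ _ _))// [leRHS]ger0_norm; last first.
  by rewrite !mulr_ge0// sqrtr_ge0.
rewrite -!mulrA mulr_natl -[n in _ *+ n]card_ord -sumr_const; apply: ler_sum => i _.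
rewrite ip_suml (le_trans (ler_norm_sum _ _ _))//.
rewrite mulr_natl -[n in _ *+ n]card_ord -sumr_const; apply: ler_sum => j _.
rewrite ipZl normrM mulrC ler_pM//.
  by rewrite -normrN -h_coefE h_coef_le.
rewrite normrM; have := ag i; have := ag j.
rewrite -(real_normK (num_real (a i))) -(real_normK (num_real (a j))).
move: (`|a i|) (`|a j|) => s t; move: (induced_metric _ _ _ _) => g.
by have := sqr_ge0 (s - t); rewrite sqrrB; nra.
Qed.

End Charts.

(** * Riemannian distance *)

Section Affine.
Context {R : realType} {V W : normedModType R}.

Lemma iter_derive_line (f : V -> W) (u v : V) (vs : seq R) :
  iter_derive vs (fun t : R => f (u + t *: v)) =
  (fun t : R => iter_derive [seq r *: v | r <- vs] f (u + t *: v)).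
Proof.
elim: vs => // r vs IH; rewrite [LHS]/= -/(iter_derive vs _) IH.
apply/funext => t; rewrite /=.
apply: (congr1 (fun k : R -> W => lim (k h @[h --> (0 : R)^']))).
apply/funext => h; move: (iter_derive _ f) => G; rewrite /=.
have -> // : u + (h *: r + t) *: v = h *: (r *: v) + (u + t *: v).
by rewrite scalerDl [h *: r]/GRing.scale/= scalerA addrCA.
Qed.

Lemma smooth_on_line (U : set V) (f : V -> W) (u v : V) : smooth_on U f ->
  smooth_on [set t : R | U (u + t *: v)] (fun t : R => f (u + t *: v)).
Proof.
move=> sf vs t Ut; rewrite iter_derive_line; set g := iter_derive _ _.
have dg : differentiable g (u + t *: v) by exact: sf.
by apply: (@differentiable_comp _ _ _ _ (fun t : R => u + t *: v) g).
Qed.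

End Affine.

Section Primitive.
Context {R : realType}.

(* Arc lengths are handled through a primitive of the speed, so that reversing and
   cutting curves needs no change of variables in integrals. *)
Definition primitive01 (f F : R -> R) := forall t : R, 0 <= t <= 1 -> is_derive t (1 : R) F (f t).

Lemma primitive01_continuous f F (t : R) : primitive01 f F -> 0 <= t <= 1 ->
  {for t, continuous F}.
Proof.
by move=> PF /PF[dF _]; apply: differentiable_continuous; exact/derivable1_diffP.
Qed.

Lemma within01_continuous (f : R -> R) :
  (forall t : R, 0 <= t <= 1 -> {for t, continuous f}) -> {within `[0, 1], continuous f}.
Proof.
move=> cf; apply/(continuous_within_itvP _ (@ltr01 R)); split.
- by move=> t; rewrite in_itv/= => /andP[t0 t1]; apply: cf; rewrite !ltW.
- by apply: cvg_at_right_filter; apply: cf; rewrite lexx ler01.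
- by apply: cvg_at_left_filter; apply: cf; rewrite lexx ler01.
Qed.

(* [k] is the projection of the line onto [0, 1], which extends [f] to a
   continuous function. *)
Lemma primitive01_exists (f : R -> R) :
  (forall t : R, 0 <= t <= 1 -> {for t, continuous f}) -> exists F, primitive01 f F.
Proof.
move=> cf; pose k (t : R) := (`|t| - `|t - 1| + 1) / 2.
have k01 t : 0 <= k t <= 1.
  rewrite /k; have [t0|t0] := leP 0 t; have [t1|t1] := leP 0 (t - 1);
  rewrite ?(ger0_norm t0) ?(ltr0_norm t0) ?(ger0_norm t1) ?(ltr0_norm t1); lra.
have kE t : 0 <= t <= 1 -> k t = t.
  move=> /andP[t0 t1]; rewrite /k ger0_norm// ler0_norm; first by field.
  by rewrite subr_le0.
have ck : continuous k.
  move=> t; apply: cvgM; last exact: cvg_cst.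
  apply: cvgD; last exact: cvg_cst.
  apply: cvgB; apply: cvg_norm => //.
  by apply: cvgB => //; exact: cvg_cst.
have cfk : continuous (f \o k).
  by move=> t; apply: continuous_comp; [exact: ck|exact/cf/k01].
have intf : lebesgue_measure.-integrable `[(- 1 : R), 2] (EFin \o (f \o k)).
  apply: continuous_compact_integrable; first exact: segment_compact.
  exact: continuous_subspaceT.
exists (fun x => \int[lebesgue_measure]_(t in `[-1, x]) (f \o k) t)%R => t t01.
have [t0 t1] := andP t01.
have t2 : t < 2 by lra.
have tN1 : -1 < t by lra.
have [dF FE] := continuous_FTC1_closed t2 intf tN1 (cfk t).
by rewrite -{2}(kE t t01); exact: (DeriveDef dF (etrans (esym (derive1E _ _)) FE)).
Qed.

Lemma primitive01_integral (f F : R -> R) :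
  (forall t : R, 0 <= t <= 1 -> {for t, continuous f}) -> primitive01 f F ->
  (\int[lebesgue_measure]_(t in `[0, 1]) f t)%R = F 1 - F 0.
Proof.
move=> cf PF; have wf := within01_continuous cf.
have in01 (t : R) : t \in `]0, 1[ -> 0 <= t <= 1.
  by rewrite in_itv/= => /andP[t0 t1]; rewrite !ltW.
rewrite /Rintegral (@continuous_FTC2 _ f F)//.
  split; first by move=> t /in01/PF[].
    by apply: cvg_at_right_filter; apply: (primitive01_continuous PF); rewrite lexx ler01.
  by apply: cvg_at_left_filter; apply: (primitive01_continuous PF); rewrite lexx ler01.
by move=> t /in01/PF[_ <-]; rewrite derive1E.
Qed.

Lemma primitive01_le (f F g G : R -> R) : primitive01 f F -> primitive01 g G ->
  (forall t, 0 <= t <= 1 -> f t <= g t) -> F 1 - F 0 <= G 1 - G 0.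
Proof.
move=> PF PG fg.
have h (t : R) : 0 <= t <= 1 -> is_derive t (1 : R) (F \- G) (f t - g t).
  by move=> ht; apply: is_deriveB; [exact: PF|exact: PG].
have in01 (t : R) : t \in `]0, 1[ -> 0 <= t <= 1.
  by rewrite in_itv/= => /andP[t0 t1]; rewrite !ltW.
have : (F \- G) 1 <= (F \- G) 0.
  apply: (@ler0_derive1_le_cc _ (F \- G) 0 1) => //; rewrite ?in_itv/= ?lexx ?ler01//.
  - by move=> t /in01/h [].
  - by move=> t /in01 ht; have [_] := h _ ht; rewrite derive1E => ->; rewrite subr_le0 fg.
  - by apply: within01_continuous => t; exact: (primitive01_continuous h).
by rewrite /=; lra.
Qed.

Lemma primitive01_linear (c : R) : primitive01 (fun=> c) (fun t => c * t).
Proof.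
move=> t _; have := is_deriveZ c (is_derive_id t (1 : R)).
by move=> /is_derive_eq; apply; rewrite /GRing.scale/= mulr1.
Qed.

End Primitive.

Lemma cvg_dd_comp {R : realType} {n : nat} {W : normedModType R} {T : Type} {F : set_system T}
    {FF : Filter F} (U : set 'rV[R]_n) (f : 'rV[R]_n -> W) (a b : T -> 'rV[R]_n) v u :
  open U -> smooth_on U f -> U u -> a @ F --> v -> b @ F --> u ->
  dd (a s) f (b s) @[s --> F] --> dd v f u.
Proof.
move=> oU sf Uu av bu.
move=> P /(@cvg_dd_pair R n W U f v u oU sf Uu) [[A B] /= [nA nB] AB].
apply: (@filterS2 _ F FF _ _ _ _ (av _ nA) (bu _ nB)) => s As Bs.
exact: (AB (a s, b s)).
Qed.

Section Curves.
Context {R : realType} {n p : nat} (M : smooth_manifold R n).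
Variable X : M -> 'rV[R]_(n + p).
Hypothesis spX : spacelike_immersion X.
Implicit Types (g : R -> M) (c d : chart R n M) (x y z : M).

Local Opaque ip.

(** [smooth_curve] speaks of the preferred chart at [g t] only; the transition map carries the
    first-order information to any chart of the atlas. *)
Lemma curve_in_chart g (t : R) c : smooth_curve g -> 0 <= t <= 1 -> atlas c ->
  chart_dom c (g t) ->
  [/\ \forall s \near t, chart_dom c (g s) /\ differentiable (chart_fun c \o g) s,
      {for t, continuous (dd (1 : R) (chart_fun c \o g))} &
      \forall s \near t, differentiable (X \o g) s /\ dd (1 : R) (X \o g) s =
        dd (dd (1 : R) (chart_fun c \o g) s) (in_chart X c) (chart_fun c (g s))].
Proof.
move=> sg t01 ac ct.
have [cg [U [oU Ut] sU]] := sg _ t01.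
pose d := chart_at (g t); have ad := chart_at_atlas (g t); have dt := chart_at_dom (g t).
pose psi := chart_fun d \o g; pose tau := chart_fun c \o chart_inv d.
pose D := chart_fun d @` (chart_dom d `&` chart_dom c).
have oD : open D by apply: open_chart_preimage; exact: open_chart_dom.
have sT : smooth_on D tau by exact: transition_smooth.
have nO : \forall s \near t, U s /\ chart_dom d (g s) /\ chart_dom c (g s).
  have nU : \forall s \near t, U s by exact: open_nbhs_nbhs.
  have nd : \forall s \near t, chart_dom d (g s) by apply: cg; exact: near_chart_dom.
  have nc : \forall s \near t, chart_dom c (g s) by apply: cg; exact: near_chart_dom.
  by apply: filterS3 nU nd nc => s.
have nD : \forall s \near t, D (psi s) by apply: filterS nO => s [_ [ds cs]]; exists (g s).
have phiE s : chart_dom d (g s) -> (chart_fun c \o g) s = (tau \o psi) s.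
  by move=> ds; rewrite /tau /psi /= chart_funK.
have key : \forall s \near t, [/\ U s, chart_dom c (g s), D (psi s) &
    {near s, (chart_fun c \o g) =1 (tau \o psi)}].
  have := nbhs_interior nO; apply: filterS => s hs; have [Us [ds cs]] := nbhs_singleton hs.
  split => //; first by exists (g s).
  by move: hs; apply: filterS => r [_ [dr _]]; exact: phiE.
have dphi : \forall s \near t, [/\ chart_dom c (g s), differentiable (chart_fun c \o g) s &
    dd (1 : R) (chart_fun c \o g) s = dd (dd (1 : R) psi s) tau (psi s)].
  apply: filterS key => s [Us cs Ds e].
  have dpsi : differentiable psi s := smooth_on_differentiable sU Us.
  have dtau : differentiable tau (psi s) := smooth_on_differentiable sT Ds.
  split => //.
    apply: (near_eq_differentiable _ (differentiable_comp dpsi dtau)).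
    by apply: filterS e => r /= ->.
  have [_ E] := is_derive_chain (1 : R) dpsi dtau.
  by rewrite !ddE -E; exact: near_eq_derive.
have cphi : {for t, continuous (dd (1 : R) (chart_fun c \o g))}.
  have cpsi : {for t, continuous psi} := smooth_on_continuous sU Ut.
  have c1 : {for t, continuous (dd (1 : R) psi)} := smooth_on_continuous (smooth_on_dd _ sU) Ut.
  have [_ _ E] := nbhs_singleton dphi.
  have h : dd (dd (1 : R) psi s) tau (psi s) @[s --> t] --> dd (dd (1 : R) psi t) tau (psi t).
    exact: (cvg_dd_comp oD sT (nbhs_singleton nD) c1 cpsi).
  rewrite -E in h; apply: cvg_near_eq_to h.
  by apply: filterS dphi => s [].
split => //; first by apply: filterS dphi => s [].
have := nbhs_interior dphi; apply: filterS => s hs; have [cs ds _] := nbhs_singleton hs.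
have dY : differentiable (in_chart X c) ((chart_fun c \o g) s).
  by apply: smooth_on_differentiable (smooth_in_chart spX ac) _; exact: chart_cod_fun.
have e : {near s, (in_chart X c \o (chart_fun c \o g)) =1 (X \o g)}.
  by move: hs; apply: filterS => r [cr _ _]; rewrite /in_chart /= chart_funK.
split.
  exact: (near_eq_differentiable e (differentiable_comp ds dY)).
have [_ E] := is_derive_chain (1 : R) ds dY.
rewrite !ddE -E; apply: near_eq_derive.
by apply: filterS e => r /= ->.
Qed.

Definition speed g (t : R) := Num.sqrt (ip (dd (1 : R) (X \o g) t) (dd (1 : R) (X \o g) t)).

Lemma speed_continuous g (t : R) : smooth_curve g -> 0 <= t <= 1 ->
  {for t, continuous (speed g)}.
Proof.
move=> sg t01; have ac := chart_at_atlas (g t); have ct := chart_at_dom (g t).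
have [n1 c1 n2] := curve_in_chart sg t01 ac ct.
have cD : {for t, continuous (dd (1 : R) (X \o g))}.
  have [_ E] := nbhs_singleton n2; have [cs ds] := nbhs_singleton n1.
  have oC : open (chart_cod (chart_at (g t))) by exact: open_chart_cod.
  have h : dd (dd (1 : R) (chart_fun (chart_at (g t)) \o g) s) (in_chart X (chart_at (g t)))
      ((chart_fun (chart_at (g t)) \o g) s) @[s --> t] -->
    dd (dd (1 : R) (chart_fun (chart_at (g t)) \o g) t) (in_chart X (chart_at (g t)))
      (chart_fun (chart_at (g t)) (g t)).
    exact: (cvg_dd_comp oC (smooth_in_chart spX ac) (chart_cod_fun ct) c1
      (differentiable_continuous ds)).
  rewrite -E in h.
  by apply: cvg_near_eq_to h; apply: filterS n2 => s [].
have ci : ip (dd (1 : R) (X \o g) s) (dd (1 : R) (X \o g) s) @[s --> t] -->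
  ip (dd (1 : R) (X \o g) t) (dd (1 : R) (X \o g) t) by exact: (cvg_ip cD cD).
have h : speed g s @[s --> t] --> speed g t.
  by apply: (cvg_comp _ Num.sqrt ci); exact: sqrt_continuous.
exact: h.
Qed.

Lemma arc_lengthE g : arc_length X g = (\int[lebesgue_measure]_(t in `[0%R, 1%R]) speed g t)%R.
Proof. by rewrite /arc_length /speed ddE. Qed.

Lemma arc_length_ge0 g : 0 <= arc_length X g.
Proof. by rewrite arc_lengthE; apply: Rintegral_ge0 => t _; exact: sqrtr_ge0. Qed.

Lemma arc_length_primitive g F : smooth_curve g -> primitive01 (speed g) F ->
  arc_length X g = F 1 - F 0.
Proof.
move=> sg; rewrite arc_lengthE; apply: primitive01_integral => t.
exact: speed_continuous.
Qed.

Lemma speed_primitive g : smooth_curve g -> exists F, primitive01 (speed g) F.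
Proof. by move=> sg; apply: primitive01_exists => t; exact: speed_continuous. Qed.

Lemma lipschitz_arc_length (f df : R -> R) g K : smooth_curve g ->
  (forall t : R, 0 <= t <= 1 -> is_derive t (1 : R) f (df t)) ->
  (forall t : R, 0 <= t <= 1 -> df t <= K * speed g t) ->
  f 1 - f 0 <= K * arc_length X g.
Proof.
move=> sg df1 dfK; have [F PF] := speed_primitive sg.
rewrite (arc_length_primitive sg PF).
have PK : primitive01 (fun t => K * speed g t) (fun t => K * F t).
  by move=> t /PF dF; have := is_deriveZ K dF; move=> /is_derive_eq; apply.
rewrite mulrBr; exact: (primitive01_le df1 PK dfK).
Qed.

Lemma arc_length_le g C : smooth_curve g ->
  (forall t, 0 <= t <= 1 -> speed g t <= C) -> arc_length X g <= C.
Proof.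
move=> sg h; have [F PF] := speed_primitive sg.
rewrite (arc_length_primitive sg PF).
have := primitive01_le PF (primitive01_linear C) h.
by rewrite mulr1 mulr0 subr0.
Qed.

Lemma affine_unit_interval (a b t : R) : 0 <= a <= 1 -> 0 <= b <= 1 -> 0 <= t <= 1 ->
  0 <= a + t *: (b - a) <= 1.
Proof. by rewrite /GRing.scale/= => /andP[? ?] /andP[? ?] /andP[? ?]; nra. Qed.

Lemma dd_line {V W : normedModType R} (f : V -> W) (u v : V) (t : R) :
  dd (1 : R) (fun s : R => f (u + s *: v)) t = dd v f (u + t *: v).
Proof.
rewrite !ddE; have := iter_derive_line f u v [:: 1].
by rewrite /= scale1r => /(congr1 (@^~ t)).
Qed.

Lemma smooth_curve_affine g (a b : R) : smooth_curve g -> 0 <= a <= 1 -> 0 <= b <= 1 ->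
  smooth_curve (fun t : R => g (a + t *: (b - a))).
Proof.
move=> sg a01 b01 t t01; have [cg [U [oU Ut] sU]] := sg _ (affine_unit_interval a01 b01 t01).
have cl : continuous (fun t : R => a + t *: (b - a)).
  move=> s; apply: cvgD; [exact: cvg_cst|apply: cvgZr_tmp; exact: cvg_id].
split; first exact: (continuous_comp (cl t) cg).
exists [set s | U (a + s *: (b - a))]; last first.
  exact: (@smooth_on_line R _ _ U (chart_fun (chart_at (g (a + t *: (b - a)))) \o g) a (b - a) sU).
by split => //; apply: open_comp => // s _; exact: cl.
Qed.

(** Treats restriction ([a < b]) and reversal ([b < a]) at once: the sign turns the factor [b - a]
    of the chain rule into [|b - a|]. *)
Lemma arc_length_affine g F (a b : R) : smooth_curve g -> primitive01 (speed g) F ->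
  0 <= a <= 1 -> 0 <= b <= 1 ->
  arc_length X (fun t : R => g (a + t *: (b - a))) = Num.sg (b - a) * (F b - F a).
Proof.
move=> sg PF a01 b01; have sh := smooth_curve_affine sg a01 b01.
pose G (t : R) := Num.sg (b - a) * F (a + t *: (b - a)).
suff PG : primitive01 (speed (fun t : R => g (a + t *: (b - a)))) G.
  rewrite (arc_length_primitive sh PG) /G.
  by rewrite scale1r scale0r addr0 [a + _]addrC subrK mulrBr.
move=> t t01.
have at01 := affine_unit_interval a01 b01 t01.
have dF : differentiable F (a + t *: (b - a)) by have [+ _] := PF _ at01; move=> /derivable1_diffP.
have := is_deriveZ (Num.sg (b - a)) (is_derive_dd dF).
move=> /is_derive_eq; apply.
have -> : dd (b - a) F (a + t *: (b - a)) = (b - a) * speed g (a + t *: (b - a)).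
  rewrite -(dd_val (PF _ at01)) -[X in dd X F _]mulr1.
  exact: (ddZl (b - a) (1 : R) dF).
rewrite [LHS]mulrA -normrEsg /speed.
have -> : X \o (fun t : R => g (a + t *: (b - a))) = (fun s : R => (X \o g) (a + s *: (b - a))).
  by [].
have [_ _ n2] := curve_in_chart sg at01 (chart_at_atlas _) (chart_at_dom _).
have [dXg _] := nbhs_singleton n2.
have E : dd (b - a) (X \o g) (a + t *: (b - a)) = (b - a) *: dd (1 : R) (X \o g) (a + t *: (b - a)).
  by rewrite -(ddZl (b - a) (1 : R) dXg) [_ *: 1]mulr1.
rewrite dd_line E ipZl ipZr mulrA -expr2 sqrtrM ?sqr_ge0//.
by rewrite sqrtr_sqr.
Qed.

Lemma path_length_ge0 x y l : path_length X x y l -> 0 <= l.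
Proof. by elim=> // {}l g _ l0 _; rewrite addr_ge0// arc_length_ge0. Qed.

Lemma path_length_cat x y z l m : path_length X x y l -> path_length X y z m ->
  path_length X x z (l + m).
Proof.
move=> xy; elim; first by rewrite addr0.
by move=> {}m g _ IH sg; rewrite addrA; exact: path_length_cons.
Qed.

Lemma path_length_curve g : smooth_curve g -> path_length X (g 0) (g 1) (arc_length X g).
Proof. by move=> sg; rewrite -[arc_length _ _]add0r; exact: (path_length_cons (path_length_nil _ _)). Qed.

Lemma path_length_subcurve g F (a b : R) : smooth_curve g -> primitive01 (speed g) F ->
  0 <= a <= 1 -> 0 <= b <= 1 ->
  path_length X (g a) (g b) (Num.sg (b - a) * (F b - F a)).
Proof.
move=> sg PF a01 b01; rewrite -(arc_length_affine sg PF a01 b01).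
have := path_length_curve (smooth_curve_affine sg a01 b01).
by rewrite scale0r addr0 scale1r addrC subrK.
Qed.

Lemma path_length_sym x y l : path_length X x y l -> path_length X y x l.
Proof.
elim; first exact: path_length_nil.
move=> {}l g _ IH sg; have [F PF] := speed_primitive sg.
have := @path_length_subcurve g F 1 0 sg PF.
rewrite lexx ler01 sub0r sgrN sgr1 mulN1r opprB -(arc_length_primitive sg PF).
by rewrite lexx => /(_ erefl erefl) h; rewrite addrC; exact: path_length_cat h IH.
Qed.

Local Notation d := (riemannian_dist X).

Lemma dist_le x y l : path_length X x y l -> d x y <= l.
Proof.
by move=> xy; apply: ge_inf => //; exists 0 => m; exact: path_length_ge0.
Qed.

Lemma distxx x : d x x = 0.
Proof.
apply/eqP; rewrite eq_le dist_le/=; last exact: path_length_nil.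
by apply: lb_le_inf; [exists 0; exact: path_length_nil|move=> l; exact: path_length_ge0].
Qed.

Lemma dist_sym x y : d x y = d y x.
Proof.
by rewrite /riemannian_dist; congr inf; apply/seteqP; split => l; exact: path_length_sym.
Qed.

Lemma chart_segment c (u v : 'rV[R]_n) : atlas c ->
  (forall t : R, 0 <= t <= 1 -> chart_cod c (u + t *: v)) ->
  smooth_curve (fun t : R => chart_inv c (u + t *: v)).
Proof.
move=> ac Cl t t01; have Ct := Cl _ t01; have [cx xE] := chart_cod_inv Ct.
set x := chart_inv c _ in cx xE *.
have cl : continuous (fun t : R => u + t *: v).
  by move=> s; apply: cvgD; [exact: cvg_cst|apply: cvgZr_tmp; exact: cvg_id].
split; first exact: (continuous_comp (cl t) (continuous_chart_inv Ct)).
pose D := chart_fun c @` (chart_dom c `&` chart_dom (chart_at x)).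
exists [set s | D (u + s *: v)].
  split; last by exists x => //; split => //; exact: chart_at_dom.
  apply: open_comp => [s _|]; first exact: cl.
  by apply: open_chart_preimage; exact: open_chart_dom.
have sT := transition_smooth ac (chart_at_atlas x).
exact: (@smooth_on_line R _ _ D (chart_fun (chart_at x) \o chart_inv c) u v sT).
Qed.

Lemma chart_segment_speed c (u v : 'rV[R]_n) (t : R) :
  speed (fun t : R => chart_inv c (u + t *: v)) t =
  Num.sqrt (ip (dd v (in_chart X c) (u + t *: v)) (dd v (in_chart X c) (u + t *: v))).
Proof.
rewrite /speed.
have -> : X \o (fun t : R => chart_inv c (u + t *: v)) = (fun t : R => in_chart X c (u + t *: v)).
  by [].
by rewrite dd_line.
Qed.

Lemma metric_bounded (U : set 'rV[R]_n) (Y : 'rV[R]_n -> 'rV[R]_(n + p)) u0 :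
  open U -> smooth_on U Y -> U u0 -> exists2 B : R, 0 < B & \forall u \near u0,
    U u /\ forall v, ip (dd v Y u) (dd v Y u) <= B ^+ 2 * `|v| ^+ 2.
Proof.
move=> oU sY Uu0; pose e (i : 'I_n) : 'rV[R]_n := delta_mx 0 i.
pose G i j u := ip (dd (e i) Y u) (dd (e j) Y u).
pose K := \sum_i \sum_j (`|G i j u0| + 1).
have K0 : 0 <= K by apply: sumr_ge0 => i _; apply: sumr_ge0 => j _; rewrite addr_ge0.
exists (Num.sqrt (K + 1)); first by rewrite sqrtr_gt0 ltr_wpDl.
have nG : \forall u \near u0, forall i j, `|G i j u| <= `|G i j u0| + 1.
  apply: (near_forall2 (F := nbhs u0)) => i j.
  have cD k : {for u0, continuous (dd (e k) Y)} := smooth_on_continuous (smooth_on_dd _ sY) Uu0.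
  have cG : G i j u @[u --> u0] --> G i j u0 by exact: (cvg_ip (cD i) (cD j)).
  have cN : `|G i j u| @[u --> u0] --> `|G i j u0| by exact: (cvg_norm cG).
  by apply: (cvgr_le _ cN); rewrite ltrDl.
have nU : \forall u \near u0, U u by exact: open_nbhs_nbhs.
apply: filterS2 nU nG => u Uu Gu; split=> // v.
rewrite sqr_sqrtr ?addr_ge0// (dd_basis _ (smooth_on_differentiable sY Uu)) ip_suml.
apply: (@le_trans _ _ (K * `|v| ^+ 2)); last by rewrite ler_wpM2r ?sqr_ge0// lerDl.
rewrite /K mulr_suml; apply: ler_sum => i _.
rewrite ip_sumr mulr_suml; apply: ler_sum => j _.
rewrite ipZl ipZr mulrA; apply: le_trans (ler_norm _) _.
have vv : `|v 0 i * v 0 j| <= `|v| ^+ 2.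
  by rewrite normrM expr2; apply: ler_pM => //; exact: coord_le_norm.
by rewrite normrM mulrC; apply: ler_pM => //; exact: Gu.
Qed.

Lemma chart_segment_path c x : atlas c -> chart_dom c x -> exists r B : R, [/\ 0 < r, 0 < B &
  forall u, `|u - chart_fun c x| < r -> chart_cod c u /\
    exists2 l, path_length X x (chart_inv c u) l & l <= B * `|u - chart_fun c x|].
Proof.
move=> ac cx; set u0 := chart_fun c x; have Cx := chart_cod_fun cx.
have oC : open (chart_cod c) by exact: open_chart_cod.
have [B B0 nB] := metric_bounded oC (smooth_in_chart spX ac) Cx.
have [r /= r0 hr] := (nbhs_ballP u0 _).1 nB.
exists r, B; split=> // u ur.
have seg (t : R) : 0 <= t <= 1 -> ball u0 r (u0 + t *: (u - u0)).
  move=> /andP[t0 t1]; rewrite -ball_normE /ball_/= opprD addrA subrr sub0r normrN normrZ.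
  by rewrite ger0_norm// (le_lt_trans _ ur)// ler_piMl.
have Cs (t : R) : 0 <= t <= 1 -> chart_cod c (u0 + t *: (u - u0)) by move=> /seg/hr[].
have u1 : u0 + 1 *: (u - u0) = u by rewrite scale1r addrC subrK.
split; first by rewrite -u1; apply: Cs; rewrite ler01 lexx.
have sg := chart_segment ac Cs.
exists (arc_length X (fun t : R => chart_inv c (u0 + t *: (u - u0)))).
  by have := path_length_curve sg; rewrite u1 scale0r addr0 /u0 chart_funK.
apply: arc_length_le => // t t01; rewrite chart_segment_speed.
have [_ /(_ (u - u0)) h] := hr _ (seg _ t01).
have Bw : 0 <= B * `|u - u0| by rewrite mulr_ge0// ltW.
by rewrite -(ger0_norm Bw) -sqrtr_sqr ler_wsqrtr// exprMn.
Qed.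

Lemma path_near x (e : R) : 0 < e ->
  \forall y \near x, exists2 l, path_length X x y l & l < e.
Proof.
move=> e0; have cx := chart_at_dom x.
have [r [B [r0 B0 h]]] := chart_segment_path (chart_at_atlas x) cx.
have e' : 0 < Num.min r (e / B) by rewrite lt_min r0 divr_gt0.
have : \forall u \near chart_fun (chart_at x) x,
    `|u - chart_fun (chart_at x) x| < Num.min r (e / B).
  apply/nbhs_ballP; exists (Num.min r (e / B)) => // u.
  by rewrite -ball_normE /ball_/= distrC.
move=> /(near_chart_fun cx); apply: filterS2 (near_chart_dom cx) => y cy.
rewrite lt_min => /andP[yr ye]; have [_ [l pl lB]] := h _ yr.
rewrite chart_funK// in pl; exists l => //; rewrite (le_lt_trans lB)//.
by rewrite mulrC -ltr_pdivlMr.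
Qed.

Lemma connected_locally_constant (P : M -> Prop) x : connected [set: M] ->
  (forall y, \forall z \near y, P z <-> P y) -> P x -> forall y, P y.
Proof.
move=> cM lP Px y.
suff : [set z | P z] = setT by move=> /(congr1 (@^~ y)) /= ->.
apply: cM; first by exists x.
- exists [set z | P z]; last by rewrite setTI.
  by rewrite openE => z /= Pz; apply: filterS (lP z) => w [_]; exact.
- exists [set z | P z]; last by rewrite setTI.
  rewrite -[[set z | P z]]setCK; apply: open_closedC; rewrite openE => z /= Pz.
  by apply: filterS (lP z) => w [h _] /h.
Qed.

Hypothesis cM : connected [set: M].

Lemma path_exists x y : exists l, path_length X x y l.
Proof.
move: y; apply: (@connected_locally_constant (fun y => exists l, path_length X x y l) x) => //.
  move=> y; apply: filterS (path_near y ltr01) => z [l yz _]; split=> -[m xm].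
    by exists (m + l); apply: path_length_cat xm (path_length_sym yz).
  by exists (m + l); apply: path_length_cat xm yz.
by exists 0; exact: path_length_nil.
Qed.

Lemma dist_adherent x y (e : R) : 0 < e -> exists2 l, path_length X x y l & l < d x y + e.
Proof.
move=> e0; apply: inf_adherent => //; split; first exact: path_exists.
by exists 0 => l; exact: path_length_ge0.
Qed.

Lemma dist_ge0 x y : 0 <= d x y.
Proof. by apply: lb_le_inf; [exact: path_exists|move=> l; exact: path_length_ge0]. Qed.

Lemma dist_triangle x y z : d x z <= d x y + d y z.
Proof.
apply/ler_addgt0Pl => e e0; have e2 : 0 < e / 2 by rewrite divr_gt0.
have [l xl hl] := dist_adherent x y e2; have [m ym hm] := dist_adherent y z e2.
by apply: le_trans (dist_le (path_length_cat xl ym)) _; lra.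
Qed.

Lemma dist_near x (e : R) : 0 < e -> \forall y \near x, d x y < e.
Proof.
move=> e0; apply: filterS (path_near x e0) => y [l pl le].
exact: le_lt_trans (dist_le pl) le.
Qed.

(** In the smooth piece during which the length [a] is reached, the intermediate value theorem for a
    primitive of the speed provides the point. *)
Lemma path_split x y l : path_length X x y l -> forall a, 0 <= a <= l ->
  exists2 z, path_length X x z a & path_length X z y (l - a).
Proof.
elim=> [a a0|{}l g xl IH sg a /andP[a0 al]].
  have -> : a = 0 by apply/eqP; rewrite eq_le andbC.
  by exists x; rewrite ?subr0; exact: path_length_nil.
have [F PF] := speed_primitive sg; have gF := arc_length_primitive sg PF.
have [al'|la] := leP a l.
  have [|z xz zg] := IH a; first by rewrite a0.
  by exists z => //; rewrite addrAC; exact: path_length_cons.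
have wF : {within `[0, 1], continuous F}.
  by apply: within01_continuous => t; exact: (primitive01_continuous PF).
have [|t] := @IVT _ F 0 1 (F 0 + (a - l)) ler01 wF.
  by rewrite ge_min le_max lerDl subr_ge0 (ltW la)/= ; apply/orP; right; rewrite gF in al; lra.
rewrite in_itv/= => t01 Ft.
(* If the cut falls at an end of the piece, the sign is 0, but the length is 0 as well. *)
have sgE (s b : R) : 0 <= s -> (s = 0 -> b = 0) -> Num.sg s * b = b.
  rewrite le_eqVlt => /predU1P[<- /(_ erefl) ->|s0 _]; first by rewrite mulr0.
  by rewrite gtr0_sg// mul1r.
have i0 : 0 <= (0 : R) <= 1 by rewrite lexx ler01.
have i1 : 0 <= (1 : R) <= 1 by rewrite lexx ler01.
have [t0 t1] := andP t01.
have p0 := path_length_subcurve sg PF i0 t01.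
have p1 := path_length_subcurve sg PF t01 i1.
rewrite sgE ?subr0// in p0; last by move=> ->; rewrite subrr.
rewrite sgE ?subr_ge0// in p1; last by move=> /eqP; rewrite subr_eq0 => /eqP ->; rewrite subrr.
exists (g t).
  by have := path_length_cat xl p0; rewrite Ft; congr (path_length _ _ _ _); lra.
by move: p1; rewrite Ft gF; congr (path_length _ _ _ _); lra.
Qed.

(** The strict inequality leaves room for a path that is longer than the distance, which may not be
    attained; cutting it at length [a] gives the point. *)
Lemma dist_midpoint x y (a b : R) : 0 <= a -> 0 <= b -> d x y < a + b ->
  exists2 z, d x z <= a & d z y <= b.
Proof.
move=> a0 b0 h; have e0 : 0 < a + b - d x y by rewrite subr_gt0.
have [l xl hl] := dist_adherent x y e0.
have [la|al] := leP l a.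
  exists y; last by rewrite distxx.
  exact: le_trans (dist_le xl) la.
have [|z xz zy] := path_split xl (a := a); first by rewrite a0 ltW.
exists z; first exact: dist_le.
by apply: le_trans (dist_le zy) _; lra.
Qed.

End Curves.

(** * The distance induces the manifold topology, and closed balls are compact *)

Section Bump.
Context {R : realType} {n p : nat} (M : smooth_manifold R n).
Variable X : M -> 'rV[R]_(n + p).
Hypothesis spX : spacelike_immersion X.
Hypothesis cM : connected [set: M].
Implicit Types (g : R -> M) (c : chart R n M) (x y z : M).

Local Opaque ip.
Local Notation d := (riemannian_dist X).

Lemma path_lipschitz (f : M -> R) K x y l : path_length X x y l ->
  (forall g (t : R), smooth_curve g -> 0 <= t <= 1 ->
     exists2 D, is_derive t (1 : R) (f \o g) D & D <= K * speed X g t) ->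
  f y - f x <= K * l.
Proof.
move=> xy h; elim: xy; first by rewrite subrr mulr0.
move=> {y}l g _ IH sg; rewrite mulrDr.
suff : f (g 1) - f (g 0) <= K * arc_length X g by move: IH; lra.
apply: (lipschitz_arc_length spX (f := f \o g) (df := dd (1 : R) (f \o g))) => // t t01;
  have [D dD DK] := h g t sg t01; rewrite (dd_val dD) //.
Qed.

Lemma dist_lipschitz (f : M -> R) K x y : 0 <= K ->
  (forall g (t : R), smooth_curve g -> 0 <= t <= 1 ->
     exists2 D, is_derive t (1 : R) (f \o g) D & D <= K * speed X g t) ->
  f y - f x <= K * d x y.
Proof.
move=> K0 h; apply/ler_addgt0Pl => e e0.
have K1 : 0 < K + 1 by rewrite ltr_wpDl.
have [l xy hl] := dist_adherent spX cM x y (divr_gt0 e0 K1).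
apply: (le_trans (path_lipschitz xy h)).
apply: (@le_trans _ _ (K * (d x y + e / (K + 1)))); first by rewrite ler_wpM2l// ltW.
rewrite mulrDr addrC lerD2r mulrA ler_pdivrMr// mulrC.
by rewrite ler_wpM2l ?ltW// ltrDl.
Qed.

(** Squaring the positive part makes it differentiable at 0, where the difference quotient is at
    most [|h|]. *)
Lemma is_derive_sqr_max (s : R) :
  is_derive s (1 : R) (fun s => Num.max 0 s ^+ 2) (2 * Num.max 0 s).
Proof.
have [s0|s0|->] := ltgtP s 0.
- rewrite mulr0; apply: (near_eq_is_derive _ (is_derive_cst (0 : R) s (1 : R))).
  near=> t; rewrite max_l ?expr0n//.
  by apply: ltW; near: t; exact: lt_nbhsl.
- have h := is_deriveX 2 (is_derive_id s (1 : R)).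
  apply: (@near_eq_is_derive _ _ _ (fun t : R => t ^+ 2)).
  + near=> t; rewrite max_r//.
    by apply: ltW; near: t; exact: lt_nbhsr.
  + by move: h => /is_derive_eq; apply; rewrite /GRing.scale/= expr1; ring.
- rewrite mulr0.
  have h : h^-1 *: (((fun s : R => Num.max 0 s ^+ 2) \o shift 0) (h *: (1 : R)) - Num.max 0 0 ^+ 2)
     @[h --> (0 : R)^'] --> (0 : R).
    apply/cvgr0Pnorm_le => e e0; near=> h.
    rewrite /= maxxx expr0n subr0 addr0 /GRing.scale/= mulr1 normrM normfV.
    have h0 : 0 < `|h| by rewrite normr_gt0; near: h; exact: nbhs_dnbhs_neq.
    have he : `|h| <= e by near: h; apply: dnbhs0_le.
    rewrite mulrC ler_pdivrMr// (le_trans _ (ler_wpM2r (ltW h0) he))//.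
    rewrite normrX -expr2 lerXn2r ?nnegrE//.
    by rewrite ger0_norm ?le_max ?lexx// ge_max normr_ge0 ler_norm.
  apply: DeriveDef; first by apply/cvg_ex; exists 0.
  exact/cvg_lim.
Unshelve. all: by end_near. Qed.

(** The Euclidean square is used because the norm of ['rV[R]_n] is a maximum of absolute values,
    which is not differentiable. *)
Definition sqd (u0 u : 'rV[R]_n) : R := \sum_i (u 0 i - u0 0 i) ^+ 2.

Lemma coord_le_sqd u0 u i r : 0 <= r -> sqd u0 u <= r ^+ 2 -> `|u 0 i - u0 0 i| <= r.
Proof.
move=> r0 h; have : (u 0 i - u0 0 i) ^+ 2 <= r ^+ 2.
  apply: le_trans h; rewrite /sqd (bigD1 i)//= lerDl sumr_ge0// => j _; exact: sqr_ge0.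
by rewrite -(real_normK (num_real _)) ler_pXn2r// ?nnegrE.
Qed.

Lemma norm_le_sqd u0 u r : 0 <= r -> sqd u0 u <= r ^+ 2 -> `|u - u0| <= r.
Proof.
move=> r0 h; apply: norm_le_coord => // i j.
by rewrite [i]ord1 !mxE; exact: coord_le_sqd.
Qed.

Lemma cvg_sqd {T : Type} {F : set_system T} {FF : Filter F} u0 (f : T -> 'rV[R]_n) a :
  f @ F --> a -> sqd u0 (f x) @[x --> F] --> sqd u0 a.
Proof.
move=> fa; apply: cvg_big => [|i _]; first exact: add_continuous.
have h : f x 0 i - u0 0 i @[x --> F] --> a 0 i - u0 0 i.
  by apply: cvgB; [exact: cvg_coord|exact: cvg_cst].
exact: (cvgM h h).
Qed.

Lemma sqd_continuous u0 : continuous (sqd u0).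
Proof. by move=> u; have := @cvg_sqd _ (nbhs u) _ u0 id u; apply. Qed.

(* Compares the distance with the bump function max(0, r^2 - |u - u0|^2)^2, which
   is Lipschitz for the induced metric; Hausdorffness makes its extension by zero
   continuously differentiable along curves. *)
Lemma dist_chart_ball c x : atlas c -> chart_dom c x ->
  exists2 r0 : R, 0 < r0 & forall r, 0 < r <= r0 ->
  [/\ [set u | sqd (chart_fun c x) u <= r ^+ 2] `<=` chart_cod c,
      compact (chart_inv c @` [set u | sqd (chart_fun c x) u <= r ^+ 2]) &
  exists2 e : R, 0 < e & forall y, d x y < e ->
    (chart_inv c @` [set u | sqd (chart_fun c x) u <= r ^+ 2]) y].
Proof.
move=> ac cx; set u0 := chart_fun c x; have Cx := chart_cod_fun cx.
have oC : open (chart_cod c) by exact: open_chart_cod.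
have [k k0 nk] := coercive oC (smooth_in_chart spX ac) (fun u v Cu => in_chart_pos spX ac Cu) Cx.
have [r1 /= r10 hr] := (nbhs_ballP u0 _).1 nk.
exists (r1 / 2); first by rewrite divr_gt0.
move=> r /andP[r0 rr1]; pose B : set 'rV[R]_n := [set u | sqd u0 u <= r ^+ 2].
have rr : r < r1 by rewrite (le_lt_trans rr1)// ltr_pdivrMr// ltr_pMr// ltr1n.
have Bball u : B u -> ball u0 r1 u.
  by move=> /(norm_le_sqd (ltW r0)) h; rewrite -ball_normE /ball_/= distrC (le_lt_trans h).
have BC : B `<=` chart_cod c by move=> u /Bball/hr[].
have cB : compact B.
  apply: bounded_closed_compact.
    exists (`|u0| + r); split=> [|t ut u /(norm_le_sqd (ltW r0)) Bu]; first exact: num_real.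
    by rewrite /= -(subrK u0 u) (le_trans (ler_normD _ _))// addrC (le_trans _ (ltW ut))// lerD2l.
  have -> : B = sqd u0 @^-1` [set t | t <= r ^+ 2] by [].
  apply: preimage_closed; last exact: closed_le.
  by move=> u _; exact: sqd_continuous.
have cK : compact (chart_inv c @` B).
  apply: continuous_compact cB; apply: continuous_in_subspaceT => u; rewrite inE => /BC.
  exact: continuous_chart_inv.
split => //; pose K := chart_inv c @` B.
have clK : closed K by apply: compact_closed cK; exact: manifold_hausdorff.
(* The negative of the bump, so that [f y - f x = r ^+ 4] for every [y] outside [K]. *)
pose f y := if y \in chart_dom c then - Num.max 0 (r ^+ 2 - sqd u0 (chart_fun c y)) ^+ 2 else 0.
(* Along a curve the derivative of [f] is at most [2 r^2] times [2 n r |w|], where [w] is the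
   coordinate velocity, and coercivity bounds [|w|] by the speed divided by [Num.sqrt k]. *)
pose L := 4 * n%:R * r ^+ 3 / Num.sqrt k.
have L0 : 0 <= L.
  have r3 : 0 <= r ^+ 3 by apply/exprn_ge0/ltW.
  by apply: divr_ge0 (sqrtr_ge0 _); apply: mulr_ge0 r3; exact: mulr_ge0.
have fK y : ~ K y -> f y = 0.
  rewrite /f; case: ifP => //; rewrite inE => cy Ky; rewrite max_l ?expr0n ?oppr0//.
  rewrite subr_le0 leNgt; apply/negP => /ltW h; apply: Ky; exists (chart_fun c y) => //.
  exact: chart_funK.
have key g (t : R) : smooth_curve g -> 0 <= t <= 1 ->
   exists2 D, is_derive t (1 : R) (f \o g) D & D <= L * speed X g t.
  move=> sg t01; have [cg|ncg] := pselect (chart_dom c (g t)); last first.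
    exists 0; last by rewrite mulr_ge0// sqrtr_ge0.
    apply: (near_eq_is_derive _ (is_derive_cst (0 : R) t (1 : R))).
    have [ctg _] := sg _ t01.
    have : \forall y \near g t, ~ K y.
      apply: open_nbhs_nbhs; split; first exact: closed_openC.
      by move=> [u /BC Cu ut]; apply: ncg; rewrite -ut; have [] := chart_cod_inv Cu.
    move=> nK; have : \forall s \near t, ~ K (g s) by exact: (ctg _ nK).
    by apply: filterS => s Ks; rewrite /= fK.
  have [n1 _ n2] := curve_in_chart spX sg t01 ac cg.
  pose phi := chart_fun c \o g; pose w := dd (1 : R) phi t.
  have [_ dphi] := nbhs_singleton n1; have [_ XE] := nbhs_singleton n2.
  have dp : is_derive t (1 : R) phi w by rewrite /w ddE; apply: derivableP; exact: diff_derivable.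
  pose q s := r ^+ 2 - sqd u0 (phi s).
  pose dq := \sum_i (phi t 0 i - u0 0 i) * w 0 i.
  have dqP : is_derive t (1 : R) q (- (2 * dq)).
    have h i : is_derive t (1 : R) (fun s => (phi s 0 i - u0 0 i) ^+ 2)
       (2 * ((phi t 0 i - u0 0 i) * w 0 i)).
      have h1 : is_derive t (1 : R) (fun s => phi s 0 i - u0 0 i) (w 0 i).
        by have := is_deriveB (is_derive_coord 0 i dp) (is_derive_cst (u0 0 i) t (1 : R)); rewrite subr0.
      have := is_deriveX 2 h1; move=> /is_derive_eq; apply.
      by rewrite /GRing.scale/= expr1; ring.
    rewrite /dq mulr_sumr -sub0r.
    exact: (is_deriveB (is_derive_cst (r ^+ 2) t (1 : R)) (is_derive_sumf h)).
  exists (- (2 * Num.max 0 (q t) * - (2 * dq))).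
    apply: (@near_eq_is_derive _ _ _ (fun s => - Num.max 0 (q s) ^+ 2)).
      by apply: filterS n1 => s [cs _]; rewrite /f /= mem_set.
    apply: is_deriveN.
    exact: (is_derive1_comp (is_derive_sqr_max (q t)) dqP).
  have [q0|q0] := leP (q t) 0.
    by rewrite mulr0 mul0r oppr0 mulr_ge0// sqrtr_ge0.
  have Bt : B (phi t) by rewrite /B /=; rewrite /q in q0; lra.
  have [_ kt] := hr _ (Bball _ Bt).
  have wS : `|w| <= speed X g t / Num.sqrt k.
    rewrite ler_pdivlMr ?sqrtr_gt0// /speed XE -/w mulrC.
    have kw : 0 <= Num.sqrt k * `|w| by rewrite mulr_ge0// sqrtr_ge0.
    rewrite -(ger0_norm kw) -sqrtr_sqr ler_wsqrtr// exprMn (sqr_sqrtr (ltW k0)).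
    exact: kt.
  have dqS : `|dq| <= n%:R * (r * `|w|).
    rewrite (le_trans (ler_norm_sum _ _ _))// mulr_natl -[n in _ *+ n]card_ord -sumr_const.
    apply: ler_sum => i _; rewrite normrM ler_pM// ?coord_le_norm//.
    exact: (coord_le_sqd i (ltW r0) Bt).
  have qr : q t <= r ^+ 2 by rewrite /q gerBl sumr_ge0// => i _; exact: sqr_ge0.
  have q2 : 0 <= 2 * q t by rewrite mulr_ge0// ltW.
  rewrite mulrN opprK (le_trans (ler_norm _))// normrM (ger0_norm q2) normrM ger0_norm//.
  have -> : L * speed X g t = (2 * r ^+ 2) * (2 * (n%:R * (r * (speed X g t / Num.sqrt k)))).
    by rewrite /L; ring.
  apply: ler_pM => //; first by rewrite ler_pM2l.
  rewrite ler_pM2l// (le_trans dqS)//; apply: ler_wpM2l => //.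
  by apply: ler_wpM2l wS; exact: ltW.
have r4 : 0 < r ^+ 4 by rewrite exprn_gt0.
exists (r ^+ 4 / (L + 1)); first by rewrite divr_gt0// ltr_wpDl.
move=> y; rewrite ltr_pdivlMr ?ltr_wpDl// => dy; apply: contrapT => Ky.
have := dist_lipschitz x y L0 key; rewrite (fK _ Ky) /f mem_set//.
have -> : sqd u0 (chart_fun c x) = 0.
  by rewrite /sqd big1// => i _; rewrite subrr expr0n.
rewrite subr0 max_r ?sqr_ge0// -exprM sub0r opprK => h.
have d0 := dist_ge0 spX cM x y.
by move: dy; rewrite mulrDr mulr1; lra.
Qed.

(** With [dist_near], this identifies the manifold topology with that of the distance. *)
Lemma dist_nbhs x (P : M -> Prop) : (\forall y \near x, P y) ->
  exists2 e : R, 0 < e & forall y, d x y < e -> P y.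
Proof.
move=> nP; have cx := chart_at_dom x.
have [r0 r00 h] := dist_chart_ball (chart_at_atlas x) cx.
have [r1 /= r10 hr] := (nbhs_ballP _ _).1 (near_chart_inv cx nP).
pose r := Num.min r0 (r1 / 2).
have rP : 0 < r <= r0 by rewrite lt_min r00 divr_gt0// ge_min lexx.
have [_ _ [e e0 he]] := h _ rP; exists e => // y /he [u Bu <-].
apply: (hr u); rewrite -ball_normE /ball_/= distrC; have [rp _] := andP rP.
apply: le_lt_trans (norm_le_sqd (ltW rp) Bu) _.
by rewrite gt_min ltr_pdivrMr// ltr_pMr// ltr1n orbT.
Qed.

Lemma dist_locally_compact x : exists2 e : R, 0 < e &
  exists2 K : set M, compact K & forall y, d x y <= e -> K y.
Proof.
have [r0 r00 h] := dist_chart_ball (chart_at_atlas x) (chart_at_dom x).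
have [|_ cK [e e0 he]] := h r0; first by rewrite r00 lexx.
exists (e / 2); first by rewrite divr_gt0.
exists (chart_inv (chart_at x) @` [set u | sqd (chart_fun (chart_at x) x) u <= r0 ^+ 2]) => //.
by move=> y ye; apply: he; rewrite (le_lt_trans ye)// ltr_pdivrMr// ltr_pMr// ltr1n.
Qed.

Lemma dist_cvg (s : nat -> M) x : d (s k) x @[k --> \oo] --> 0 -> s k @[k --> \oo] --> x.
Proof.
move=> sx P /dist_nbhs[e e0 he]; have : \forall k \near \oo, d (s k) x < e.
  exact: (cvgr_lt _ sx).
by apply: filterS => k kx; apply: he; rewrite (dist_sym spX).
Qed.

Lemma dist_continuous x : continuous (d x).
Proof.
move=> y; apply/cvgrPdist_lt => e e0.
apply: filterS (dist_near spX y e0) => z yz.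
have := dist_triangle spX cM x y z; have := dist_triangle spX cM x z y.
by rewrite (dist_sym spX z y) ltr_norml => ? ?; apply/andP; split; lra.
Qed.

Hypothesis completeM : complete_metric X.

Lemma geometric_small (c e : R) : 0 < e -> exists N, c / 2 ^+ N < e.
Proof.
move=> e0; have c1 : 0 < `|c| + 1 by rewrite ltr_wpDl.
have ec : 0 < e / (`|c| + 1) by rewrite divr_gt0.
have [N _ hN] := near_infty_natSinv_expn_lt (PosNum ec).
exists N; have := hN N (leqnn N); rewrite /= div1r ltr_pdivlMr// => h.
rewrite (le_lt_trans _ h)// mulrC ler_wpM2l ?invr_ge0 ?exprn_ge0//.
by rewrite (le_trans (ler_norm c))// lerDl.
Qed.

(** Ekeland's principle with slope 1/2. From each point the iteration jumps to a point of [S] that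
    at least halves the gap between [f] and its infimum over [S]. The gap controls the diameter of
    [S], so the iterates are Cauchy. *)
Lemma ekeland (f : M -> R) : M -> continuous f -> (forall x, 0 <= f x) ->
  exists x, forall y, f x <= f y + d x y / 2.
Proof.
move=> o cf f0; pose S x := [set y | f y + d x y / 2 <= f x].
have Sxx x : S x x by rewrite /S /= distxx mul0r addr0.
have Str x y z : S x y -> S y z -> S x z.
  rewrite /S /= => xy yz; have := dist_triangle spX cM x y z.
  by move: xy yz; lra.
pose m x := inf (f @` S x).
have lbm x : has_lbound (f @` S x) by exists 0 => _ [y _ <-].
have mS x y : S x y -> m x <= f y by move=> Sy; apply: ge_inf => //; exists y.
have mm x y : S x y -> m x <= m y.
  move=> Sy; apply: lb_le_inf; first by exists (f y), y.
  by move=> _ [z Sz <-]; apply: mS; exact: Str Sz.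
have nx x : exists y, S x y /\ f y <= (m x + f x) / 2.
  have := mS _ _ (Sxx x); rewrite le_eqVlt => /orP[/eqP mE|mlt].
    by exists x; split => //; rewrite mE; lra.
  have e0 : 0 < (f x - m x) / 2 by rewrite divr_gt0 ?subr_gt0.
  have [|_ [y Sy <-] hy] := inf_adherent e0 (E := f @` S x).
    by split => //; exists (f x), x.
  by exists y; split => //; move: hy; rewrite -/(m x); lra.
have [nxt hn] := choice nx.
pose s k := iter k nxt o; pose c := f o - m o.
have Ss j k : S (s j) (s (j + k)%N).
  elim: k => [|k IH]; first by rewrite addn0.
  by rewrite addnS; apply: Str IH _; have [] := hn (s (j + k)%N).
have gap k : f (s k) - m (s k) <= c / 2 ^+ k.
  elim: k => [|k IH]; first by rewrite expr0 divr1.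
  have [Sn fn] := hn (s k); have := mm _ _ Sn.
  rewrite exprS invfM mulrCA -/(s k.+1); move: fn IH; rewrite -/(s k.+1).
  by move: (c / 2 ^+ k) => z; lra.
have dS j k : d (s j) (s (j + k)%N) <= 2 * (c / 2 ^+ j).
  have := Ss j k; rewrite {1}/S /= => Sjk; have := mS _ _ (Ss j k); have := gap j.
  by move: Sjk; move: (c / 2 ^+ j) => z; lra.
have cauchy e : 0 < e -> exists N : nat, forall j k : nat, (N <= j)%N -> (N <= k)%N ->
    d (s j) (s k) < e.
  move=> e0; have [N hN] := geometric_small (4 * c) e0.
  exists N => j k Nj Nk.
  have := dist_triangle spX cM (s j) (s N) (s k); rewrite (dist_sym spX (s j) (s N)).
  have := dS N (j - N)%N; have := dS N (k - N)%N; rewrite !subnKC//.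
  by move: hN; rewrite -mulrA; move: (c / 2 ^+ N) => z; lra.
have [x sx] := completeM cauchy.
have csx := dist_cvg sx.
have Sx j : S (s j) x.
  have h : f (s k) + d (s j) (s k) / 2 @[k --> \oo] --> f x + d (s j) x / 2.
    apply: cvgD; first exact: (cvg_comp s f csx (cf x)).
    apply: cvgM; last exact: cvg_cst.
    exact: (cvg_comp s (d (s j)) csx (@dist_continuous (s j) x)).
  apply: (cvgr_to_le h); exists j => // k /= jk.
  by have := Ss j (k - j)%N; rewrite subnKC.
(* A better point [y] would lie in every [S (s N)], on which [f] is at least [f (s N)] minus a
   vanishing gap; this forces [f x <= f y]. *)
exists x => y; rewrite leNgt; apply/negP => lt.
have fxy : f x <= f y.
  apply/ler_addgt0Pl => e e0; have [N hN] := geometric_small c e0.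
  have Sy : S (s N) y by apply: Str (Sx N) _; exact: ltW.
  have := mS _ _ Sy; have := gap N; have := Sx N; rewrite {1}/S /= => h.
  by have := dist_ge0 spX cM (s N) x; move: h hN; move: (c / 2 ^+ N) => z; lra.
by have := dist_ge0 spX cM x y; lra.
Qed.

Let CB x (r : R) := [set y | d x y <= r].

Let closed_CB x r : closed (CB x r).
Proof.
have -> : CB x r = d x @^-1` [set t | t <= r] by [].
by apply: preimage_closed; [move=> y _; exact: dist_continuous|exact: closed_le].
Qed.

Let CB_shift x y r r' : compact (CB x r) -> d x y + r' <= r -> compact (CB y r').
Proof.
move=> cx h; apply: (subclosed_compact _ cx); first exact: closed_CB.
by move=> z; rewrite /CB /= => yz; rewrite (le_trans (dist_triangle spX cM x y z))// (le_trans _ h)// lerD2l.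
Qed.

(* The supremum of the radii of the compact balls around a point is
   1-Lipschitz; at a point where it nearly decreases as slowly as possible the
   ball could be enlarged. *)
Lemma closed_ball_compact x r : compact [set y | d x y <= r].
Proof.
rewrite -/(CB x r); apply: contrapT => nc.
(* One noncompact ball bounds the compact radii around every point, so the supremum [rho] is
   finite. *)
pose A y := [set r | compact (CB y r)].
have Aub y : has_ubound (A y).
  exists (d y x + r) => r' /= cr; rewrite leNgt; apply/negP => /ltW h.
  by apply: nc; exact: CB_shift cr h.
have Apos y : exists2 e, 0 < e & A y e.
  have [e e0 [K cK hK]] := dist_locally_compact y; exists e => //.
  by apply: (subclosed_compact _ cK); [exact: closed_CB|exact: hK].
pose rho y := sup (A y).
have Asup y : has_sup (A y) by split => //; have [e _ Ae] := Apos y; exists e.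
have rho_gt0 y : 0 < rho y.
  by have [e e0 Ae] := Apos y; apply: lt_le_trans e0 _; apply: ub_le_sup.
have rhoA y r' : r' < rho y -> compact (CB y r').
  move=> h; have e0 : 0 < rho y - r' by rewrite subr_gt0.
  have [t At ht] := sup_adherent e0 (Asup y).
  by apply: (CB_shift (x := y) At); rewrite distxx add0r ltW//; move: ht; rewrite -/(rho y); lra.
have lip y z : rho y <= rho z + d y z.
  apply: ge_sup; first by have [] := Asup y.
  move=> t At; rewrite -lerBlDr; apply: ub_le_sup => //.
  by apply: (CB_shift (x := y) At); rewrite addrC subrK.
have crho : continuous rho.
  move=> y; apply/cvgrPdist_lt => e e0.
  apply: filterS (dist_near spX y e0) => z yz.
  have := lip y z; have := lip z y; rewrite (dist_sym spX z y) ltr_norml => ? ?.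
  by apply/andP; split; lra.
have [z hz] := ekeland x crho (fun y => ltW (rho_gt0 y)).
have rz := rho_gt0 z.
(* By [hz], [rho w >= 5/8 rho z] for [w] within [3/4 rho z] of [z], so the ball of radius
   [9/16 rho z] around [w] is compact. As [3/4 + 7/16 > 9/8], balls of radius [7/16 rho z] with
   centres in the compact [3/4]-ball cover the [9/8]-ball; the difference [9/16 - 7/16] leaves room
   to move [w]. Compactness is used as near covering, first around each [w] and then over all
   [w]. *)
suff /ub_le_sup : A z (9 / 8 * rho z) by move=> /(_ (Aub z)); rewrite -/(rho z); lra.
have cC : compact (CB z (3 / 4 * rho z)) by apply: rhoA; lra.
rewrite /A /=; apply/compact_near_coveringP => I F P FF hP.
have /compact_near_coveringP/(_ I F (fun i w => forall y, CB z (9 / 8 * rho z) y ->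
    d w y <= 7 / 16 * rho z -> P i y) FF) := cC.
have step : forall w, CB z (3 / 4 * rho z) w -> \forall w' \near w & i \near F,
    forall y, CB z (9 / 8 * rho z) y -> d w' y <= 7 / 16 * rho z -> P i y.
  move=> w zw; have cw : compact (CB w (9 / 16 * rho z)).
    by apply: rhoA; have := hz w; move: zw; rewrite /CB /=; lra.
  have cW : compact (CB w (9 / 16 * rho z) `&` CB z (9 / 8 * rho z)).
    by apply: compact_closedI => //; exact: closed_CB.
  have /compact_near_coveringP/(_ I F P FF) := cW.
  have hP' : forall y, (CB w (9 / 16 * rho z) `&` CB z (9 / 8 * rho z)) y ->
     \forall y' \near y & i \near F, P i y' by move=> y [_ Cy]; exact: hP.
  move=> /(_ hP') nP; have r16 : 0 < rho z / 16 by rewrite divr_gt0.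
  exists ([set w' | d w w' < rho z / 16], [set i | forall y, (CB w (9 / 16 * rho z) `&` CB z (9 / 8 * rho z)) y -> P i y]).
    by split => //; exact: dist_near.
  move=> [w' i] /= [ww' Pi] y Cy wy; apply: Pi; split => //; rewrite /CB /=.
  by have := dist_triangle spX cM w w' y; lra.
move=> /(_ step); apply: filterS => i hi y Cy.
have a0 : 0 <= 3 / 4 * rho z by lra.
have b0 : 0 <= 7 / 16 * rho z by lra.
have [|w zw wy] := dist_midpoint spX cM (x := z) (y := y) a0 b0.
  by move: Cy; rewrite /CB /=; lra.
exact: hi zw _ Cy wy.
Qed.

End Bump.

(** * Maxima of the normal parts, and rigidity *)

Section DefectSemicontinuity.
Context {R : realType} {n p : nat}.
Variables (U : set 'rV[R]_n) (Y : 'rV[R]_n -> 'rV[R]_(n + p)).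
Hypothesis oU : open U.
Hypothesis sY : smooth_on U Y.
Hypothesis posY : forall u v, U u -> v != 0 -> 0 < ip (dd v Y u) (dd v Y u).

Local Opaque ip.

Lemma orthonormal_exists u : U u -> exists E, orthonormal_at Y u E.
Proof.
move=> Uu; have dY : differentiable Y u := smooth_on_differentiable sY Uu.
have ddJ v : dd v Y u = v *m 'J Y u by rewrite ddE deriveEjacobian.
have [|E tE] := @tframe_exists R n p ('J Y u).
  by move=> v v0; rewrite -ddJ; exact: posY.
by exists E => i j; rewrite !ddJ; exact: tE.
Qed.

(** Every [|a i * a j|] is at most the sum of squares, so the entrywise deviations of [G] from the
    identity add up to the loss of positivity. *)
Lemma quadratic_perturbation (G : 'I_n -> 'I_n -> R) (a : 'I_n -> R) :
  (1 - \sum_i \sum_j `|G i j - (i == j)%:R|) * \sum_i a i ^+ 2 <=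
  \sum_i \sum_j a i * a j * G i j.
Proof.
have s0 : 0 <= \sum_i a i ^+ 2 by apply: sumr_ge0 => i _; exact: sqr_ge0.
have as2 i : a i ^+ 2 <= \sum_i a i ^+ 2.
  by rewrite (bigD1 i)//= lerDl sumr_ge0// => j _; exact: sqr_ge0.
have E : \sum_i \sum_j a i * a j * (i == j)%:R = \sum_i a i ^+ 2.
  apply: eq_bigr => i _; rewrite (bigD1 i)//= eqxx mulr1 big1 ?addr0// => j ji.
  by rewrite eq_sym (negbTE ji) mulr0.
rewrite mulrBl mul1r -{1}E lerBlDr -lerBlDl -sumrB mulr_suml; apply: ler_sum => i _.
rewrite -sumrB mulr_suml; apply: ler_sum => j _.
rewrite -mulrBr (le_trans (ler_norm _))// normrM mulrC -opprB normrN.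
apply: ler_wpM2l => //; rewrite normrM; have := as2 i; have := as2 j.
rewrite -(real_normK (num_real (a i))) -(real_normK (num_real (a j))).
move: (`|a i|) (`|a j|) => x y; move: (\sum_i _) => z.
by have := sqr_ge0 (x - y); rewrite sqrrB; nra.
Qed.

(* Completing the square in an orthonormal frame at [u0] bounds the defect at
   nearby points by a continuous function that is sharp at [u0]. *)
Lemma defect_usc {T : Type} {F : set_system T} {FF : ProperFilter F}
    (w : T -> 'rV[R]_(n + p)) (u : T -> 'rV[R]_n) (s : T -> R)
    (w0 : 'rV[R]_(n + p)) (u0 : 'rV[R]_n) (s0 : R) : U u0 ->
  w @ F --> w0 -> u @ F --> u0 -> s @ F --> s0 ->
  (forall th, - ip (w0 - dd th Y u0) (w0 - dd th Y u0) < s0) ->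
  \forall t \near F, forall th, - ip (w t - dd th Y (u t)) (w t - dd th Y (u t)) < s t.
Proof.
move=> Uu0 cw cu cs h.
have [E oE] := orthonormal_exists Uu0.
pose e i := row i E.
have Eu : E \in unitmx := orthonormal_at_unit sY Uu0 oE.
have cD i : dd (e i) Y (u t) @[t --> F] --> dd (e i) Y u0.
  exact: (cvg_comp u (dd (e i) Y) cu (smooth_on_continuous (smooth_on_dd _ sY) Uu0)).
pose G t i j := ip (dd (e i) Y (u t)) (dd (e j) Y (u t)).
have cG i j : G t i j @[t --> F] --> ((i == j)%:R : R).
  by rewrite -oE; exact: (cvg_ip (cD i) (cD j)).
pose eps t := \sum_i \sum_j `|G t i j - (i == j)%:R|.
have ceps : eps t @[t --> F] --> (0 : R).
  have h0 : eps t @[t --> F] --> (\sum_(i < n) \sum_(j < n) `|(i == j)%:R - (i == j)%:R| : R).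
    apply: cvg_big => [|i _]; first exact: add_continuous.
    apply: cvg_big => [|j _]; first exact: add_continuous.
    by apply: cvg_norm; apply: cvgB; [exact: cG|exact: cvg_cst].
  have E0 : (\sum_(i < n) \sum_(j < n) `|(i == j)%:R - (i == j)%:R| : R) = 0.
    by rewrite big1// => i _; rewrite big1// => j _; rewrite subrr normr0.
  by rewrite E0 in h0.
pose b t i := ip (w t) (dd (e i) Y (u t)); pose b0 i := ip w0 (dd (e i) Y u0).
have cb i : b t i @[t --> F] --> b0 i by exact: (cvg_ip cw (cD i)).
(* [b^2 / (1 - eps)] is the maximum over [a] of [2 a b - (1 - eps) a^2]. At [u0], where [eps] is 0,
   [Phi] is the defect of the orthogonal projection of [w0], which [h] bounds. *)
pose Phi t := - ip (w t) (w t) + (\sum_i b t i ^+ 2) / (1 - eps t).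
have cPhi : Phi t @[t --> F] --> - ip w0 w0 + (\sum_i b0 i ^+ 2) / (1 - 0).
  apply: cvgD; first by apply: cvgN; exact: (cvg_ip cw cw).
  apply: cvgM.
    by apply: cvg_big => [|i _]; [exact: add_continuous|exact: (cvgM (cb i) (cb i))].
  apply: cvgV; first by rewrite subr0 oner_neq0.
  by apply: cvgB => //; exact: cvg_cst.
have Phi0 : - ip w0 w0 + (\sum_i b0 i ^+ 2) / (1 - 0) < s0.
  have dY0 : differentiable Y u0 := smooth_on_differentiable sY Uu0.
  pose V := \sum_i b0 i *: dd (e i) Y u0.
  have VE : dd (\sum_i b0 i *: e i) Y u0 = V.
    by rewrite dd_suml//; apply: eq_bigr => i _; rewrite ddZl.
  have wV : ip w0 V = \sum_i b0 i ^+ 2.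
    by rewrite ip_sumr; apply: eq_bigr => i _; rewrite ipZr expr2.
  have VV : ip V V = \sum_i b0 i ^+ 2.
    rewrite ip_suml; apply: eq_bigr => i _; rewrite ip_sumr (bigD1 i)//= big1 => [|j ji].
      by rewrite ipZl ipZr oE eqxx mulr1 addr0 expr2.
    by rewrite ipZl ipZr oE eq_sym (negbTE ji) !mulr0.
  have := h (\sum_i b0 i *: e i); rewrite VE !ipBl !ipBr (ipC V w0) wV VV.
  by rewrite subr0 divr1; move: (ip w0 w0) (\sum_i _) => x y; lra.
have nU : \forall t \near F, U (u t) by apply: cu; exact: open_nbhs_nbhs.
have neps : \forall t \near F, eps t < 1 by apply: (cvgr_lt _ ceps); exact: ltr01.
have nPhi : \forall t \near F, Phi t < s t.
  have c2 : s t - Phi t @[t --> F] --> s0 - (- ip w0 w0 + (\sum_i b0 i ^+ 2) / (1 - 0)).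
    exact: cvgB.
  have : \forall t \near F, 0 < s t - Phi t by apply: (cvgr_gt _ c2); rewrite subr_gt0.
  by apply: filterS => t; rewrite subr_gt0.
apply: filterS3 nU neps nPhi => t Ut et Pt th.
have dYt : differentiable Y (u t) := smooth_on_differentiable sY Ut.
apply: le_lt_trans Pt; pose a i := (th *m invmx E) 0 i.
have thE : dd th Y (u t) = \sum_i a i *: dd (e i) Y (u t).
  have -> : th = \sum_i a i *: e i by rewrite -mulmx_sum_row mulmxKV.
  by rewrite dd_suml//; apply: eq_bigr => i _; rewrite ddZl.
rewrite thE !ipBl !ipBr (ipC _ (w t)) ip_sumr.
have -> : ip (\sum_i a i *: dd (e i) Y (u t)) (\sum_i a i *: dd (e i) Y (u t)) =
    \sum_i \sum_j a i * a j * G t i j.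
  rewrite ip_suml; apply: eq_bigr => i _; rewrite ip_sumr; apply: eq_bigr => j _.
  by rewrite ipZl ipZr mulrA.
have -> : \sum_i ip (w t) (a i *: dd (e i) Y (u t)) = \sum_i a i * b t i.
  by apply: eq_bigr => i _; rewrite ipZr.
have := quadratic_perturbation (G t) a; rewrite -/(eps t).
have k0 : 0 < 1 - eps t by rewrite subr_gt0.
have sq : 2 * (\sum_i a i * b t i) - (1 - eps t) * (\sum_i a i ^+ 2) <=
    (\sum_i b t i ^+ 2) / (1 - eps t).
  rewrite !mulr_sumr mulr_suml -sumrB; apply: ler_sum => i _.
  rewrite ler_pdivlMr// -subr_ge0.
  have -> : b t i ^+ 2 - (2 * (a i * b t i) - (1 - eps t) * a i ^+ 2) * (1 - eps t) =
    (b t i - (1 - eps t) * a i) ^+ 2 by ring.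
  exact: sqr_ge0.
rewrite /Phi; move: sq; move: (ip (w t) (w t)) (\sum_i a i * b t i) => x y.
move: (_ / _) ((1 - eps t) * _) (\sum_i \sum_j _) => z q r; lra.
Qed.

Lemma cvg_dd2 {T : Type} {F : set_system T} {FF : Filter F} (a u : T -> 'rV[R]_n) v u0 :
  U u0 -> a @ F --> v -> u @ F --> u0 ->
  dd (a t) (dd (a t) Y) (u t) @[t --> F] --> dd v (dd v Y) u0.
Proof.
move=> Uu0 av cu.
have E (b x : 'rV[R]_n) : U x -> \sum_i b 0 i *: dd b (dd (delta_mx 0 i) Y) x = dd b (dd b Y) x.
  move=> Ux; rewrite [RHS]dd_basis; last exact: (smooth_on_differentiable (smooth_on_dd _ sY) Ux).
  by apply: eq_bigr => i _; rewrite (dd_comm _ _ oU sY Ux).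
have h : \sum_i (a t) 0 i *: dd (a t) (dd (delta_mx 0 i) Y) (u t) @[t --> F] -->
    \sum_i v 0 i *: dd v (dd (delta_mx 0 i) Y) u0.
  apply: cvg_big => [|i _]; first exact: add_continuous.
  apply: cvgZ; first exact: cvg_coord.
  exact: (cvg_dd_comp oU (smooth_on_dd _ sY) Uu0 av cu).
rewrite E// in h; apply: cvg_near_eq_to h.
have nU : \forall t \near F, U (u t) by apply: cu; exact: open_nbhs_nbhs.
by apply: filterS nU => t; exact: E.
Qed.

Lemma dd2_scale (r : R) w u : U u ->
  dd (r *: w) (dd (r *: w) Y) u = r ^+ 2 *: dd w (dd w Y) u.
Proof.
move=> Uu; rewrite ddZl; last exact: (smooth_on_differentiable (smooth_on_dd _ sY) Uu).
rewrite (dd_comm _ _ oU sY Uu) ddZl; last exact: (smooth_on_differentiable (smooth_on_dd _ sY) Uu).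
by rewrite scalerA expr2.
Qed.

End DefectSemicontinuity.

(** * Attainment of positive suprema of upper semicontinuous functions that vanish at infinity *)

Section MaximumPrinciple.
Context {R : realType} (T : topologicalType).
Variable lt : T -> R -> Prop.
Hypothesis lt_mono : forall x s s', lt x s -> s <= s' -> lt x s'.
Hypothesis lt_open : forall x s, lt x s -> \forall y \near x & s' \near s, lt y s'.
Hypothesis lt_proper : forall e, 0 < e ->
  exists2 K : set T, compact K & forall x, ~ K x -> lt x e.
Hypothesis lt_bounded : forall x, exists s, lt x s.

(* [lt x s] stands for [q x < s], where [q] is upper semicontinuous. *)
Lemma max_attained : (forall x s, 0 < s -> lt x s) \/
  exists x s, [/\ 0 < s, ~ lt x s & forall y s', s < s' -> lt y s'].
Proof.
have [[x1 [s1 [s10 nlt1]]]|none] := pselect (exists x s, 0 < s /\ ~ lt x s); last first.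
  by left => x s s0; apply: contrapT => nlt; apply: none; exists x, s.
right; pose A := [set s | 0 < s /\ exists x, ~ lt x s].
have Aub : has_ubound A.
  have [K cK hK] := lt_proper ltr01.
  have /compact_near_coveringP/(_ _ (+oo) (fun s x => lt x s) _) := cK.
  have h : forall x, K x -> \forall x' \near x & s \near +oo, lt x' s.
    move=> x _; have [s xs] := lt_bounded x; have [[B C] /= [nB nC] BC] := lt_open xs.
    exists (B, [set s' | s <= s']); first by split => //; by apply: nbhs_pinfty_ge; exact: num_real.
    move=> [y s'] /= [By ss']; apply: lt_mono ss'.
    exact: (BC (y, s) (conj By (nbhs_singleton nC))).
  move=> /(_ h) [N [_ hN]].
  exists (Num.max 1 (N + 1)) => s [s0 [x nx]]; rewrite leNgt; apply/negP => sN.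
  apply: nx; have [Kx|nKx] := pselect (K x).
    by apply: (hN s) => //; move: sN; rewrite gt_max => /andP[_]; apply: le_lt_trans; rewrite lerDl.
  by apply: lt_mono (hK _ nKx) _; move: sN; rewrite gt_max => /andP[/ltW].
have A1 : A s1 by split => //; exists x1.
have sA : has_sup A by split => //; exists s1.
pose S := sup A; have S0 : 0 < S by apply: lt_le_trans s10 _; exact: ub_le_sup.
have above y s' : S < s' -> lt y s'.
  move=> Ss; apply: contrapT => ny.
  have : s' <= S by apply: ub_le_sup => //; split; [exact: lt_trans Ss|exists y].
  by rewrite leNgt Ss.
suff [x nx] : exists x, ~ lt x S by exists x, S.
(* If [q < S] held everywhere, compactness would improve it to [q < S - e / 2] on [K], while
   [q < S / 2] outside; then [S] would not be the supremum. *)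
apply: contrapT => none.
have allS x : lt x S by apply: contrapT => nx; apply: none; exists x.
have S2 : 0 < S / 2 by rewrite divr_gt0.
have [K cK hK] := lt_proper S2.
have /compact_near_coveringP/(_ _ (nbhs S) (fun s x => lt x s) _) := cK.
move=> /(_ (fun x _ => lt_open (allS x))) nS.
have nS2 : \forall s \near S, S / 2 < s by apply: lt_nbhsr; rewrite ltr_pdivrMr// ltr_pMr// ltr1n.
have [e /= e0 he] := (nbhs_ballP S _).1 (filterI nS nS2).
have [|hs s2] := he (S - e / 2).
  rewrite /ball/= opprB addrC subrK ger0_norm ?divr_ge0 ?ltW//.
  by rewrite ltr_pdivrMr// ltr_pMr// ltr1n.
have all x : lt x (S - e / 2).
  have [Kx|nKx] := pselect (K x); first exact: hs.
  by apply: lt_mono (hK _ nKx) _; exact: ltW.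
have : S <= S - e / 2.
  apply: ge_sup; first by exists s1.
  move=> s [s0 [x nx]]; rewrite leNgt; apply/negP => h; apply: nx.
  by apply: lt_mono (all x) _; exact: ltW.
by move: e0; lra.
Qed.

End MaximumPrinciple.

(** * From charts to the manifold, and the rigidity argument *)

Section Rigidity.
Context {R : realType} {n p : nat} (M : smooth_manifold R n).
Variable X : M -> 'rV[R]_(n + p).
Hypothesis spX : spacelike_immersion X.
Implicit Types (c : chart R n M) (x y : M).

Local Opaque ip.
Local Notation d := (riemannian_dist X).
Local Notation Y c := (in_chart X c).

(** [L] and [L'] are the derivatives of the two transition maps between [c] and the preferred chart
    at [x]; [Q] and [Q'] are their second derivatives, which add tangent terms only. *)
Lemma chart_change c x : atlas c -> chart_dom c x ->
  exists L L' Q Q' : 'rV[R]_n -> 'rV[R]_n, let u := chart_fun c x in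
  [/\ forall v, dd v (Y c) u = dX X x (L v), forall v, dX X x v = dd (L' v) (Y c) u,
      forall v, dd v (dd v (Y c)) u = d2X X x (L v) (L v) + dX X x (Q v),
      forall v, d2X X x v v = dd (L' v) (dd (L' v) (Y c)) u + dd (Q' v) (Y c) u &
      forall v, v != 0 -> L v != 0 /\ L' v != 0].
Proof.
move=> ac cx; have ad := chart_at_atlas x; have dx := chart_at_dom x.
have [h1 h2] := transition_derive spX ac ad cx dx.
have [k1 k2] := transition_derive spX ad ac dx cx.
pose tau := chart_fun (chart_at x) \o chart_inv c.
pose tau' := chart_fun c \o chart_inv (chart_at x).
exists (fun v => dd v tau (chart_fun c x)), (fun v => dd v tau' (Defs.coord x)),
  (fun v => dd v (dd v tau) (chart_fun c x)), (fun v => dd v (dd v tau') (Defs.coord x)); split.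
- by move=> v; rewrite dXE h1.
- by move=> v; rewrite dXE k1.
- by move=> v; rewrite dXE h2.
- by move=> v; rewrite /d2X k2.
- move=> v v0; split; apply: contraNneq v0 => E.
    by rewrite -(transition_derive_inv ac ad cx dx v) -/tau E dd0l.
  by rewrite -(transition_derive_inv ad ac dx cx v) -/tau' E dd0l.
Qed.

Lemma dX_linear x : linear (dX X x).
Proof.
move=> a v w; have dY : differentiable (Y (chart_at x)) (Defs.coord x).
  exact: smooth_on_differentiable (smooth_in_chart spX (chart_at_atlas x)) (coord_cod x).
by rewrite !dXE ddDl// ddZl.
Qed.

Lemma dXB x v w : dX X x (v - w) = dX X x v - dX X x w.
Proof. by rewrite addrC -scaleN1r dX_linear scaleN1r addrC. Qed.

Lemma dXZ x a v : dX X x (a *: v) = a *: dX X x v.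
Proof. by have := dX_linear x a v 0; rewrite addr0 => ->; rewrite [dX X x 0]dXE dd0l addr0. Qed.

Lemma normal_in_chart c x z : atlas c -> chart_dom c x ->
  normal_at (Y c) (chart_fun c x) z <-> normal X x z.
Proof.
move=> ac cx; have [L [L' [_ [_ [h k _ _ _]]]]] := chart_change ac cx.
by split=> nz v; [rewrite k|rewrite h]; exact: nz.
Qed.

Lemma tangent_in_chart c x w : atlas c -> chart_dom c x ->
  tangent_at (Y c) (chart_fun c x) w <-> exists v, w = dX X x v.
Proof.
move=> ac cx; have [L [L' [_ [_ [h k _ _ _]]]]] := chart_change ac cx.
by split=> -[v ->]; [exists (L v); rewrite h|exists (L' v); rewrite k].
Qed.

Lemma orthogonal_normal_tangent x w : (forall z, normal X x z -> ip w z = 0) ->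
  exists v, w = dX X x v.
Proof.
move=> h; have [nz [v wE]] := normal_partP spX x w; exists v.
rewrite {1}wE (normal_ip_eq0 spX nz) ?addr0//.
by have := h _ nz; rewrite {1}wE ipDl nz add0r => ->.
Qed.

Lemma defect_le0_tangent x w : (forall v, - ip (w - dX X x v) (w - dX X x v) <= 0) ->
  exists v, w = dX X x v.
Proof.
move=> h; have [nz [v wE]] := normal_partP spX x w; exists v.
rewrite {1}wE (normal_ip_eq0 spX nz) ?addr0//.
by have := h v; rewrite {1 2}wE [_ + normal_part _ _ _]addrC addrK oppr_le0.
Qed.

Section Maxima.
Variable o : M.
Hypothesis cM : connected [set: M].
Hypothesis completeM : complete_metric X.
Hypothesis shX : self_shrinker X.
Hypothesis A0 : converges_to_zero_at_infinity X o (norm_A X).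

Lemma norm_A_proper C e : 0 <= C -> 0 < e ->
  exists2 K : set M, compact K & forall x, ~ K x -> C * norm_A X x ^+ 2 < e.
Proof.
move=> C0 e0; have C1 : 0 < C + 1 by rewrite ltr_wpDl.
(* The bound 1 gives [|A|^2 <= |A|], and the other bound then suffices. *)
have d0 : 0 < Num.min 1 (e / (C + 1)) by rewrite lt_min ltr01 divr_gt0.
have [r hr] := A0 d0; exists [set y | d o y <= r].
  exact: closed_ball_compact.
move=> x /negP; rewrite -ltNge (dist_sym spX) => /hr.
have a0 : 0 <= norm_A X x by exact: sqrtr_ge0.
rewrite ger0_norm// lt_min => /andP[a1 ae]; move: ae; rewrite ltr_pdivlMr//.
by move: (norm_A X x) a0 a1 => a; nra.
Qed.

Definition position_lt x s := forall v, - ip (X x - dX X x v) (X x - dX X x v) < s.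

Lemma near_position_lt x s : position_lt x s ->
  \forall y \near x & s' \near s, position_lt y s'.
Proof.
move=> h; have ac := chart_at_atlas x; have cx := chart_at_dom x.
pose c := chart_at x; pose u (z : M * R) := chart_fun c z.1.
have oC : open (chart_cod c) by exact: open_chart_cod.
have sY := smooth_in_chart spX ac.
have Cx := chart_cod_fun cx.
have pY v w : chart_cod c v -> w != 0 -> 0 < ip (dd w (Y c) v) (dd w (Y c) v).
  exact: in_chart_pos.
have cu : u z @[z --> (x, s)] --> chart_fun c x.
  apply: (cvg_comp fst (chart_fun c) (cvg_fst (G := nbhs s))).
  exact: continuous_chart_fun.
have cw : Y c (u z) @[z --> (x, s)] --> Y c (chart_fun c x).
  exact: (cvg_comp u (Y c) cu (smooth_on_continuous sY Cx)).
have cs : z.2 @[z --> (x, s)] --> s by exact: cvg_snd.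
have h' th : - ip (Y c (chart_fun c x) - dd th (Y c) (chart_fun c x))
   (Y c (chart_fun c x) - dd th (Y c) (chart_fun c x)) < s.
  by rewrite {1 3}/in_chart /= chart_funK// -dXE; exact: h.
have hd := defect_usc oC sY pY Cx cw cu cs h' (FF := nbhs_pfilter (x, s)).
have nd : \forall z \near (x, s), chart_dom c z.1.
  by exists (chart_dom c, setT); [split; [exact: near_chart_dom|exact: filterT]|move=> z []].
apply: filterS2 nd hd => -[y s'] /= cy hy v.
have [_ [L' [_ [_ [_ k _ _ _]]]]] := chart_change ac cy.
have := hy (L' v); rewrite /u /= -k /in_chart /= chart_funK//.
Qed.

Lemma self_shrinker_in_chart c u : atlas c -> chart_cod c u -> self_shrinker_at (Y c) u.
Proof.
move=> ac Cu; have [cx xu] := chart_cod_inv Cu; set x := chart_inv c u in cx xu.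
have [L [L' [Q [Q' [h k l m _]]]]] := chart_change ac cx; rewrite xu in h k l m.
have [v hv] := shrinker_tangent spX shX x.
have dY : differentiable (Y c) u := smooth_on_differentiable (smooth_in_chart spX ac) Cu.
pose e k := row k (tangent_frame X x).
exists (\matrix_k L' (e k)) => [i j|].
  by rewrite !rowK -!k; exact: tangent_frameP.
exists (L' v - \sum_k Q' (e k)).
rewrite ddDl// ddNl// -k -hv dd_suml//.
under eq_bigr => i _ do rewrite rowK.
rewrite addrAC; congr (_ + _).
rewrite -sumrB; apply: eq_bigr => i _.
by rewrite m addrK.
Qed.

Lemma position_tangent x : exists v, X x = dX X x v.
Proof.
have C0 : 0 <= p%:R * (2 * n%:R) ^+ 2 :> R by rewrite mulr_ge0// sqr_ge0.
have bnd y s : p%:R * (2 * n%:R) ^+ 2 * norm_A X y ^+ 2 < s -> position_lt y s.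
  move=> ys v; apply: le_lt_trans ys.
  by rewrite -mulrA -exprMn; exact: position_defect_le.
have [||||pos0|] := @max_attained R M position_lt.
- by move=> y s s' ys ss' v; exact: lt_le_trans (ys v) ss'.
- exact: near_position_lt.
- move=> e e0; have [K cK hK] := norm_A_proper C0 e0.
  by exists K => // y /hK; exact: bnd.
- move=> y; exists (p%:R * (2 * n%:R) ^+ 2 * norm_A X y ^+ 2 + 1); apply: bnd.
  by rewrite ltrDl.
- apply: defect_le0_tangent => v; apply/ler_addgt0Pl => e e0; rewrite addr0.
  exact: ltW (pos0 x e e0 v).
move=> [y [s [s0 ny hs]]].
have [v hv] : exists v, s <= - ip (X y - dX X y v) (X y - dX X y v).
  apply: contrapT => nv; apply: ny => v; rewrite ltNge; apply/negP => sv.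
  by apply: nv; exists v.
have le_s z w : - ip (X z - dX X z w) (X z - dX X z w) <= s.
  apply/ler_addgt0Pr => e e0; have se : s < s + e by rewrite ltrDl.
  exact: ltW (hs z _ se w).
have ac := chart_at_atlas y; have Cy := coord_cod y.
suff : s <= 0 by rewrite leNgt s0.
apply: (@shrinker_max_defect R n p (chart_cod (chart_at y)) (Y (chart_at y)) _ _ _ (Defs.coord y) v s Cy).
- exact: open_chart_cod.
- exact: smooth_in_chart.
- by move=> u w; exact: in_chart_pos.
- by move=> u; exact: self_shrinker_in_chart.
- apply: filterS (near_chart_cod Cy) => u Cu th.
  have [cx xu] := chart_cod_inv Cu.
  have [L [_ [_ [_ [h _ _ _ _]]]]] := chart_change ac cx; rewrite xu in h.
  by rewrite h; exact: le_s.
- apply/eqP; rewrite eq_le -!dXE /in_chart /= chart_funK ?le_s//; exact: chart_at_dom.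
Qed.

(** Both sides scale with degree 4 in [v], once [th] is scaled with degree 2, so unit coordinate
    vectors suffice. The zero vector is left out because the strict inequality fails there for
    [th = 0]. *)
Definition second_form_lt x s := forall v th, v != 0 ->
  - ip (d2X X x v v - dX X x th) (d2X X x v v - dX X x th) < s * induced_metric X x v v ^+ 2.

Lemma near_second_form_lt x s : second_form_lt x s ->
  \forall y \near x & s' \near s, second_form_lt y s'.
Proof.
move=> h; have ac := chart_at_atlas x; have cx := chart_at_dom x.
pose c := chart_at x; pose S : set 'rV[R]_n := [set v | `|v| = 1].
have oC : open (chart_cod c) by exact: open_chart_cod.
have sY := smooth_in_chart spX ac.
have Cx := chart_cod_fun cx.
have pY v w : chart_cod c v -> w != 0 -> 0 < ip (dd w (Y c) v) (dd w (Y c) v).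
  exact: in_chart_pos.
have cS : compact S.
  apply: bounded_closed_compact.
    by exists 1; split=> [|v v1 w /= ->]; [exact: num_real|exact: ltW].
  have -> : S = (fun v : 'rV[R]_n => `|v|) @^-1` [set 1 : R] by [].
  apply: preimage_closed; last exact: closed_eq.
  by move=> v _; exact: norm_continuous.
have /compact_near_coveringP/(_ _ (nbhs (x, s)) (fun z v => forall th,
    - ip (dd v (dd v (Y c)) (chart_fun c z.1) - dd th (Y c) (chart_fun c z.1))
         (dd v (dd v (Y c)) (chart_fun c z.1) - dd th (Y c) (chart_fun c z.1)) <
    z.2 * ip (dd v (Y c) (chart_fun c z.1)) (dd v (Y c) (chart_fun c z.1)) ^+ 2)) := cS.
have step : forall v, S v -> \forall v' \near v & z \near (x, s), forall th,
    - ip (dd v' (dd v' (Y c)) (chart_fun c z.1) - dd th (Y c) (chart_fun c z.1))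
         (dd v' (dd v' (Y c)) (chart_fun c z.1) - dd th (Y c) (chart_fun c z.1)) <
    z.2 * ip (dd v' (Y c) (chart_fun c z.1)) (dd v' (Y c) (chart_fun c z.1)) ^+ 2.
  move=> v Sv; pose u (z : 'rV[R]_n * (M * R)) := chart_fun c z.2.1.
  pose F := nbhs (v, (x, s)).
  have cx2 : z.2 @[z --> F] --> (x, s) by exact: cvg_snd.
  have cM2 : z.2.1 @[z --> F] --> x.
    exact: (cvg_comp snd fst cx2 (cvg_fst (G := nbhs s))).
  have cs : z.2.2 @[z --> F] --> s.
    exact: (cvg_comp snd snd cx2 (cvg_snd (F := nbhs x))).
  have cv : z.1 @[z --> F] --> v by exact: (cvg_fst (G := nbhs (x, s))).
  have cu : u z @[z --> F] --> chart_fun c x.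
    exact: (cvg_comp (fun z : 'rV[R]_n * (M * R) => z.2.1) (chart_fun c) cM2 (continuous_chart_fun cx)).
  have cw : dd z.1 (dd z.1 (Y c)) (u z) @[z --> F] --> dd v (dd v (Y c)) (chart_fun c x).
    exact: (cvg_dd2 oC sY Cx cv cu).
  have cd : dd z.1 (Y c) (u z) @[z --> F] --> dd v (Y c) (chart_fun c x).
    exact: (cvg_dd_comp oC sY Cx cv cu).
  have cg : ip (dd z.1 (Y c) (u z)) (dd z.1 (Y c) (u z)) @[z --> F] -->
     ip (dd v (Y c) (chart_fun c x)) (dd v (Y c) (chart_fun c x)) by exact: (cvg_ip cd cd).
  have csg : z.2.2 * ip (dd z.1 (Y c) (u z)) (dd z.1 (Y c) (u z)) ^+ 2 @[z --> F] -->
     s * ip (dd v (Y c) (chart_fun c x)) (dd v (Y c) (chart_fun c x)) ^+ 2.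
    by apply: cvgM => //; exact: (cvgM cg cg).
  have h' th : - ip (dd v (dd v (Y c)) (chart_fun c x) - dd th (Y c) (chart_fun c x))
     (dd v (dd v (Y c)) (chart_fun c x) - dd th (Y c) (chart_fun c x)) <
     s * ip (dd v (Y c) (chart_fun c x)) (dd v (Y c) (chart_fun c x)) ^+ 2.
    have v0 : v != 0 by rewrite -normr_eq0 (Sv : `|v| = 1) oner_neq0.
    by have := h v th v0; rewrite /induced_metric !dXE.
  exact: (defect_usc oC sY pY Cx cw cu csg h' (FF := nbhs_pfilter (v, (x, s)))).
move=> /(_ (nbhs_filter (x, s)) step) hd.
have nd : \forall z \near (x, s), chart_dom c z.1.
  by exists (chart_dom c, setT); [split; [exact: near_chart_dom|exact: filterT]|move=> z []].
apply: filterS2 nd hd => -[y s'] /= cy hy v th v0.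
have [L [L' [Q [Q' [_ k _ m nz]]]]] := chart_change ac cy.
have Cy := chart_cod_fun cy.
have dY : differentiable (Y c) (chart_fun c y) := smooth_on_differentiable sY Cy.
have [_ L0] := nz v v0; have r0 : 0 < `|L' v| by rewrite normr_gt0.
pose r := `|L' v|; pose w := r^-1 *: L' v.
have wE : L' v = r *: w by rewrite /w scalerA divff ?gt_eqF// scale1r.
have Sw : S w by rewrite /S/= /w normrZ normfV normr_id mulVf ?gt_eqF.
have r2 : 0 < r ^+ 2 by rewrite exprn_gt0.
pose D := dd w (dd w (Y c)) (chart_fun c y); pose g := ip (dd w (Y c) (chart_fun c y)) (dd w (Y c) (chart_fun c y)).
pose A := dd (L' th) (Y c) (chart_fun c y); pose B := dd (Q' v) (Y c) (chart_fun c y).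
have gE : induced_metric X y v v = r * (r * g).
  by rewrite /induced_metric k wE (ddZl _ _ dY) ipZl ipZr.
have zE : d2X X y v v - dX X y th = r ^+ 2 *: D + B - A.
  by rewrite m k wE (dd2_scale oC sY _ _ Cy).
(* This competitor undoes the normalization of [L' v] and absorbs the tangent term [Q' v] of the
   chart change. *)
have := hy w Sw (r ^- 2 *: (L' th - Q' v)); rewrite gE zE -/D -/g.
rewrite (ddZl _ _ dY) (ddDl _ _ dY) (ddNl _ dY) -/A -/B.
have aux (a b e : 'rV[R]_(n + p)) : a - r ^- 2 *: (b - e) = r ^- 2 *: (r ^+ 2 *: a + e - b).
  by apply/rowP => i; rewrite !mxE; field; rewrite gt_eqF.
rewrite aux.
rewrite ipZl ipZr; move: (ip (_ + _ - _) _) => a.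
have -> : - (r ^- 2 * (r ^- 2 * a)) = - a / (r ^+ 2 * r ^+ 2) by field; rewrite gt_eqF.
rewrite ltr_pdivrMr ?mulr_gt0//.
by have -> : s' * g ^+ 2 * (r ^+ 2 * r ^+ 2) = s' * (r * (r * g)) ^+ 2 by ring.
Qed.

(** The maximum argument treats the diagonal [v = w]; polarization gives the general case. *)
Lemma second_derivative_tangent x v w : exists th, d2X X x v w = dX X x th.
Proof.
have C0 : 0 <= p%:R * (n%:R * n%:R) ^+ 2 :> R by rewrite mulr_ge0// sqr_ge0.
have bnd y s : p%:R * (n%:R * n%:R) ^+ 2 * norm_A X y ^+ 2 < s -> second_form_lt y s.
  move=> ys a th a0; apply: le_lt_trans (second_form_defect_le spX y a th) _.
  have [_ _ /(_ y a a0) g0] := spX.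
  by rewrite ltr_pM2r ?exprn_gt0// exprMn mulrA.
have diag y a : exists th, d2X X y a a = dX X y th.
  have [||||pos0|] := @max_attained R M second_form_lt.
  - move=> z s s' zs ss' b th b0; apply: lt_le_trans (zs b th b0) _.
    by rewrite ler_wpM2r// sqr_ge0.
  - exact: near_second_form_lt.
  - move=> e e0; have [K cK hK] := norm_A_proper C0 e0.
    by exists K => // z /hK; exact: bnd.
  - move=> z; exists (p%:R * (n%:R * n%:R) ^+ 2 * norm_A X z ^+ 2 + 1); apply: bnd.
    by rewrite ltrDl.
  - have [->|a0] := eqVneq a 0; first by exists 0; rewrite /d2X dd0l dXE dd0l.
    apply: defect_le0_tangent => th; apply/ler_addgt0Pr => e e0; rewrite add0r.
    have [_ _ /(_ y a a0) g0] := spX.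
    have g2 : 0 < induced_metric X y a a ^+ 2 by rewrite exprn_gt0.
    have := pos0 y (e / induced_metric X y a a ^+ 2) (divr_gt0 e0 g2) a th a0.
    by rewrite divfK ?gt_eqF//; exact: ltW.
  move=> [z [s [s0 nz hs]]].
  have [b [th [b0 hb]]] : exists b th, b != 0 /\ s * induced_metric X z b b ^+ 2 <=
      - ip (d2X X z b b - dX X z th) (d2X X z b b - dX X z th).
    apply: contrapT => nb; apply: nz => b th b0; rewrite ltNge; apply/negP => sb.
    by apply: nb; exists b, th.
  have le_s u b' t : b' != 0 -> - ip (d2X X u b' b' - dX X u t) (d2X X u b' b' - dX X u t) <=
      s * induced_metric X u b' b' ^+ 2.
    move=> b'0; apply/ler_addgt0Pr => e e0.
    have [_ _ /(_ u b' b'0) g0] := spX.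
    have g2 : 0 < induced_metric X u b' b' ^+ 2 by rewrite exprn_gt0.
    have se : s < s + e / induced_metric X u b' b' ^+ 2 by rewrite ltrDl divr_gt0.
    by have := ltW (hs u _ se b' t b'0); rewrite mulrDl divfK ?gt_eqF.
  have ac := chart_at_atlas z; have Cz := coord_cod z.
  have oC : open (chart_cod (chart_at z)) by exact: open_chart_cod.
  have sY := smooth_in_chart spX ac.
  have dYz : differentiable (Y (chart_at z)) (Defs.coord z) := smooth_on_differentiable sY Cz.
  have [_ _ /(_ z b b0) g0] := spX.
  pose r := Num.sqrt (induced_metric X z b b).
  have r0 : 0 < r by rewrite sqrtr_gt0.
  have r2 : r ^+ 2 = induced_metric X z b b by rewrite sqr_sqrtr// ltW.
  have r20 : r ^+ 2 != 0 by rewrite r2 gt_eqF.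
  suff : s <= 0 by rewrite leNgt s0.
  (* The maximizing direction [b] is normalized to unit length; the correction [th] then scales by
     the square of the factor. *)
  apply: (@tangent_position_max R n p (chart_cod (chart_at z)) (Y (chart_at z)) _ _ _ _
    (Defs.coord z) (r^-1 *: b) (r ^- 2 *: th) s Cz) => //.
  - by move=> u w'; exact: in_chart_pos.
  - move=> u Cu; have [cu uE] := chart_cod_inv Cu; rewrite -{1}uE.
    by apply/(tangent_in_chart _ ac cu); exact: position_tangent.
  - move=> u Cu b' t; have [->|b'0] := eqVneq b' 0.
      rewrite !dd0l sub0r ipNl ipNr opprK ip0l expr0n mulr0 oppr_le0.
      have [->|t0] := eqVneq t 0; first by rewrite dd0l ip0l.
      exact: ltW (in_chart_pos spX ac Cu t0).
    have [cu uE] := chart_cod_inv Cu.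
    have [L [L' [Q [Q' [h _ l _ nz']]]]] := chart_change ac cu; rewrite uE in h l.
    rewrite !h l -addrA -opprB -dXB; apply: le_s.
    by have [] := nz' b' b'0.
  - apply/eqP; rewrite eq_le (dd2_scale oC sY _ _ Cz) ddZl// -exprVn -scalerBr ipZl ipZr.
    rewrite -/(d2X X z b b) -dXE.
    have := hb; have := le_s z b th b0; rewrite -r2.
    move: (ip _ _) => q h1 h2.
    have -> : - (r^-1 ^+ 2 * (r^-1 ^+ 2 * q)) = - q / (r ^+ 2) ^+ 2.
      by field; move: r20; rewrite sqrf_eq0.
    have r4 : 0 < (r ^+ 2) ^+ 2 by rewrite !exprn_gt0.
    by rewrite ler_pdivrMr// ler_pdivlMr// h1 h2.
  - rewrite ddZl// ipZl ipZr -dXE -/(induced_metric X z b b) -r2.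
    by field; move: r20; rewrite sqrf_eq0.
have ac := chart_at_atlas x; have Cx := coord_cod x.
have oC : open (chart_cod (chart_at x)) by exact: open_chart_cod.
have sY := smooth_in_chart spX ac.
have dD a : differentiable (dd a (Y (chart_at x))) (Defs.coord x).
  exact: smooth_on_differentiable (smooth_on_dd a sY) Cx.
have E : d2X X x v w = 2^-1 *: (d2X X x (v + w) (v + w) - d2X X x v v - d2X X x w w).
  have key a : d2X X x (v + w) a = d2X X x v a + d2X X x w a by exact: ddDl.
  have sym a b : d2X X x a b = d2X X x b a by exact: dd_comm oC sY Cx.
  rewrite key (sym v (v + w)) (sym w (v + w)) !key (sym w v).
  move: (d2X X x v v) (d2X X x v w) (d2X X x w w) => a b e.
  by apply/rowP => i; rewrite !mxE; field.
have [t1 e1] := diag x (v + w); have [t2 e2] := diag x v; have [t3 e3] := diag x w.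
by exists (2^-1 *: (t1 - t2 - t3)); rewrite E e1 e2 e3 dXZ !dXB.
Qed.

Lemma normal_space_constant x y z : normal X x z <-> normal X y z.
Proof.
pose P y := forall z, normal X y z <-> normal X x z.
suff h : forall y, P y by have [h1 h2] := h y z; split.
have Px : P x by [].
apply: (connected_locally_constant cM _ Px) => {}y.
have ac := chart_at_atlas y; have cy := chart_at_dom y; have Cy := coord_cod y.
pose c := chart_at y; have oC : open (chart_cod c) by exact: open_chart_cod.
have pY u w : chart_cod c u -> w != 0 -> 0 < ip (dd w (Y c) u) (dd w (Y c) u).
  exact: in_chart_pos.
have tC u : chart_cod c u -> forall v w, tangent_at (Y c) u (dd v (dd w (Y c)) u).
  move=> Cu v w; have [cu uE] := chart_cod_inv Cu; rewrite -uE.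
  apply/(tangent_in_chart _ ac cu).
  have [_ k2] := transition_derive spX ac (chart_at_atlas _) cu (chart_at_dom (chart_inv c u)).
  pose x' := chart_inv c u; pose tau := chart_fun (chart_at x') \o chart_inv c.
  have [th thE] := second_derivative_tangent x' (dd v tau (chart_fun c x')) (dd w tau (chart_fun c x')).
  exists (1 *: th + dd v (dd w tau) (chart_fun c x')).
  by rewrite k2 dX_linear scale1r -thE dXE.
have := tangent_plane_locally_constant oC (smooth_in_chart spX ac) pY Cy tC.
move=> /(near_chart_fun cy); apply: filterS2 (near_chart_dom cy) => w cw [Cw nw].
have e t : normal X w t <-> normal X y t.
  split=> nt.
    by apply/(normal_in_chart _ ac cy)/(nw t)/(normal_in_chart _ ac cw).
  by apply/(normal_in_chart _ ac cw)/(nw t)/(normal_in_chart _ ac cy).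
by split=> h t; [rewrite -e|rewrite e]; exact: h.
Qed.

Lemma tangent_space_constant x y w : exists v, dX X x w = dX X y v.
Proof.
apply: orthogonal_normal_tangent => z nz; have [_ h] := normal_space_constant x y z.
exact: (h nz w).
Qed.

Lemma position_in_plane x : exists v, X x = dX X o v.
Proof.
have [w ->] := position_tangent x; exact: tangent_space_constant.
Qed.

Lemma X_continuous : continuous X.
Proof.
move=> x; have ac := chart_at_atlas x; have cx := chart_at_dom x.
have h : in_chart X (chart_at x) (chart_fun (chart_at x) y) @[y --> x] --> X x.
  have cY : {for chart_fun (chart_at x) x, continuous (Y (chart_at x))}.
    exact: smooth_on_continuous (smooth_in_chart spX ac) (chart_cod_fun cx).
  have := cvg_comp (chart_fun (chart_at x)) _ (continuous_chart_fun cx) cY.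
  by rewrite {2}/in_chart /= chart_funK.
apply: cvg_near_eq_to h; apply: filterS (near_chart_dom cx) => y cy.
by rewrite /in_chart /= chart_funK.
Qed.

(** A coordinate segment bounds the distance from above; the factor [e > 1] absorbs the variation of
    the metric along it. *)
Lemma dist_chart_line_le x v (e : R) : v != 0 -> 1 < e -> \forall t \near (0 : R)^'+,
  chart_cod (chart_at x) (Defs.coord x + t *: v) /\
  d x (chart_inv (chart_at x) (Defs.coord x + t *: v)) <= t * (e * Num.sqrt (induced_metric X x v v)).
Proof.
move=> v0 e1; have ac := chart_at_atlas x; have Cx := coord_cod x.
pose c := chart_at x; pose u0 := Defs.coord x.
have oC : open (chart_cod c) by exact: open_chart_cod.
have sY := smooth_in_chart spX ac.
have [_ _ /(_ x v v0) g0] := spX; pose g := induced_metric X x v v.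
have e0 : 0 < e by exact: lt_trans ltr01 e1.
have cD : {for u0, continuous (dd v (Y c))} := smooth_on_continuous (smooth_on_dd v sY) Cx.
have cg : ip (dd v (Y c) u) (dd v (Y c) u) @[u --> u0] --> g.
  by rewrite /g /induced_metric !dXE; exact: (cvg_ip cD cD).
have ng : \forall u \near u0, ip (dd v (Y c) u) (dd v (Y c) u) < e ^+ 2 * g.
  apply: (cvgr_lt _ cg); rewrite ltr_pMl// expr2.
  by rewrite (lt_le_trans e1)// ler_peMr// ltW.
have [r /= r0 hr] := (nbhs_ballP u0 _).1 (filterI (near_chart_cod Cx) ng).
have v1 : 0 < `|v| by rewrite normr_gt0.
near=> t.
have t0 : 0 < t by [].
have tr : t < r / `|v| by near: t; apply: nbhs_right_lt; rewrite divr_gt0.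
have seg (s : R) : 0 <= s <= 1 -> ball u0 r (u0 + s *: (t *: v)).
  move=> /andP[s0 s1]; rewrite -ball_normE /ball_/= opprD addrA subrr sub0r normrN !normrZ.
  rewrite (ger0_norm s0) (gtr0_norm t0); move: tr; rewrite ltr_pdivlMr//; apply: le_lt_trans.
  by rewrite ler_piMl// mulr_ge0// ltW.
have Cs (s : R) : 0 <= s <= 1 -> chart_cod c (u0 + s *: (t *: v)) by move=> /seg/hr[].
have u1 : u0 + 1 *: (t *: v) = u0 + t *: v by rewrite scale1r.
split; first by rewrite -/u0 -u1; apply: Cs; rewrite ler01 lexx.
have sg := chart_segment ac Cs.
have pl := path_length_curve X sg.
rewrite scale0r addr0 u1 {1}/u0 [chart_inv c (Defs.coord x)]chart_funK in pl; last exact: chart_at_dom.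
apply: (le_trans (dist_le pl)); apply: (arc_length_le spX sg) => s s01.
rewrite chart_segment_speed; have [Cu hu] := hr _ (seg _ s01).
rewrite (ddZl _ _ (smooth_on_differentiable sY Cu)) ipZl ipZr mulrA -expr2.
have tg : 0 <= t * (e * Num.sqrt g) by rewrite !mulr_ge0 ?sqrtr_ge0// ltW.
rewrite -/g -(ger0_norm tg) -sqrtr_sqr ler_wsqrtr// !exprMn sqr_sqrtr; last exact: ltW.
by rewrite ler_wpM2l ?sqr_ge0// ltW.
Unshelve. all: by end_near. Qed.

(* Otherwise, at an almost minimum of the distance of [X] to the missed point,
   moving straight towards it decreases that distance at unit rate. *)
Lemma plane_in_image v : exists x, X x = dX X o v.
Proof.
pose y := dX X o v; pose q x := ip (X x - y) (X x - y).
have tq x : exists w, y - X x = dX X x w.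
  have [a ->] := position_in_plane x; rewrite /y -dXB; exact: tangent_space_constant.
have qE x w : y - X x = dX X x w -> q x = induced_metric X x w w.
  by move=> yE; rewrite /induced_metric -yE /q -opprB ipNl ipNr opprK.
have q0 x w : y - X x = dX X x w -> 0 < q x \/ X x = y.
  move=> yE; have [w0|w0] := eqVneq w 0.
    by right; move: yE; rewrite w0 dXE dd0l => /eqP; rewrite subr_eq0 => /eqP.
  by left; rewrite (qE _ _ yE); have [_ _] := spX; exact.
pose f x := Num.sqrt (q x).
have cf : continuous f.
  move=> x; have cX : X z - y @[z --> x] --> X x - y.
    by apply: cvgB; [exact: X_continuous|exact: cvg_cst].
  have cq : q z @[z --> x] --> q x by exact: (cvg_ip cX cX).
  have h : f z @[z --> x] --> f x.
    by apply: (cvg_comp q Num.sqrt cq); exact: sqrt_continuous.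
  exact: h.
have [x hx] := ekeland spX cM completeM o cf (fun z => sqrtr_ge0 _).
exists x; have [w yE] := tq x; have [qx|] := q0 x w yE; last by [].
exfalso.
pose c := chart_at x; pose u0 := Defs.coord x; pose F := f x.
have ac := chart_at_atlas x; have Cx := coord_cod x.
have F0 : 0 < F by rewrite sqrtr_gt0.
have FF : F ^+ 2 = q x by rewrite sqr_sqrtr// ltW.
have qw : q x = induced_metric X x w w by exact: qE.
have w0 : w != 0.
  by apply: contraTneq qx => w0; rewrite qw w0 /induced_metric dXE dd0l ip0l ltxx.
have xE : chart_inv c u0 = x by exact: chart_funK (chart_at_dom x).
pose W (t : R) := Y c (u0 + t *: w) - y.
have dW : is_derive (0 : R) (1 : R) W (dX X x w).
  have dY : differentiable (Y c) (u0 + (0 : R) *: w).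
    by rewrite (scale0r w) (addr0 u0); exact: smooth_on_differentiable (smooth_in_chart spX ac) Cx.
  have := is_deriveB (is_derive_dd dY) (is_derive_cst y (0 : R) (1 : R)).
  by rewrite subr0 (scale0r w) (addr0 u0) -dXE.
have W0 : W 0 = - dX X x w.
  by rewrite /W (scale0r w) (addr0 u0) /in_chart /= xE -yE opprB.
have dphi := is_derive_ip dW dW.
have cphi := cvg_quotient dphi.
have phi0 : ip (W 0) (W 0) = F ^+ 2 by rewrite W0 ipNl ipNr opprK FF qw.
(* Any constant strictly between 1 and 2 would do. Ekeland's inequality with slope 1/2 lets the
   squared distance decrease at rate at most [5 / 4 * F ^+ 2], whereas its derivative is
   [- 2 * F ^+ 2]. *)
have e54 : 1 < 5 / 4 :> R by lra.
have ns := dist_chart_line_le x w0 e54.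
have : - (5 / 4) * F ^+ 2 <= ip (dX X x w) (W 0) + ip (W 0) (dX X x w).
  apply: (cvgr_to_ge cphi); near=> t.
  have t0 : 0 < t by [].
  have t1 : t < 1 by near: t; exact: nbhs_right_lt.
  have [Ct dt] : chart_cod (chart_at x) (Defs.coord x + t *: w) /\
    d x (chart_inv (chart_at x) (Defs.coord x + t *: w)) <=
    t * (5 / 4 * Num.sqrt (induced_metric X x w w)) by near: t.
  pose z := chart_inv (chart_at x) (Defs.coord x + t *: w).
  have qz : ip (W t) (W t) = f z ^+ 2.
    rewrite sqr_sqrtr//; have [a aE] := tq z.
    by have [/ltW//|zy] := q0 z a aE; rewrite /q zy subrr ip0l.
  have := hx z; rewrite -/F; move: dt; rewrite -/z -qw -/(f x) -/F => dt fz.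
  rewrite phi0 qz /GRing.scale/= ler_pdivlMl//.
  have f1 : F * (1 - 5 / 8 * t) <= f z by move: fz dt; lra.
  have f2 : 0 <= F * (1 - 5 / 8 * t) by rewrite mulr_ge0 ?ltW//; lra.
  have f3 : (F * (1 - 5 / 8 * t)) ^+ 2 <= f z ^+ 2 by rewrite lerXn2r ?nnegrE// (le_trans f2).
  have := sqr_ge0 (F * t); move: f3; rewrite !exprMn; nra.
rewrite W0 ipNl ipNr -/(induced_metric X x w w) -qw -FF.
by have := exprn_gt0 2 F0; lra.
Unshelve. all: by end_near. Qed.

End Maxima.
End Rigidity.

Theorem theorem1p5 (R : realType) (n p : nat) (M : smooth_manifold R n)
    (X : M -> 'rV[R]_(n + p)) (o : M)
    (M_connected : connected [set: M])
    (X_spacelike : spacelike_immersion X)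
    (M_complete : complete_metric X)
    (M_noncompact : ~ compact [set: M])
    (X_shrinker : self_shrinker X)
    (A_to_zero : converges_to_zero_at_infinity X o (norm_A X)) :
  is_spacelike_plane (X @` [set: M]).
Proof.
have J v := dXJ X_spacelike o v.
exists 0, (jacX X o); split.
- apply: inj_row_free => v; rewrite -J => v0.
  have [_ inj _] := X_spacelike; apply: (inj o).
  by rewrite v0 dXE dd0l.
- by move=> v v0; rewrite -J; have [_ _ pos] := X_spacelike; exact: pos.
- apply/seteqP; split => [_ [x _ <-]|_ [v _ <-]].
    have [v xE] := position_in_plane X_spacelike M_connected M_complete X_shrinker A_to_zero x.
    by exists v => //; rewrite add0r -J.
  have [x xE] := plane_in_image X_spacelike M_connected M_complete X_shrinker A_to_zero v.
  by exists x => //; rewrite add0r -J.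
Qed.
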